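(* Let $\{(X_n,Y_n), n\ge 1\}$ be independent and identically distributed bivariate random vectors with distribution function $F$, and suppose that $a_i(t)>0$, $b_i(t)$, $i=1,2$, are real functions such that $$\lim_{t\to\infty}\ \sup_{(x,y)\in\mathbb{R}^2}\bigl|F^t(a_1(t)x+b_1(t),\,a_2(t)y+b_2(t))-H(x,y)\bigr|=0,\qquad H(x,y)=\exp(-\exp(-x)-\exp(-y)),\ x,y\in\mathbb{R}.$$ Let $\{N(t),t\ge 0\}$ be a counting process independent of $\{(X_n,Y_n), n\ge 1\}$ such that $N(t)/t\stackrel{d}{\to}\mathcal{Z}$ as $t\to\infty$, with $\mathcal{Z}$ almost surely positive. Let $p,q\in\mathbb{N}$, let $k_{j1}$ ($1\le j\le p$) and $k_{j2}$ ($1\le j\le q$) be real constants, and put $$S_1(p,t):=\sum_{j=1}^p k_{j1}X_{N(t)-j+1:N(t)},\qquad S_2(q,t):=\sum_{j=1}^q k_{j2}Y_{N(t)-j+1:N(t)},$$ $c_1:=\sum_{j=1}^p k_{j1}$, $c_2:=\sum_{j=1}^q k_{j2}$, $\bar k_{li}:=\frac1l\sum_{j=1}^l k_{ji}$, and $K_l:=K-\sum_{j=1}^l\frac1j$ for $l\ge1$, where $K$ is the Euler–Mascheroni constant. Then, as $t\to\infty$, $$\Biggl(\frac{S_1(p,t)-b_1(t)c_1}{a_1(t)},\ \frac{S_2(q,t)-b_2(t)c_2}{a_2(t)}\Biggr)$$ converges in distribution to $$\Biggl(\sum_{j=1}^{p}\bar k_{j1}E_{j1}+c_1\Bigl[\sum_{j=p+1}^{\infty}\frac{E_{j1}-1}{j}+\ln\mathcal{Z}+K_p\Bigr],\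 \sum_{j=1}^{q}\bar k_{j2}E_{j2}+c_2\Bigl[\sum_{j=q+1}^{\infty}\frac{E_{j2}-1}{j}+\ln\mathcal{Z}+K_q\Bigr]\Biggr),$$ where $E_{ji}$, $j\ge1$, $i=1,2$, are iid unit exponential random variables, independent of $\mathcal{Z}$.
   Context: $X_{1:n}\le\cdots\le X_{n:n}$ denote the order statistics of $X_1,\ldots,X_n$, and $Y_{1:n}\le\cdots\le Y_{n:n}$ those of $Y_1,\ldots,Y_n$ (ordering is done separately in each component); $X_{i:N(t)}$, $Y_{i:N(t)}$ are the same with the random sample size $N(t)$. A counting process here means a stochastic process with values in the non-negative integers. The randomly indexed order statistics are considered on the event $\{N(t)\ge\max(p,q)\}$, whose probability tends to $1$; values elsewhere are irrelevant. The Euler–Mascheroni constant is $K=\lim_{n\to\infty}\bigl(\sum_{l=1}^n\frac1l-\ln n\bigr)$. $\stackrel{d}{\to}$ is convergence in distribution. *)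

(* Defs.v *)
From HB Require Import structures.
From mathcomp Require Import all_boot all_order all_algebra.
From mathcomp Require Import all_classical all_reals all_analysis.

Set Implicit Arguments.
Unset Strict Implicit.
Unset Printing Implicit Defensive.

Import Order.TTheory GRing.Theory Num.Theory.
Import numFieldNormedType.Exports.

Local Open Scope classical_set_scope.
Local Open Scope ring_scope.

(* Mutual independence of the random elements X i, i in D: the product rule
   holds for every finite subfamily. *)
Definition independent_family (R : realType) (d : measure_display)
    (T : measurableType d) (P : probability T R) (d' : measure_display)
    (U : measurableType d') (I : eqType) (D : set I)
    (X : I -> {RV P >-> U}) : Prop :=
  forall (s : seq I) (A : I -> set U),
    uniq s -> [set` s] `<=` D -> (forall i, measurable (A i)) ->
    P (\bigcap_(i in [set` s]) (X i @^-1` A i)) =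
    (\prod_(i <- s) P (X i @^-1` A i))%E.

Definition identically_distributed (R : realType) (d : measure_display)
    (T : measurableType d) (P : probability T R) (d' : measure_display)
    (U : measurableType d') (I : Type) (D : set I)
    (X : I -> {RV P >-> U}) : Prop :=
  forall i j, D i -> D j -> forall A : set U, measurable A ->
    distribution P (X i) A = distribution P (X j) A.

(* The sigma-algebra on T generated by the random elements X i, i in D. *)
Definition sigma_generated (R : realType) (d : measure_display)
    (T : measurableType d) (P : probability T R) (d' : measure_display)
    (U : measurableType d') (I : Type) (D : set I)
    (X : I -> {RV P >-> U}) : set (set T) :=
  <<s \bigcup_(i in D) preimage_set_system setT (X i) measurable >>.

Definition independent_systems (R : realType) (d : measure_display)
    (T : measurableType d) (P : probability T R) (G G' : set (set T)) : Prop :=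
  forall A B, G A -> G' B -> P (A `&` B) = (P A * P B)%E.

Definition joint_cdf (R : realType) (d : measure_display)
    (T : measurableType d) (P : probability T R)
    (V : {RV P >-> (R * R)%type}) (x y : R) : R :=
  fine (distribution P V (`]-oo, x] `*` `]-oo, y])).

(* Convergence in distribution, as t tends to +oo, of X t to Y: convergence of
   the expectations of bounded continuous functions.  The limit may live on
   another probability space. *)
Definition cvg_in_distribution (R : realType) (U : topologicalType)
    (d : measure_display) (T : measurableType d) (P : probability T R)
    (X : R -> T -> U)
    (d' : measure_display) (T' : measurableType d') (Q : probability T' R)
    (Y : T' -> U) : Prop :=
  forall f : U -> R, continuous f -> (exists M : R, forall u, `|f u| <= M) ->
    ('E_P[fun w => f (X t w)])%E @[t --> +oo] --> ('E_Q[fun w => f (Y w)])%E.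

(* x_{i:n}, the i-th smallest (1 <= i <= n) of x_1, ..., x_n; the value x 0 is
   not used. *)
Definition order_stat (R : realType) (x : nat -> R) (i n : nat) : R :=
  nth 0 (sort <=%R [seq x j | j <- iota 1 n]) i.-1.

(* \sum_(1 <= j <= p) k_j x_{n-j+1:n}; the formula is the intended one when
   p <= n, and for smaller n truncated subtraction makes the value arbitrary. *)
Definition upper_order_sum (R : realType) (k : nat -> R) (p : nat)
    (x : nat -> R) (n : nat) : R :=
  \sum_(1 <= j < p.+1) k j * order_stat x (n - j + 1) n.

Definition weight_sum (R : realType) (k : nat -> R) (l : nat) : R :=
  \sum_(1 <= j < l.+1) k j.

Definition weight_mean (R : realType) (k : nat -> R) (l : nat) : R :=
  l%:R^-1 * weight_sum k l.

Definition euler_mascheroni (R : realType) : R :=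
  limn (fun n : nat => \sum_(1 <= l < n.+1) (l%:R : R)^-1 - ln (n%:R : R)).

Definition euler_mascheroni_tail (R : realType) (l : nat) : R :=
  euler_mascheroni R - \sum_(1 <= j < l.+1) (j%:R : R)^-1.

(* H(x, y), the product of two standard Gumbel distribution functions. *)
Definition bigumbel_cdf (R : realType) (x y : R) : R :=
  expR (- expR (- x) - expR (- y)).

(* Partial sums of \sum_(j > p) (e_j - 1) / j. *)
Definition centered_partial_sum (R : realType) (p : nat) (e : nat -> R)
    (n : nat) : R :=
  \sum_(p.+1 <= j < n) (e j - 1) / j%:R.

(* One component of the limit, z being the value of the random factor Z and e_j
   that of the j-th exponential variable.  When the series diverges its limn is
   a default value. *)
Definition limit_component (R : realType) (k : nat -> R) (p : nat)
    (e : nat -> R) (z : R) : R :=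
  \sum_(1 <= j < p.+1) weight_mean k j * e j +
  weight_sum k p *
    (limn (centered_partial_sum p e) + ln z + euler_mascheroni_tail R p).

(* Main.v *)
(* By Renyi's representation, the sums T_j = \sum_(j <= i <= n) e_i / i of unit
   exponentials are distributed like the decreasing order statistics of n
   independent unit exponentials, and \sum_j k_j (T_j - ln n) converges almost
   surely to the component of the limit with z = 1; replacing ln n by ln t shifts
   it by c ln (n / t).  It remains to replace the normalised X_i and Y_i, for a
   deterministic sample size n with n / t in a compact subset of ]0, +oo[, by two
   independent samples of unit exponentials translated by - ln t.  Cut the line
   into finitely many cells and round all values monotonically: order statistics
   commute with rounding, t times the difference of the probabilities of each cell
   of the plane tends to 0 because t (1 - F) --> - ln H, and changing the n pairs
   one at a time costs at most n times the sum of these differences.  This is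
   uniform in n, so one may substitute N(t), independent of the sample, for n, and
   conclude with N(t) / t --> Z. *)
Require Import Defs.
From HB Require Import structures.
From mathcomp Require Import all_boot all_order all_algebra.
From mathcomp Require Import all_classical all_reals all_analysis.
From mathcomp Require Import measurable_realfun.
From mathcomp Require Import lra ring zify.

Set Implicit Arguments.
Unset Strict Implicit.
Unset Printing Implicit Defensive.

Import Order.TTheory GRing.Theory Num.Theory.
Import numFieldNormedType.Exports.

Local Open Scope classical_set_scope.
Local Open Scope ring_scope.

(** * Bounded random variables *)

(** Renyi's representation is never proved as an identity of laws. Two laws on vectors of n cells
    that give the same expectation to all pure powers z(v_1)...z(v_n) agree on symmetric functions,
    so it suffices to know E prod_j h(s + T_j) = (E h(s + xi))^n. This follows by induction on n
    from one explicit primitive, without densities of order statistics. The primitive asks for a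
    continuous h, whence the approximation of functions of cells by continuous ones. Two
    uniformities carry the limits. That of the hypothesis in (x, y) gives the marginal tails, at y =
    +oo, which the unbounded cells require. Bounds uniform in n for a t <= n <= b t allow the
    substitution of N(t). No tightness is proved for the normalised X and Y: the event that the top
    values leave the grid is itself a function of the rounded values, so its probability is
    transported from the exponential model. The almost sure convergence of the series comes from
    second moments of truncated variables over blocks between consecutive cubes, so that
    independence is only applied to bounded functions. *)

Definition bounded_measurable (R : realType) d (T : measurableType d)
  (f : T -> R) := measurable_fun setT f /\ exists M, forall w, `|f w| <= M.

Section bounded_expectation.
Context (R : realType) d (T : measurableType d) (P : probability T R).
Implicit Types f g : T -> R.

Lemma bm_integrable f : bounded_measurable f -> P.-integrable setT (EFin \o f).
Proof.
move=> [mf [M fM]]; apply: measurable_bounded_integrable => //.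
- by rewrite (le_lt_trans (probability_le1 P measurableT))// ltry.
- exists M; split; first by rewrite num_real.
  by move=> x Mx y _; apply: le_trans (fM y) (ltW Mx).
Qed.

Lemma bm_cst c : bounded_measurable (cst c : T -> R).
Proof. by split; [exact: measurable_cst|exists `|c|]. Qed.

Lemma bmD f g : bounded_measurable f -> bounded_measurable g ->
  bounded_measurable (fun w => f w + g w).
Proof.
move=> [mf [M fM]] [mg [M' gM]]; split; first exact: measurable_funD.
by exists (M + M') => w; rewrite (le_trans (ler_normD _ _))// lerD.
Qed.

Lemma bmM f g : bounded_measurable f -> bounded_measurable g ->
  bounded_measurable (fun w => f w * g w).
Proof.
move=> [mf [M fM]] [mg [M' gM]]; split; first exact: measurable_funM.
by exists (M * M') => w; rewrite normrM ler_pM.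
Qed.

Lemma bmZ c f : bounded_measurable f -> bounded_measurable (fun w => c * f w).
Proof. by move=> bf; apply: bmM => //; exact: bm_cst. Qed.

Lemma bmN f : bounded_measurable f -> bounded_measurable (fun w => - f w).
Proof.
move=> [mf [M fM]]; split; first exact: measurable_funN.
by exists M => w; rewrite normrN.
Qed.

Lemma bmB f g : bounded_measurable f -> bounded_measurable g ->
  bounded_measurable (fun w => f w - g w).
Proof. by move=> bf bg; apply: bmD => //; exact: bmN. Qed.

Lemma bm_norm f : bounded_measurable f -> bounded_measurable (fun w => `|f w|).
Proof.
move=> [mf [M fM]]; split; first exact: measurableT_comp.
by exists M => w; rewrite normr_id.
Qed.

Lemma bm_indic A : measurable A -> bounded_measurable (\1_A : T -> R).
Proof.
move=> mA; split; first exact: measurable_indic.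
by exists 1 => w; rewrite indicE; case: (w \in A); rewrite /= ?normr1 ?normr0.
Qed.

Lemma bm_sum (I : Type) (s : seq I) (p : pred I) (F : I -> T -> R) :
  (forall i, p i -> bounded_measurable (F i)) ->
  bounded_measurable (fun w => \sum_(i <- s | p i) F i w).
Proof.
move=> bF; elim: s => [|i s IH].
  rewrite (_ : (fun w => _) = cst 0); first exact: bm_cst.
  by apply/funext => w; rewrite big_nil.
have [pi|pi] := boolP (p i).
  rewrite (_ : (fun w => _) = fun w => F i w + \sum_(j <- s | p j) F j w).
    by apply: bmD => //; exact: bF.
  by apply/funext => w; rewrite big_cons pi.
rewrite (_ : (fun w => _) = fun w => \sum_(j <- s | p j) F j w)//.
by apply/funext => w; rewrite big_cons (negbTE pi).
Qed.

Lemma bm_prod (I : Type) (s : seq I) (p : pred I) (F : I -> T -> R) :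
  (forall i, p i -> bounded_measurable (F i)) ->
  bounded_measurable (fun w => \prod_(i <- s | p i) F i w).
Proof.
move=> bF; elim: s => [|i s IH].
  rewrite (_ : (fun w => _) = cst 1); first exact: bm_cst.
  by apply/funext => w; rewrite big_nil.
have [pi|pi] := boolP (p i).
  rewrite (_ : (fun w => _) = fun w => F i w * \prod_(j <- s | p j) F j w).
    by apply: bmM => //; exact: bF.
  by apply/funext => w; rewrite big_cons pi.
rewrite (_ : (fun w => _) = fun w => \prod_(j <- s | p j) F j w)//.
by apply/funext => w; rewrite big_cons (negbTE pi).
Qed.

Lemma expectation_bm f : bounded_measurable f ->
  ('E_P[f])%E = (\int[P]_w f w)%:E.
Proof.
move=> bf; rewrite unlock /Rintegral fineK//.
exact: integrable_fin_num (bm_integrable bf).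
Qed.

Lemma ex_cst c : \int[P]_w c = c.
Proof. by rewrite Rintegral_cst// [X in fine X]probability_setT mulr1. Qed.

Lemma exD f g : bounded_measurable f -> bounded_measurable g ->
  \int[P]_w (f w + g w) = \int[P]_w f w + \int[P]_w g w.
Proof. by move=> bf bg; apply: RintegralD => //; exact: bm_integrable. Qed.

Lemma exB f g : bounded_measurable f -> bounded_measurable g ->
  \int[P]_w (f w - g w) = \int[P]_w f w - \int[P]_w g w.
Proof. by move=> bf bg; apply: RintegralB => //; exact: bm_integrable. Qed.

Lemma exZ c f : bounded_measurable f ->
  \int[P]_w (c * f w) = c * \int[P]_w f w.
Proof. by move=> bf; apply: RintegralZl => //; exact: bm_integrable. Qed.

Lemma ex_sum (I : Type) (s : seq I) (p : pred I) (F : I -> T -> R) :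
  (forall i, p i -> bounded_measurable (F i)) ->
  \int[P]_w (\sum_(i <- s | p i) F i w) = \sum_(i <- s | p i) \int[P]_w F i w.
Proof.
move=> bF; elim: s => [|i s IH].
  by rewrite big_nil; under [LHS]eq_Rintegral do rewrite big_nil; exact: ex_cst.
rewrite big_cons; under [LHS]eq_Rintegral do rewrite big_cons.
case: ifPn => // pi; rewrite exD ?IH//; first exact: bF.
exact: bm_sum.
Qed.

Lemma ex_le f g : bounded_measurable f -> bounded_measurable g ->
  (forall w, f w <= g w) -> \int[P]_w f w <= \int[P]_w g w.
Proof. by move=> bf bg fg; apply: le_Rintegral => //; exact: bm_integrable. Qed.

Lemma ex_norm f : bounded_measurable f ->
  `|\int[P]_w f w| <= \int[P]_w `|f w|.
Proof. by move=> bf; apply: le_normr_Rintegral => //; exact: bm_integrable. Qed.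

Lemma ex_norm_le f M : bounded_measurable f -> (forall w, `|f w| <= M) ->
  `|\int[P]_w f w| <= M.
Proof.
move=> bf fM; apply: le_trans (ex_norm bf) _; rewrite -[leRHS]ex_cst.
by apply: ex_le => //; [exact: bm_norm|exact: bm_cst].
Qed.

Lemma ex_dist f g h : bounded_measurable f -> bounded_measurable g ->
  bounded_measurable h -> (forall w, `|f w - g w| <= h w) ->
  `|\int[P]_w f w - \int[P]_w g w| <= \int[P]_w h w.
Proof.
move=> bf bg bh fgh; rewrite -exB//; have bfg := bmB bf bg.
by apply: le_trans (ex_norm bfg) _; apply: ex_le => //; exact: bm_norm.
Qed.

Lemma ex_indic A : measurable A -> \int[P]_w \1_A w = fine (P A).
Proof. by move=> mA; rewrite /Rintegral integral_indic// setIT. Qed.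

Lemma ex_ae f g : bounded_measurable f -> bounded_measurable g ->
  {ae P, forall w, f w = g w} -> \int[P]_w f w = \int[P]_w g w.
Proof.
move=> [mf _] [mg _] fg; congr fine; apply: ae_eq_integral => //.
- exact/measurable_EFinP.
- exact/measurable_EFinP.
- by apply: filterS fg => w ->.
Qed.

Lemma ex_cvg (f_ : nat -> T -> R) f M :
  (forall n, measurable_fun setT (f_ n)) -> measurable_fun setT f ->
  (forall n w, `|f_ n w| <= M) ->
  {ae P, forall w, f_ n w @[n --> \oo] --> f w} ->
  \int[P]_w f_ n w @[n --> \oo] --> \int[P]_w f w.
Proof.
move=> mf_ mf fM fcvg.
have mF n : measurable_fun setT (EFin \o f_ n) by exact/measurable_EFinP.
have mf' : measurable_fun setT (EFin \o f) by exact/measurable_EFinP.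
have cF : {ae P, forall w, setT w ->
    (EFin \o f_ n) w @[n --> \oo] --> (EFin \o f) w}.
  by apply: filterS fcvg => w fw _; apply: cvg_EFin => //; exact: nearW.
have iM : P.-integrable setT (EFin \o (cst M : T -> R)).
  by apply: bm_integrable; exact: bm_cst.
have bF : {ae P, forall w n, setT w ->
    (`|(EFin \o f_ n) w| <= (EFin \o (cst M : T -> R)) w)%E}.
  by apply: aeW => w n _ /=; rewrite lee_fin.
have [If _ cv] := dominated_convergence measurableT mF mf' cF iM bF.
rewrite /Rintegral; apply: fine_cvg.
by rewrite fineK//; exact: integrable_fin_num If.
Qed.

End bounded_expectation.

(** * Independence *)

Section independence_fubini.
Context (R : realType) d (T : measurableType d) (P : probability T R).
Context d1 (U1 : measurableType d1) d2 (U2 : measurableType d2).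
Variables (X : {RV P >-> U1}) (Y : {RV P >-> U2}).
Hypothesis XY : forall A B, measurable A -> measurable B ->
  P (X @^-1` A `&` Y @^-1` B) = (P (X @^-1` A) * P (Y @^-1` B))%E.
Variable phi : U1 * U2 -> R.
Hypothesis bphi : bounded_measurable phi.

Let inner (x : U1) : R := \int[P]_w phi (x, Y w).

Let bsec x : bounded_measurable (fun w => phi (x, Y w)).
Proof.
case: bphi => mphi [M phiM]; split; last by exists M.
apply: (measurableT_comp mphi); apply: measurable_fun_pair => //.
Qed.

Let innerE x :
  (inner x)%:E = (\int[distribution P Y]_y (phi (x, y))%:E)%E.
Proof.
rewrite /inner /Rintegral fineK; last first.
  by have := bm_integrable P (bsec x); exact: integrable_fin_num.
rewrite integral_distribution//=.
- apply/measurable_EFinP; case: bphi => mphi _.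
  exact: (measurableT_comp mphi (pair1_measurable x)).
- exact: (bm_integrable P (bsec x)).
Qed.

Lemma bm_inner : bounded_measurable inner.
Proof.
have [mphi [M phiM]] := bphi; split; last first.
  by exists M => x; apply: ex_norm_le => //; exact: bsec.
apply/measurable_EFinP.
rewrite (_ : EFin \o inner =
    fubini_F (distribution P Y) (EFin \o phi)); last first.
  by apply/funext => x /=; rewrite innerE.
apply: (@measurable_fubini_F _ _ _ _ _ (distribution P X)).
exact: (bm_integrable (distribution P X \x distribution P Y)%E bphi).
Qed.

(** The joint law and the product of the laws agree on rectangles, hence everywhere; Fubini's
    theorem then integrates out [Y] first. *)
Lemma ex_indep :
  \int[P]_w phi (X w, Y w) = \int[P]_w (\int[P]_v phi (X w, Y v)).
Proof.
have [mphi [M phiM]] := bphi.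
have mXY : measurable_fun setT (fun w => (X w, Y w)).
  exact: measurable_fun_pair.
pose XYm : {RV P >-> (U1 * U2)%type} :=
  HB.pack (fun w => (X w, Y w)) (isMeasurableFun.Build _ _ _ _ _ mXY).
have mE : measurable_fun setT (EFin \o phi) by exact/measurable_EFinP.
have prodE A : measurable A ->
    (distribution P X \x distribution P Y)%E A = distribution P XYm A.
  apply: product_measure_unique => B C mB mC.
  by rewrite /distribution/= /pushforward /= -XY.
have iphi : (distribution P X \x distribution P Y)%E.-integrable setT
    (EFin \o phi) by exact: bm_integrable.
rewrite /Rintegral; congr fine.
transitivity (\int[distribution P XYm]_z (phi z)%:E)%E.
  rewrite integral_distribution//.
  apply: (bm_integrable P (f := fun w => phi (X w, Y w))); split.
    exact: (measurableT_comp mphi mXY).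
  by exists M.
transitivity (\int[(distribution P X \x distribution P Y)%E]_z (phi z)%:E)%E.
  by apply: eq_measure_integral => A mA _; apply/esym/prodE.
rewrite -(integral12_prod_meas1 iphi) /fubini_F.
transitivity (\int[distribution P X]_x (inner x)%:E)%E.
  by apply: eq_integral => x _; rewrite innerE.
rewrite integral_distribution//.
- by apply/measurable_EFinP; case: bm_inner.
- apply: (bm_integrable P (f := fun w => inner (X w))).
  case: bm_inner => mi [M' iM']; split; last by exists M'.
  exact: (measurableT_comp mi).
Qed.

End independence_fubini.

Section independent_sigma_algebras.
Context (R : realType) d (T : measurableType d) (P : probability T R).
Variables G1 G2 : set (set T).
Hypotheses (G1m : G1 `<=` measurable) (G2m : G2 `<=` measurable).
Hypothesis G12 : independent_systems P <<s G1 >> <<s G2 >>.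
Local Notation T1 := (g_sigma_algebraType G1).
Local Notation T2 := (g_sigma_algebraType G2).

Lemma measurable_fun_g_sigma (G : set (set T)) d' (U : measurableType d')
    (f : T -> U) : G `<=` measurable ->
  measurable_fun setT (f : g_sigma_algebraType G -> U) -> measurable_fun setT f.
Proof.
move=> Gm mf _ B mB; have := mf measurableT B mB.
exact: (@smallest_sub _ _ _ _ (@sigma_algebra_measurable _ T) Gm).
Qed.

Lemma bm_g_sigma (G : set (set T)) (f : T -> R) : G `<=` measurable ->
  bounded_measurable (f : g_sigma_algebraType G -> R) -> bounded_measurable f.
Proof. by move=> Gm [mf bf]; split=> //; exact: measurable_fun_g_sigma mf. Qed.

(* The identity of T, viewed as a random element of T with a smaller
   sigma-algebra, turns independence of sigma-algebras into that of variables. *)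
Lemma ex_indep_sigma (phi : T -> T -> R) :
  bounded_measurable (fun z : T1 * T2 => phi z.1 z.2) ->
  \int[P]_w phi w w = \int[P]_w (\int[P]_v phi w v).
Proof.
move=> bphi.
have m1 : measurable_fun setT (id : T -> T1).
  by apply: (@measurable_fun_g_sigma G1) => //; exact: measurable_id.
have m2 : measurable_fun setT (id : T -> T2).
  by apply: (@measurable_fun_g_sigma G2) => //; exact: measurable_id.
pose X : {RV P >-> T1} := HB.pack (id : T -> T1) (isMeasurableFun.Build _ _ _ _ _ m1).
pose Y : {RV P >-> T2} := HB.pack (id : T -> T2) (isMeasurableFun.Build _ _ _ _ _ m2).
by apply: (@ex_indep _ _ _ P _ _ _ _ X Y _ _ bphi) => A B mA mB; exact: G12.
Qed.

Lemma bm_fst (f : T -> R) : bounded_measurable (f : T1 -> R) ->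
  bounded_measurable (fun z : T1 * T2 => f z.1).
Proof.
move=> [mf [M fM]]; split; last by exists M.
exact: (measurableT_comp mf measurable_fst).
Qed.

Lemma bm_snd (f : T -> R) : bounded_measurable (f : T2 -> R) ->
  bounded_measurable (fun z : T1 * T2 => f z.2).
Proof.
move=> [mf [M fM]]; split; last by exists M.
exact: (measurableT_comp mf measurable_snd).
Qed.

Lemma exM_indep (f g : T -> R) :
  bounded_measurable (f : T1 -> R) -> bounded_measurable (g : T2 -> R) ->
  \int[P]_w (f w * g w) = \int[P]_w f w * \int[P]_w g w.
Proof.
move=> bf bg; rewrite (@ex_indep_sigma (fun w v => f w * g v)); last first.
  by apply: bmM; [exact: bm_fst|exact: bm_snd].
have bf' := bm_g_sigma G1m bf; have bg' := bm_g_sigma G2m bg.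
transitivity (\int[P]_w (\int[P]_v g v * f w)).
  by apply: eq_Rintegral => w _; rewrite exZ// mulrC.
by rewrite exZ// mulrC.
Qed.

End independent_sigma_algebras.

(** * Independence of disjoint blocks of an independent family *)

Section blocks.
Context (R : realType) d (T : measurableType d) (P : probability T R).
Context d' (U : measurableType d') (I : eqType).
Variable (X : I -> {RV P >-> U}).

Definition generators (D : set I) : set (set T) :=
  \bigcup_(i in D) preimage_set_system setT (X i) measurable.

Lemma sigma_generatedE D : sigma_generated D X = <<s generators D >>.
Proof. by []. Qed.

Lemma generators_measurable D : generators D `<=` measurable.
Proof. by move=> _ [i Di] [A mA <-]; exact: measurable_funPT. Qed.

Lemma measurable_generators D i : D i ->
  measurable_fun setT (X i : g_sigma_algebraType (generators D) -> U).
Proof.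
by move=> Di _ B mB; apply: sub_sigma_algebra; exists i => //; exists B.
Qed.

(** Finite-dimensional cylinders: a pi-system generating the sigma-algebra of the block, on which
    independence is exactly the product rule assumed for finite subfamilies. *)
Let cyl (D : set I) : set (set T) := [set C | exists (s : seq I) (A : I -> set U),
  [/\ uniq s, [set` s] `<=` D, forall i, measurable (A i) &
      C = \bigcap_(i in [set` s]) (X i @^-1` A i)]].

Let cyl_measurable D : cyl D `<=` measurable.
Proof.
move=> _ [s [A [us sD mA ->]]]; apply: fin_bigcap_measurable => // i _.
exact: measurable_funPTI.
Qed.

Let cylI D : setI_closed (cyl D).
Proof.
move=> _ _ [s [A [us sD mA ->]]] [t [B [ut tD mB ->]]].
exists (undup (s ++ t)), (fun i => (if i \in s then A i else setT) `&`
  (if i \in t then B i else setT)); split.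
- exact: undup_uniq.
- by move=> i /=; rewrite mem_undup mem_cat => /orP[/sD|/tD].
- by move=> i; apply: measurableI; case: ifP.
- rewrite eqEsubset; split=> w /=.
    move=> [Aw Bw] i; rewrite /= mem_undup mem_cat => ist.
    by split; case: ifPn => //= H; [exact: Aw|exact: Bw].
  move=> Hw; split=> i /= it.
    by have := Hw i; rewrite /= mem_undup mem_cat it => /(_ isT)[].
  by have := Hw i; rewrite /= mem_undup mem_cat it orbT => /(_ isT)[].
Qed.

Let cylT D : cyl D setT.
Proof.
exists [::], (fun=> setT); split => //.
by rewrite eqEsubset; split.
Qed.

Let cyl_gen D : generators D `<=` cyl D.
Proof.
move=> _ [i Di] [A mA <-]; exists [:: i], (fun=> A); split => //.
- by move=> j /=; rewrite inE => /eqP ->.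
- rewrite eqEsubset; split=> w /=.
    by move=> [_ Aw] j /=; rewrite inE => /eqP ->.
  by move=> /(_ i); rewrite /= inE eqxx => /(_ isT).
Qed.

Lemma independent_blocks (D D1 D2 : set I) :
  independent_family D X -> D1 `<=` D -> D2 `<=` D -> D1 `&` D2 = set0 ->
  independent_systems P (sigma_generated D1 X) (sigma_generated D2 X).
Proof.
move=> indep D1D D2D D12.
have cylE A B : cyl D1 A -> cyl D2 B -> P (A `&` B) = (P A * P B)%E.
  move=> [s [A' [us sD mA ->]]] [t [B' [ut tD mB ->]]].
  have st i : i \in s -> i \in t -> False.
    move=> si ti; have : (D1 `&` D2) i by split; [exact: sD|exact: tD].
    by rewrite D12.
  pose C i := if i \in s then A' i else B' i.
  have -> : \bigcap_(i in [set` s]) X i @^-1` A' i =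
            \bigcap_(i in [set` s]) X i @^-1` C i.
    by apply: eq_bigcapr => i /= si; rewrite /C si.
  have -> : \bigcap_(i in [set` t]) X i @^-1` B' i =
            \bigcap_(i in [set` t]) X i @^-1` C i.
    apply: eq_bigcapr => i /= ti; rewrite /C ifN//.
    by apply/negP => si; exact: (st i).
  have mC i : measurable (C i) by rewrite /C; case: ifP.
  have -> : (\bigcap_(i in [set` s]) X i @^-1` C i) `&`
            (\bigcap_(i in [set` t]) X i @^-1` C i) =
            \bigcap_(i in [set` s ++ t]) X i @^-1` C i.
    rewrite eqEsubset; split=> w /=.
      by move=> [sw tw] i /=; rewrite mem_cat => /orP[/sw|/tw].
    by move=> stw; split=> i /= si; apply: stw; rewrite /= mem_cat si ?orbT.
  rewrite !indep ?big_cat//.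
  - by move=> i /= /tD /D2D.
  - by move=> i /= /sD /D1D.
  - rewrite cat_uniq us ut andbT/=; apply/hasPn => i ti.
    by apply/negP => si; exact: (st i).
  - by move=> i /=; rewrite mem_cat => /orP[/sD/D1D|/tD/D2D].
(* For fixed [B] both sides are finite measures in [A] that agree on the pi-system [C], hence on the
   sigma-algebra it generates. This is used twice, first to extend one argument and then the
   other. *)
have step (C : set (set T)) B : C `<=` measurable -> setI_closed C -> C setT ->
    measurable B ->
    (forall A, C A -> P (A `&` B) = (P A * P B)%E) ->
    forall A, <<s C >> A -> P (A `&` B) = (P A * P B)%E.
  move=> Cm CI CT mB CE A sA.
  pose r : {nonneg R} := NngNum (fine_ge0 (measure_ge0 P B)).
  have rE : (r%:num)%:E = P B by rewrite /= fineK// fin_num_measure.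
  have cov : \bigcup_(k : nat) (setT : set T) = setT.
    by rewrite -subTset => x _; exists 0%N.
  have E12 A' : C A' -> mrestr P mB A' = mscale r P A'.
    by move=> /CE; rewrite /mrestr /mscale/= rE muleC.
  have fin (k : nat) : (mrestr P mB setT < +oo)%E.
    by rewrite /mrestr setTI (le_lt_trans (probability_le1 P mB))// ltry.
  have := g_sigma_algebra_measure_unique C Cm _ (fun=> CT) cov _ _ CI E12 fin _ sA.
  by move=> H; rewrite -[LHS]/(mrestr P mB A) [LHS]H -rE muleC.
have sm D0 : sigma_generated D0 X `<=` measurable.
  rewrite sigma_generatedE; apply: smallest_sub.
    exact: sigma_algebra_measurable.
  exact: generators_measurable.
have sc D0 : sigma_generated D0 X `<=` <<s cyl D0 >>.
  apply: smallest_sub; first exact: smallest_sigma_algebra.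
  by apply: subset_trans (@cyl_gen _) _; exact: sub_sigma_algebra.
move=> A B sA sB.
apply: (step (cyl D1)) => //; [exact: sm sB| |exact: sc].
move=> {sA} {}A cA; rewrite setIC muleC.
apply: (step (cyl D2)) => //; [exact: cyl_measurable cA| |exact: sc].
by move=> {sB} {}B cB; rewrite setIC muleC; exact: cylE.
Qed.

End blocks.

(** * Symmetric functions on a finite product *)

Section finite_product_measures.
Context (R : numFieldType).

(** Lindeberg's telescoping: the k-th hybrid has its factors before k from [a] and those after k
    from [b], and the factor at k is the difference. *)
Lemma prod_dist n (a b : 'I_n -> R) :
  (forall i, 0 <= a i) -> (forall i, 0 <= b i) ->
  `|\prod_i a i - \prod_i b i| <=
  \sum_(k < n) \prod_(i < n) (if (i < k)%N then a i else if i == k then `|a i - b i| else b i).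
Proof.
elim: n => [|n IH] in a b * => a0 b0; first by rewrite !big_ord0 subrr normr0.
rewrite !big_ord_recr/=.
set A := \prod_(i < n) a _; set B := \prod_(i < n) b _.
rewrite (_ : A * _ - _ = (A - B) * b ord_max + A * (a ord_max - b ord_max));
  last by ring.
rewrite (le_trans (ler_normD _ _))// !normrM lerD//; last first.
  rewrite ltnn eqxx ger0_norm ?prodr_ge0// ler_wpM2r//.
  by rewrite le_eqVlt; apply/orP; left; apply/eqP/eq_bigr => i _; rewrite ltn_ord.
rewrite (ger0_norm (b0 _)).
apply: le_trans (ler_wpM2r (b0 _) (IH _ _ _ _)) _ => //.
rewrite mulr_suml; apply: ler_sum => k _.
rewrite big_ord_recr/= ltnNge (ltnW (ltn_ord k))/=.
rewrite (_ : (ord_max == _) = false) ?lexx//.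
by apply/negbTE; rewrite -val_eqE/= gtn_eqF.
Qed.

(** After summation over [v] each hybrid factorises, and every factor but the k-th has total mass
    1. *)
Lemma sum_prod_dist (C : finType) n (p q : C -> R) :
  (forall c, 0 <= p c) -> (forall c, 0 <= q c) ->
  \sum_c p c = 1 -> \sum_c q c = 1 ->
  \sum_(v : {ffun 'I_n -> C}) `|\prod_i p (v i) - \prod_i q (v i)|
    <= n%:R * \sum_c `|p c - q c|.
Proof.
move=> p0 q0 p1 q1.
pose g (k i : 'I_n) c :=
  if (i < k)%N then p c else if i == k then `|p c - q c| else q c.
apply: (@le_trans _ _ (\sum_(v : {ffun 'I_n -> C}) \sum_k \prod_i g k i (v i))).
  by apply: ler_sum => v _; exact: prod_dist.
rewrite exchange_big/= (_ : n%:R * _ = \sum_(k < n) \sum_c `|p c - q c|); last first.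
  by rewrite sumr_const card_ord mulr_natl.
apply: ler_sum => k _; rewrite -bigA_distr_bigA/= (bigD1 k)//= [X in _ * X]big1 => [|i ik].
  rewrite mulr1 /g; under eq_bigr do rewrite ltnn eqxx; exact: lexx.
by rewrite /g (negbTE ik); case: (i < k)%N.
Qed.

(* Ryser's formula for permanents: the nonnegative pure powers span all
   symmetric functions. *)
Lemma symmetric_annihilator (C : finType) n (r psi : {ffun 'I_n -> C} -> R) :
  (forall z : C -> R, (forall c, 0 <= z c) ->
    \sum_v r v * \prod_i z (v i) = 0) ->
  (forall (f : {ffun 'I_n -> 'I_n}) (v : {ffun 'I_n -> C}),
    injective f ->
    psi [ffun i => v (f i)] = psi v) ->
  \sum_v r v * psi v = 0.
Proof.
move=> rz psi_sym.
pose comp (u : {ffun 'I_n -> C}) (f : {ffun 'I_n -> 'I_n}) := [ffun i => u (f i)].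
(* Take for z(c) the number of indices i in [S] with u_i = c. Expanding the product over the choices
   of i gives a sum over maps f with values in [S], and only v = u o f survives. *)
have rS u (S : {set 'I_n}) :
    \sum_(f : {ffun 'I_n -> 'I_n}) (\prod_j ((f j \in S)%:R : R)) * r (comp u f) = 0.
  have z0 c : 0 <= \sum_(i in S) ((c == u i)%:R : R) by apply: sumr_ge0.
  rewrite -[RHS](rz _ z0).
  under [RHS]eq_bigr => v _.
    under eq_bigr => j _ do rewrite big_mkcond/=.
    rewrite bigA_distr_bigA/= mulr_sumr.
    over.
  rewrite exchange_big/=; apply: eq_bigr => f _.
  rewrite (bigD1 (comp u f))//= [X in _ + X]big1 ?addr0 => [|v vf].
    rewrite mulrC; congr (_ * _); apply: eq_bigr => j _.
    by rewrite ffunE eqxx; case: ifP.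
  have [j vj] : exists j, v j != u (f j).
    apply/existsP; rewrite -negb_forall; apply: contra vf => /forallP vf.
    by apply/eqP/ffunP => j; rewrite ffunE; exact/eqP.
  by rewrite (bigD1 j)//= (negbTE vj) if_same mul0r mulr0.
(* Inclusion-exclusion over [S]: the alternating sum of the indicators that f takes its values in
   [S] is prod_i (1 + e i), which is 1 when f is onto and 0 otherwise; on a finite set onto and
   injective coincide. *)
have rinj u : \sum_(f : {ffun 'I_n -> 'I_n} | injectiveb f) r (comp u f) = 0.
  have : \sum_(S : {set 'I_n}) (-1) ^+ #|~: S| *
      (\sum_(f : {ffun 'I_n -> 'I_n}) (\prod_j ((f j \in S)%:R : R)) * r (comp u f)) = 0.
    by rewrite big1// => S _; rewrite rS mulr0.
  under eq_bigr do rewrite mulr_sumr.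
  rewrite exchange_big/= => r0; apply: etrans r0; rewrite big_mkcond/=.
  apply: eq_bigr => f _.
  under eq_bigr do rewrite mulrA.
  rewrite -mulr_suml.
  pose e i : R := if i \in codom f then 0 else -1.
  have -> : \sum_(S : {set 'I_n}) (-1) ^+ #|~: S| * (\prod_j ((f j \in S)%:R : R)) =
      \prod_i (1 + e i).
    rewrite bigA_distr/=; apply: eq_bigr => S _.
    have [fS|/forallPn/=[j fj]] := boolP [forall j, f j \in S].
      rewrite [X in _ * X]big1 ?mulr1; last by move=> j _; rewrite (forallP fS).
      rewrite (bigID (mem S))/= [X in X * _]big1 ?mul1r; last by move=> i ->.
      rewrite (eq_bigr (fun=> -1)); last first.
        move=> i iS; rewrite (negbTE iS) /e ifN//; apply: contra iS.
        by move=> /codomP[j ->]; exact: (forallP fS).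
      by rewrite prodr_const; congr (_ ^+ _); apply: eq_card => i; rewrite inE.
    rewrite (bigD1 j)//= (negbTE fj) mul0r mulr0 (bigD1 (f j))//= (negbTE fj).
    by rewrite /e codom_f mul0r.
  have [finj|finj] := boolP (injectiveb f).
    rewrite big1 ?mul1r// => i _; rewrite /e.
    have /injectiveP/injF_bij [g fg gf] := finj.
    by rewrite -{1}(gf i) codom_f addr0.
  have [i ni] : exists i, i \notin codom f.
    apply/existsP; rewrite -negb_forall; apply: contra finj => /forallP sf.
    have /eqP/fintype.image_injP finj : #|codom f| = #|'I_n|.
      by apply: eq_card => i; rewrite sf.
    by apply/injectiveP => x y; exact: finj.
  by rewrite (bigD1 i)//= /e (negbTE ni) subrr mul0r mul0r.
pose inj := [pred f : {ffun 'I_n -> 'I_n} | injectiveb f].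
(* For each injective f the substitution v = u o f leaves the sum unchanged because [psi] is
   symmetric. The total is the wanted sum times the number of injections, which is nonzero because
   of the identity. *)
have : \sum_(f | inj f) \sum_v r v * psi v = 0.
  rewrite (eq_bigr (fun f : {ffun 'I_n -> 'I_n} => \sum_u r (comp u f) * psi u)).
    rewrite exchange_big/=; apply: big1 => u _.
    by rewrite -mulr_suml rinj mul0r.
  move=> f /injectiveP finj; have [g fg gf] := injF_bij finj.
  rewrite (reindex (fun u => comp u f))/=; last first.
    exists (fun u => [ffun i => u (g i)]) => u _.
      by apply/ffunP => i; rewrite !ffunE gf.
    by apply/ffunP => i; rewrite !ffunE fg.
  by apply: eq_bigr => u _; rewrite psi_sym.
rewrite sumr_const => /eqP; rewrite mulrn_eq0 => /orP[/eqP c0|/eqP//].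
have : [ffun i => i] \in inj by apply/injectiveP => i j; rewrite !ffunE.
by rewrite (card0_eq c0).
Qed.

End finite_product_measures.

(** * Order statistics *)

Section order_statistics.
Context (R : realType).
Implicit Types (x y k : nat -> R) (h : R -> R).

Lemma order_stat_perm x y i n :
  perm_eq [seq x j | j <- iota 1 n] [seq y j | j <- iota 1 n] ->
  order_stat x i n = order_stat y i n.
Proof. by move=> /(perm_sortP le_total le_trans le_anti); rewrite /order_stat => ->. Qed.

Lemma order_stat_homo h x i n : {homo h : u v / u <= v} -> (0 < i <= n)%N ->
  order_stat (h \o x) i n = h (order_stat x i n).
Proof.
move=> hh /andP[i0 ilen]; rewrite /order_stat.
set s := [seq x j | j <- iota 1 n].
have -> : [seq (h \o x) j | j <- iota 1 n] = map h s by rewrite -map_comp.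
have -> : sort <=%R (map h s) = map h (sort <=%R s).
  apply: (@le_sorted_eq _ R); first exact: sort_le_sorted.
    by apply: (homo_sorted hh); exact: sort_le_sorted.
  by rewrite perm_sort; apply: perm_map; rewrite perm_sym perm_sort.
by rewrite (nth_map 0)// size_sort size_map size_iota; case: i i0 ilen.
Qed.

Lemma order_stat_homo_le x i j n : (0 < i)%N -> (i <= j)%N -> (j <= n)%N ->
  order_stat x i n <= order_stat x j n.
Proof.
move=> i0 ij jn; rewrite /order_stat; set s := sort _ _.
have sz : size s = n by rewrite size_sort size_map size_iota.
apply: (@le_sorted_leq_nth _ R 0 s); first exact: sort_le_sorted.
- by rewrite inE sz; lia.
- by rewrite inE sz; lia.
- by lia.
Qed.

Lemma order_stat_decreasing x j n :
  (forall i, (0 < i < n)%N -> x i.+1 <= x i) -> (0 < j <= n)%N ->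
  order_stat x (n - j + 1) n = x j.
Proof.
move=> xdec /andP[j0 jn]; rewrite /order_stat.
set s := [seq x i | i <- iota 1 n].
have szs : size s = n by rewrite size_map size_iota.
have srt : sorted <=%R (rev s).
  rewrite rev_sorted; apply/(sortedP 0) => i; rewrite szs => ilt.
  rewrite !(nth_map 0%N) ?size_iota// ?(ltnW ilt)//.
  by rewrite !nth_iota ?(ltnW ilt)// !add1n xdec//=; lia.
have -> : sort <=%R s = rev s.
  apply: (@le_sorted_eq _ R) => //; first exact: sort_le_sorted.
  by rewrite perm_sort perm_sym perm_rev.
rewrite addn1/= nth_rev szs; last by lia.
rewrite (nth_map 0%N) ?size_iota; last by lia.
by rewrite nth_iota; [congr (x _); lia|lia].
Qed.

(** Serves measurability: the event becomes a condition on a finite sum of indicators. *)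
Lemma order_stat_le x i n r : (0 < i <= n)%N ->
  (order_stat x i n <= r) = (i <= count (<= r) [seq x j | j <- iota 1 n])%N.
Proof.
move=> /andP[i0 ilen]; rewrite /order_stat; set s := [seq x j | j <- iota 1 n].
have szs : size (sort <=%R s) = n by rewrite size_sort size_map size_iota.
have cnt : count (<= r) (sort <=%R s) = count (<= r) s.
  by apply/permP; rewrite perm_sort.
apply/idP/idP => H; last first.
  by apply: nth_count_le; [exact: sort_le_sorted|rewrite cnt; lia].
rewrite leqNgt; apply/negP => ci.
have : r < nth 0 (sort <=%R s) i.-1.
  by apply: nth_count_gt; [exact: sort_le_sorted|rewrite cnt szs; lia].
by rewrite ltNge H.
Qed.

Lemma measurable_order_stat d (T : measurableType d) (X : nat -> T -> R) i n :
  (forall j, (0 < j)%N -> measurable_fun setT (X j)) ->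
  measurable_fun setT (fun w => order_stat (X ^~ w) i n).
Proof.
move=> mX.
(* Index 0 reads the same entry as index 1, the position being [i.-1]; beyond [n] the default value
   0 of [nth] is read. *)
wlog i0 : i / (0 < i)%N => [H|].
  by case: i => [|i]; [exact: (H 1%N)|exact: H].
have [ni|ilen] := ltnP n i.
  rewrite (_ : (fun w => _) = cst 0)//; apply/funext => w.
  by rewrite /order_stat nth_default// size_sort size_map size_iota; lia.
move=> mT; apply: (measurability _ (RGenOInfty.measurableE R)) => //.
move=> _ [_ [r ->] <-].
pose c w : R := \sum_(j <- iota 0 n) \1_(X j.+1 @^-1` `]-oo, r]) w.
have cE w : c w = (count (<= r) [seq X j w | j <- iota 1 n])%:R.
  rewrite /c -add1n iotaDl -map_comp count_map -sum1_count natr_sum.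
  rewrite [RHS]big_mkcond/=; apply: eq_bigr => j _; rewrite indicE /= add1n.
  have -> : (w \in X j.+1 @^-1` `]-oo, r]) = (X j.+1 w <= r).
    by apply/idP/idP; rewrite inE /= in_itv.
  by case: ifP.
have mc : measurable_fun setT c.
  have [//] : bounded_measurable c; apply: bm_sum => j _; apply: bm_indic.
  by rewrite -[X in measurable X]setTI; exact: mX.
rewrite (_ : _ `&` _ = [set: T] `&` c @^-1` `]-oo, i%:R[).
  exact: mc.
congr (_ `&` _); apply/seteqP; split=> w /=; rewrite !in_itv/= andbT cE ltr_nat.
  by rewrite ltNge order_stat_le ?i0// -ltnNge.
by move=> H; rewrite ltNge order_stat_le ?i0// -ltnNge.
Qed.

(** The Lipschitz constant of the weighted sum for the maximum norm. *)
Definition abs_weight k p := \sum_(1 <= j < p.+1) `|k j|.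

Lemma measurable_upper_order_sum d (T : measurableType d) (X : nat -> T -> R) k p n :
  (forall j, (0 < j)%N -> measurable_fun setT (X j)) ->
  measurable_fun setT (fun w => upper_order_sum k p (X ^~ w) n).
Proof.
move=> mX; rewrite /upper_order_sum.
apply: measurable_sum => j; apply: measurable_funM => //.
exact: measurable_order_stat.
Qed.

Lemma upper_order_sum_perm k p x y n :
  perm_eq [seq x j | j <- iota 1 n] [seq y j | j <- iota 1 n] ->
  upper_order_sum k p x n = upper_order_sum k p y n.
Proof.
by move=> xy; apply: eq_bigr => j _; rewrite (order_stat_perm _ xy).
Qed.

Lemma upper_order_sum_affine k p x n a b : 0 < a -> (p <= n)%N ->
  upper_order_sum k p (fun j => (x j - b) / a) n =
  (upper_order_sum k p x n - b * weight_sum k p) / a.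
Proof.
move=> a0 pn; rewrite /upper_order_sum /weight_sum mulr_sumr -sumrB mulr_suml.
rewrite !big_nat; apply: eq_bigr => j /andP[j0 jp].
have hh : {homo (fun u => (u - b) / a) : u v / u <= v}.
  by move=> u v uv; rewrite ler_pM2r ?invr_gt0// lerD2r.
have jn : (0 < n - j + 1 <= n)%N by lia.
by rewrite (order_stat_homo x hh jn); ring.
Qed.

Lemma upper_order_sum_decreasing k p x n : (p <= n)%N ->
  (forall i, (0 < i < n)%N -> x i.+1 <= x i) ->
  upper_order_sum k p x n = \sum_(1 <= j < p.+1) k j * x j.
Proof.
move=> pn xdec; rewrite /upper_order_sum !big_nat; apply: eq_bigr => j jp.
by rewrite order_stat_decreasing//; lia.
Qed.

(** By monotonicity the p largest of the n values then all lie in ]u, v]. Nothing is asked of the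
    smaller ones, which drift to -oo after normalisation. *)
Definition top_within u v p x n :=
  (u < order_stat x (n - p + 1) n) && (order_stat x n n <= v).

Lemma upper_order_sum_round k p x n h u v delta : (0 < p <= n)%N ->
  {homo h : a b / a <= b} ->
  (forall a, u < a <= v -> `|h a - a| <= delta) ->
  top_within u v p x n ->
  `|upper_order_sum k p (h \o x) n - upper_order_sum k p x n| <=
  abs_weight k p * delta.
Proof.
move=> /andP[p0 pn] hh hd /andP[ux xv].
rewrite /upper_order_sum -sumrB (le_trans (ler_norm_sum _ _ _))// mulr_suml.
rewrite !big_nat; apply: ler_sum => j /andP[j0 jp].
have jn : (0 < n - j + 1 <= n)%N by lia.
rewrite (order_stat_homo x hh jn) -mulrBr normrM ler_wpM2l// hd//.
apply/andP; split.
  by apply: (lt_le_trans ux); apply: order_stat_homo_le; lia.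
by apply: (le_trans _ xv); apply: order_stat_homo_le; lia.
Qed.

(** Used with u and v at ends of the grid: the event is then a function of the rounded values, so
    the comparison of rounded samples applies to it as well. *)
Lemma top_within_homo u v p x n h : (0 < p <= n)%N ->
  {homo h : a b / a <= b} ->
  (forall a, (u < h a) = (u < a)) -> (forall a, (h a <= v) = (a <= v)) ->
  top_within u v p (h \o x) n = top_within u v p x n.
Proof.
move=> /andP[p0 pn] hh hu hv; rewrite /top_within.
by rewrite !(order_stat_homo x hh) ?hu ?hv//; lia.
Qed.

Lemma top_within_perm u v p x y n :
  perm_eq [seq x j | j <- iota 1 n] [seq y j | j <- iota 1 n] ->
  top_within u v p x n = top_within u v p y n.
Proof. by move=> xy; rewrite /top_within !(order_stat_perm _ xy). Qed.

Lemma top_within_decreasing u v p x n : (0 < p <= n)%N ->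
  (forall i, (0 < i < n)%N -> x i.+1 <= x i) ->
  top_within u v p x n = (u < x p) && (x 1%N <= v).
Proof.
move=> pn xdec; rewrite /top_within order_stat_decreasing//.
rewrite [X in order_stat x X n](_ : n = n - 1 + 1)%N; last by lia.
by rewrite order_stat_decreasing//; lia.
Qed.

End order_statistics.

(** * Renyi's representation *)

Definition unit_exponentials (R : realType) d (T : measurableType d) (Q : probability T R)
    (xi : nat -> {RV Q >-> R}) : Prop :=
  forall j, (0 < j)%N -> forall A : set R, measurable A ->
    distribution Q (xi j) A = exponential_prob 1 A.

Section exponential_law.
Context (R : realType) d (T : measurableType d) (Q : probability T R).
Variable xi : {RV Q >-> R}.
Hypothesis xi_exp : forall A : set R, measurable A ->
  distribution Q xi A = exponential_prob 1 A.
Local Notation mu := (@lebesgue_measure R).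

(* The Lebesgue measure lives on a copy of R with another display. *)
Let xi_mfun : measurable_fun setT (xi : T -> measurableTypeR R).
Proof. by move=> _ B mB; exact: (@measurable_funPT _ _ _ _ xi). Qed.

Let xi' : {RV Q >-> measurableTypeR R} :=
  HB.pack (xi : T -> measurableTypeR R) (isMeasurableFun.Build _ _ _ _ _ xi_mfun).

Lemma exponential_dominated : distribution Q xi' `<< mu.
Proof.
apply/null_content_dominatesP => A mA muA; rewrite [LHS]xi_exp//.
rewrite /exponential_prob.
apply: null_set_integral => //; apply/measurable_EFinP/measurable_funTS.
exact: measurable_exponential_pdf.
Qed.

(** The law is absolutely continuous, and its Radon-Nikodym derivative equals the exponential
    density almost everywhere because both have the same integral over every measurable set. *)
Lemma ex_exponential (g : R -> R) : bounded_measurable g ->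
  \int[Q]_w g (xi w) = \int[mu]_(x in `[0, +oo[) (g x * expR (- x)).
Proof.
move=> bg; have [mg [M gM]] := bg.
have ig : (distribution Q xi').-integrable setT (EFin \o g) by exact: bm_integrable.
have -> : \int[Q]_w g (xi w) = fine (\int[distribution Q xi']_x (g x)%:E).
  rewrite /Rintegral; congr fine; rewrite integral_distribution//.
    exact/measurable_EFinP.
  apply: (bm_integrable Q (f := fun w => g (xi w))); split; last by exists M.
  exact: (measurableT_comp mg).
congr fine.
rewrite -(Radon_Nikodym_change_of_variables exponential_dominated)//=.
transitivity (\int[mu]_x ((g x)%:E * (exponential_pdf 1 x)%:E))%E.
  apply: ae_eq_integral => //.
  - apply: emeasurable_funM; first exact/measurable_EFinP.
    apply: (measurable_int mu).
    by apply: Radon_Nikodym_integrable; exact: exponential_dominated.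
  - apply: emeasurable_funM; first exact/measurable_EFinP.
    by apply/measurable_EFinP; exact: measurable_exponential_pdf.
  - apply: ae_eqe_mul2l => /=.
    rewrite Radon_NikodymE//=; first exact: exponential_dominated.
    move=> abmu.
    case: cid => /= h [h1 h2 h3].
    apply: integral_ae_eq => //=.
    + by apply/measurable_EFinP; exact: measurable_exponential_pdf.
    + by move=> E E01 mE; rewrite -h3//= [LHS]xi_exp.
rewrite [RHS]integral_mkcond; apply: eq_integral => x _.
rewrite /exponential_pdf !patchE; case: ifP => _; last by rewrite mule0.
by rewrite mul1r mulN1r EFinM.
Qed.

End exponential_law.

(** * Primitives against the exponential density *)

Section exponential_tail.
Context (R : realType).
Local Notation mu := (@lebesgue_measure R).

Lemma cvg_expRN : expR (- x : R) @[x --> +oo] --> (0 : R).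
Proof. exact: cvgr_expR. Qed.

Lemma continuous_expRN : continuous (fun x : R => expR (- x)).
Proof.
move=> x; apply: (@continuous_comp _ _ _ (-%R) expR).
  exact: opp_continuous.
exact: continuous_expR.
Qed.

Lemma integral_expRN_lty (M a : R) : 0 <= M ->
  (\int[mu]_(x in `[a, +oo[) (M * expR (- x))%:E < +oo)%E.
Proof.
move=> M0; rewrite (@ge0_continuous_FTC2y _ _ (fun x => - (M * expR (- x))) a 0)//.
- by rewrite -EFinB ltry.
- by move=> x _; rewrite mulr_ge0// expR_ge0.
- apply: continuous_subspaceT => x.
  apply: cvgM; first exact: cvg_cst.
  exact: continuous_expRN.
- rewrite -oppr0; apply: cvgN; rewrite -[X in _ --> X](mulr0 M).
  by apply: cvgM; [exact: cvg_cst|exact: cvg_expRN].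
- apply/cvg_at_right_filter; apply: cvgN; apply: cvgM; first exact: cvg_cst.
  exact: continuous_expRN.
- move=> x _; rewrite derive1E; apply: derive_val.
  by apply: is_derive_eq; rewrite /GRing.scale/=; ring.
Qed.

Lemma cvg_expr (T : Type) (F : set_system T) {FF : Filter F} (f : T -> R) (l : R) n :
  f @ F --> l -> f x ^+ n @[x --> F] --> l ^+ n.
Proof.
move=> fl; elim: n => [|n IH]; first by rewrite expr0; exact: cvg_cst.
by under eq_fun do rewrite exprS; rewrite exprS; exact: cvgM.
Qed.

(** [D] y is the tail integral of h t e^(-t) over t >= y, built as the supremum of the primitive [A]
    started at a, minus [A]. Below a the integral is over an empty interval, whence the restriction
    to y > a. *)
Lemma exponential_primitive (h : R -> R) (M a : R) : continuous h ->
  (forall x, 0 <= h x <= M) ->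
  exists D : R -> R, [/\ forall y, a < y -> is_derive y 1 D (- (h y * expR (- y))),
    D y @[y --> +oo] --> 0 & forall y, a < y -> 0 <= D y].
Proof.
move=> ch hM; pose g t := h t * expR (- t).
have M0 : 0 <= M by have /andP[? ?] := hM 0; lra.
have g0 x : 0 <= g x by rewrite mulr_ge0 ?expR_ge0//; have /andP[] := hM x.
have cg : continuous g.
  move=> x; apply: cvgM; first exact: ch.
  exact: continuous_expRN.
have mg : measurable_fun setT g by exact: continuous_measurable_fun.
have mMe : measurable_fun setT (fun x : R => M * expR (- x)).
  apply: continuous_measurable_fun => x.
  by apply: cvgM; [exact: cvg_cst|exact: continuous_expRN].
have mEg D : measurable_fun D (EFin \o g).
  by apply/measurable_EFinP; apply: measurable_funTS.
pose I := (\int[mu]_(x in `[a, +oo[) (g x)%:E)%E.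
have Ioo : (I < +oo)%E.
  apply: le_lt_trans (integral_expRN_lty a M0).
  apply: ge0_le_integral => //.
  - by move=> x _; rewrite lee_fin.
  - by apply/measurable_EFinP; exact: measurable_funTS.
  - by apply/measurable_EFinP; exact: measurable_funTS.
  - by move=> x _; rewrite lee_fin ler_wpM2r ?expR_ge0//; have /andP[] := hM x.
pose A' x := (\int[mu]_(t in `[a, x]) (g t)%:E)%E.
have A'I x : (A' x <= I)%E.
  by apply: ge0_subset_integral => //; [exact: mEg|move=> t _; rewrite lee_fin|exact: subset_itvl].
have A'0 x : (0 <= A' x)%E by apply: integral_ge0 => t _; rewrite lee_fin.
have A'fin x : A' x \is a fin_num.
  by rewrite ge0_fin_numE//; exact: le_lt_trans (A'I x) Ioo.
pose A x := \int[mu]_(t in `[a, x]) g t.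
have AE x : (A x)%:E = A' x by exact: (fineK (A'fin x)).
have ndA : nondecreasing_fun A.
  move=> x y xy; rewrite -lee_fin !AE.
  by apply: ge0_subset_integral => //; [exact: mEg|move=> t _; rewrite lee_fin|exact: subset_itvl].
have ubA : has_ubound (range A).
  exists (fine I) => _ [x _ <-]; rewrite -lee_fin AE fineK//.
  by rewrite ge0_fin_numE// integral_ge0// => t _; rewrite lee_fin.
have cA := nondecreasing_cvgr ndA ubA.
exists (fun x => sup (range A) - A x); split.
- move=> y ay.
  have ig : mu.-integrable `[a, y + 1] (EFin \o g).
    apply: continuous_compact_integrable; first exact: segment_compact.
    exact: continuous_subspaceT.
  have yy1 : y < y + 1 by rewrite ltrDl.
  have [dA A'E] := continuous_FTC1_closed yy1 ig ay (cg y).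
  have dAy : is_derive y 1 A (g y) by rewrite -A'E derive1E; exact/derivableP.
  apply: is_derive_eq.
  by rewrite add0r mul1r.
- by rewrite -[X in _ --> X](subrr (sup (range A))); apply: cvgB => //; exact: cvg_cst.
- by move=> y _; rewrite subr_ge0; apply: ub_le_sup => //; exists y.
Qed.

(** With y = s + x / (n+1), the integrand is the derivative in x of - (e^s D(y))^(n+1): the factor
    n+1 of the power cancels the derivative of y, and (n+1) s - y = n y - x turns the exponentials
    into those of [B] y ^+ n and e^(-x). This primitive vanishes at +oo. *)
Lemma exponential_recursion (h D : R -> R) (M a s : R) n : continuous h ->
  (forall x, 0 <= h x) ->
  (forall y, a < y -> is_derive y 1 D (- (h y * expR (- y)))) ->
  D y @[y --> +oo] --> 0 -> (forall y, a < y -> 0 <= D y) -> a < s ->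
  let B y := expR y * D y in
  \int[mu]_(x in `[0, +oo[)
    (h (s + x / n.+1%:R) * B (s + x / n.+1%:R) ^+ n * expR (- x)) = B s ^+ n.+1.
Proof.
move=> ch h0 dD D0 Dge as_ B.
pose y (x : R) := s + x / n.+1%:R.
have ay x : 0 <= x -> a < y x.
  by move=> x0; rewrite (lt_le_trans as_)// lerDl divr_ge0.
have dy (x : R) : is_derive x 1 y n.+1%:R^-1.
  apply: is_derive_eq.
  by rewrite scaler0 scaler0 !add0r mul1r /GRing.scale/= mulr1.
have cDy (x : R) : 0 <= x -> {for x, continuous (D \o y)}.
  move=> x0; apply: differentiable_continuous; apply/derivable1_diffP.
  have := @is_derive1_comp _ D y x _ _ (dD _ (ay _ x0)) (dy x).
  by case.
have cy : continuous y.
  move=> x; apply: differentiable_continuous; apply/derivable1_diffP.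
  by case: (dy x).
pose f x := h (y x) * B (y x) ^+ n * expR (- x).
pose F x := - (expR s ^+ n.+1 * (D (y x)) ^+ n.+1).
have dF (x : R) : 0 <= x -> is_derive x 1 F (f x).
  move=> x0.
  have dDy := @is_derive1_comp _ D y x _ _ (dD _ (ay _ x0)) (dy x).
  have -> : F = - ((expR s ^+ n.+1) \*: ((D \o y) ^+ n.+1)).
    by apply/funext => z; rewrite /F !fctE.
  apply: is_derive_eq; rewrite /GRing.scale/= /f /B exprMn.
  have e1 : expR s ^+ n.+1 * expR (- y x) = expR (y x) ^+ n * expR (- x).
    rewrite -!expRM_natl -!expRD; congr expR; rewrite /y -natr1.
    by field; rewrite natr1 pnatr_eq0.
  have n1 : n.+1%:R != 0 :> R by rewrite pnatr_eq0.
  rewrite [RHS](_ : _ = h (y x) * D (y x) ^+ n * (expR (y x) ^+ n * expR (- x)));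
    last by ring.
  by rewrite -e1; field.
rewrite (@Rintegral_ge0_continuous_FTC2y _ f F 0 0).
- by rewrite /F /y mul0r addr0 sub0r opprK /B exprMn.
- move=> x x0; rewrite !mulr_ge0 ?expR_ge0// exprn_ge0// mulr_ge0 ?expR_ge0//.
  exact/Dge/ay.
- apply: continuous_in_subspaceT => x; rewrite inE/= in_itv/= andbT => x0.
  apply: cvgM; last exact: continuous_expRN.
  apply: cvgM; first exact: (continuous_comp (cy x) (ch (y x))).
  apply: cvg_expr; apply: cvgM; last exact: cDy.
  exact: (continuous_comp (cy x) (@continuous_expR R (y x))).
- rewrite -oppr0; apply: cvgN; rewrite -[X in _ --> X](mulr0 (expR s ^+ n.+1)).
  apply: cvgM; first exact: cvg_cst.
  rewrite -[X in _ --> X](expr0n _ n.+1); apply: cvg_expr.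
  apply: (@cvg_comp _ _ _ y D _ (pinfty_nbhs R)) => //.
  rewrite /y; apply/cvgryPge => A; exists ((A - s) * n.+1%:R).
  by split=> [|x /ltW xA]; rewrite ?num_real// -lerBlDl ler_pdivlMr ?ltr0n.
- by move=> x x0; case: (dF x (ltW x0)).
- apply/cvg_at_right_filter; apply: differentiable_continuous.
  by apply/derivable1_diffP; case: (dF 0 (lexx _)).
- move=> x; rewrite in_itv/= andbT => x0; rewrite derive1E.
  by have [_] := dF x (ltW x0).
Qed.

End exponential_tail.

Lemma measurable_sum_nat (R : realType) d (T : measurableType d) (F : nat -> T -> R) a b :
  (forall i, (a <= i < b)%N -> measurable_fun setT (F i)) ->
  measurable_fun setT (fun w => \sum_(a <= i < b) F i w).
Proof.
move=> mF; rewrite (_ : (fun w => _) = fun w => \sum_(a <= i < b)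
    if (a <= i < b)%N then F i w else 0).
  by apply: measurable_sum => i; case: (boolP (a <= i < b)%N) => ab; [exact: mF|exact: measurable_cst].
by apply/funext => w; rewrite !big_nat; apply: eq_bigr => i ->.
Qed.

Definition renyi (R : realType) (e : nat -> R) (n j : nat) : R :=
  \sum_(j <= i < n.+1) e i / i%:R.

Lemma measurable_renyi (R : realType) d (T : measurableType d) (e : nat -> T -> R) n j :
  (forall i, (0 < i <= n)%N -> measurable_fun setT (e i)) -> (0 < j)%N ->
  measurable_fun setT (fun w => renyi (e ^~ w) n j).
Proof.
move=> me j0; apply: measurable_sum_nat => i ij.
by apply: measurable_funM; [apply: me; lia|exact: measurable_cst].
Qed.

Lemma cvg_prod_seq (R : realType) (I : Type) (s : seq I) (T : Type) (F : set_system T)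
    {FF : Filter F} (f : I -> T -> R) (l : I -> R) :
  (forall i, f i x @[x --> F] --> l i) ->
  \prod_(i <- s) f i x @[x --> F] --> \prod_(i <- s) l i.
Proof.
move=> fl; elim: s => [|i s IH].
  by under eq_fun do rewrite big_nil; rewrite big_nil; exact: cvg_cst.
by under eq_fun do rewrite big_cons; rewrite big_cons; exact: cvgM.
Qed.

Section renyi_product.
Context (R : realType) d (T : measurableType d) (Q : probability T R).
Variable xi : nat -> {RV Q >-> R}.
Hypothesis xi_indep : independent_family [set n | (0 < n)%N] xi.
Hypothesis xi_exp : unit_exponentials xi.
Local Notation mu := (@lebesgue_measure R).

Section continuous_factor.
Variables (h : R -> R) (M : R).
Hypotheses (ch : continuous h) (hM : forall x, 0 <= h x <= M).

Let mh : measurable_fun setT h := continuous_measurable_fun ch.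

Lemma bm_continuous_comp d' (T' : measurableType d') (f : T' -> R) :
  measurable_fun setT f -> bounded_measurable (fun w => h (f w)).
Proof.
move=> mf; split; first exact: (measurableT_comp mh).
by exists M => w; have /andP[h0 hm] := hM (f w); rewrite ger0_norm.
Qed.

Lemma bm_renyi_product d' (T' : measurableType d') (e : nat -> T' -> R) (y : T' -> R) n :
  (forall i, (0 < i <= n)%N -> measurable_fun setT (e i)) -> measurable_fun setT y ->
  bounded_measurable (fun w => \prod_(1 <= j < n.+1) h (y w + renyi (e ^~ w) n j)).
Proof.
move=> me my.
rewrite (_ : (fun w => _) = fun w => \prod_(1 <= j < n.+1 | (0 < j)%N)
    h (y w + renyi (e ^~ w) n j)).
  apply: bm_prod => j j0; apply: bm_continuous_comp.
  by apply: measurable_funD => //; exact: measurable_renyi.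
apply/funext => z; rewrite [LHS]big_nat [RHS]big_nat_cond; apply: eq_bigl => j.
by case: j => //= j; rewrite andbT.
Qed.

Let b (s : R) := \int[Q]_w h (s + xi 1 w).

(** The case n = 0 of the recursion; it identifies the expectation with e^s [D] s whatever base
    point a < s was chosen. *)
Let bE (s a : R) (D : R -> R) :
  (forall y, a < y -> is_derive y 1 D (- (h y * expR (- y)))) ->
  D y @[y --> +oo] --> 0 -> (forall y, a < y -> 0 <= D y) -> a < s ->
  b s = expR s * D s.
Proof.
move=> dD D0 Dge as_; rewrite /b.
have h0 x : 0 <= h x by case/andP : (hM x).
rewrite (@ex_exponential _ _ _ Q (xi 1) (xi_exp _) (fun x => h (s + x)))//; last first.
  by apply: bm_continuous_comp; apply: measurable_funD.
have := @exponential_recursion R h D M a s 0 ch h0 dD D0 Dge as_.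
rewrite /= expr1 => <-; apply: eq_Rintegral => x _.
by rewrite expr0 mulr1 divr1.
Qed.

Let bb : bounded_measurable b.
Proof.
have bphi : bounded_measurable (fun z : R * R => h (z.1 + z.2)).
  by apply: bm_continuous_comp; apply: measurable_funD.
exact: (bm_inner (xi 1) (xi 1) bphi).
Qed.

(* If b s = E h(s + xi), then e^(-s) b s has derivative - h s e^(-s), so that the
   integrand times e^(-x) is a derivative in x. *)
Let b_recursion s n :
  \int[Q]_w (h (s + xi n.+1 w / n.+1%:R) * b (s + xi n.+1 w / n.+1%:R) ^+ n) =
  b s ^+ n.+1.
Proof.
have h0 x : 0 <= h x by case/andP : (hM x).
(* A base point strictly below s makes [D] differentiable at s and at every s + x / (n+1) with x >=
   0. *)
have [D [dD D0 Dge]] := exponential_primitive (s - 1) ch hM.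
have s1 : s - 1 < s by lra.
have my : measurable_fun setT (fun x : R => s + x / n.+1%:R).
  by apply: measurable_funD => //; apply: measurable_funM.
rewrite (@ex_exponential _ _ _ Q (xi n.+1) (xi_exp _)
  (fun x => h (s + x / n.+1%:R) * b (s + x / n.+1%:R) ^+ n))//; last first.
  apply: bmM; first exact: bm_continuous_comp.
  have [mb [M' bM']] := bb; split.
    by apply: measurable_funX; exact: (measurableT_comp mb my).
  by exists (M' ^+ n) => x; rewrite normrX lerXn2r// nnegrE// (le_trans _ (bM' 0)).
rewrite (bE dD D0 Dge s1).
rewrite -(exponential_recursion M n ch h0 dD D0 Dge s1).
apply: eq_Rintegral => x; rewrite inE/= in_itv/= andbT => x0.
by rewrite (bE dD D0 Dge)// (lt_le_trans s1)// lerDl divr_ge0.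
Qed.

(** Induction on n with s free: xi_(n+1) / (n+1) occurs in every T_j and acts as a shift of s
    independent of the rest. Given this shift the factors j <= n contribute b^n by induction and the
    factor j = n+1 contributes h, which is the integrand of [b_recursion]. *)
Lemma renyi_product_continuous n s :
  \int[Q]_w \prod_(1 <= j < n.+1) h (s + renyi (xi ^~ w) n j) =
  (\int[Q]_w h (s + xi 1 w)) ^+ n.
Proof.
elim: n s => [|n IH] s.
  under eq_Rintegral do rewrite big_geq//.
  by rewrite ex_cst expr0.
pose D1 := [set i | i = n.+1]; pose D2 := [set i | (0 < i <= n)%N].
pose y w := s + xi n.+1 w / n.+1%:R.
pose phi w v := h (y w) * \prod_(1 <= j < n.+1) h (y w + renyi (xi ^~ v) n j).
have my : measurable_fun setT (y : g_sigma_algebraType (generators xi D1) -> R).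
  apply: measurable_funD; first exact: measurable_cst.
  apply: measurable_funM; last exact: measurable_cst.
  by apply: measurable_generators.
have bphi : bounded_measurable (fun z : g_sigma_algebraType (generators xi D1) *
    g_sigma_algebraType (generators xi D2) => phi z.1 z.2).
  have my1 : measurable_fun setT (fun z : g_sigma_algebraType (generators xi D1) *
      g_sigma_algebraType (generators xi D2) => y z.1).
    exact: (measurableT_comp my measurable_fst).
  apply: bmM; first exact: bm_continuous_comp.
  apply: bm_renyi_product => // i i0.
  have mxi : measurable_fun setT (xi i : g_sigma_algebraType (generators xi D2) -> R).
    exact: measurable_generators.
  exact: (measurableT_comp mxi measurable_snd).
transitivity (\int[Q]_w phi w w).
  apply: eq_Rintegral => w _; rewrite big_nat_recr//= mulrC /phi; congr (h _ * _).
    by rewrite /renyi big_nat1.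
  rewrite !big_nat; apply: eq_bigr => j /andP[j1 jn].
  congr h; rewrite /renyi big_nat_recr/=; last exact: ltnW.
  by rewrite /y -!addrA; congr (_ + _); exact: addrC.
rewrite (@ex_indep_sigma _ _ _ Q (generators xi D1) (generators xi D2))//; first last.
- apply: (independent_blocks xi_indep).
  + by move=> _ ->.
  + by move=> i /= /andP[].
  + by rewrite -subset0 => i [/= -> /andP[_]]; rewrite ltnn.
- exact: generators_measurable.
- exact: generators_measurable.
rewrite -b_recursion; apply: eq_Rintegral => w _.
rewrite -/(y w) /phi exZ ?IH//.
exact: bm_renyi_product.
Qed.

End continuous_factor.

(* Renyi's representation, tested on symmetric products only. *)
Lemma renyi_product (h : R -> R) (h_ : nat -> R -> R) M n s :
  (forall k, continuous (h_ k)) -> (forall k x, 0 <= h_ k x <= M) ->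
  (forall x, h_ k x @[k --> \oo] --> h x) ->
  \int[Q]_w \prod_(1 <= j < n.+1) h (s + renyi (xi ^~ w) n j) =
  (\int[Q]_w h (s + xi 1 w)) ^+ n.
Proof.
move=> ch hM hh.
have mh : measurable_fun setT h.
  apply: (@measurable_fun_cvg _ _ _ _ h_) => [k|x _]; last exact: hh.
  exact: continuous_measurable_fun.
have cR : \int[Q]_w h_ k (s + xi 1 w) @[k --> \oo] --> \int[Q]_w h (s + xi 1 w).
  apply: (ex_cvg (M := M)).
  - move=> k; have [//] : bounded_measurable (fun w => h_ k (s + xi 1 w)).
    by apply: (bm_continuous_comp (ch k) (hM k)); exact: measurable_funD.
  - by apply: (measurableT_comp mh); exact: measurable_funD.
  - by move=> k w; have /andP[h0 h1] := hM k (s + xi 1 w); rewrite ger0_norm.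
  - by apply: aeW => w; exact: hh.
have bk k := @bm_renyi_product _ _ (ch k) (hM k) _ T xi (fun=> s) n
  (fun i _ => measurable_funPT (xi i)) (@measurable_cst _ _ _ _ _ s).
have cL : \int[Q]_w \prod_(1 <= j < n.+1) h_ k (s + renyi (xi ^~ w) n j)
    @[k --> \oo] --> \int[Q]_w \prod_(1 <= j < n.+1) h (s + renyi (xi ^~ w) n j).
  have cvp w : \prod_(1 <= j < n.+1) h_ k (s + renyi (xi ^~ w) n j) @[k --> \oo] -->
      \prod_(1 <= j < n.+1) h (s + renyi (xi ^~ w) n j).
    by apply: cvg_prod_seq => j; exact: hh.
  apply: (ex_cvg (M := M ^+ n)).
  - by move=> k; case: (bk k).
  - apply: (@measurable_fun_cvg _ _ _ _
      (fun k w => \prod_(1 <= j < n.+1) h_ k (s + renyi (xi ^~ w) n j))) => [k|x _].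
      by case: (bk k).
    exact: cvp.
  - move=> k w; rewrite normr_prod -[leRHS](_ : \prod_(1 <= j < n.+1) M = _).
      apply: ler_prod => j _; rewrite normr_ge0/=.
      by have /andP[h0 h1] := hM k (s + renyi (xi ^~ w) n j); rewrite ger0_norm.
    by rewrite prodr_const_nat subn1.
  - by apply: aeW => w; exact: cvp.
have cL' := cvg_expr (n := n) cR.
have E k : (\int[Q]_w h_ k (s + xi 1 w)) ^+ n =
    \int[Q]_w \prod_(1 <= j < n.+1) h_ k (s + renyi (xi ^~ w) n j).
  by rewrite (renyi_product_continuous (ch k) (hM k)).
rewrite (funext E) in cL'.
by rewrite -(cvg_lim _ cL)// -(cvg_lim _ (cL' _)).
Qed.

End renyi_product.

(** * Rounding *)

Section cells.
Context (R : realType) (u0 delta : R) (m : nat).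
Hypothesis delta_gt0 : 0 < delta.

Definition level (l : nat) : R := u0 + l%:R * delta.

(* The levels cut the line into m.+2 cells ]-oo, level 0], ]level l, level l.+1]
   and ]level m, +oo[. *)
Definition cell (x : R) : nat := count (fun l => level l < x) (iota 0 m.+1).

(** The two unbounded cells go to [level 0] and [level m.+1], outside the range ]level 0, level m].
    Rounding thus stays monotone and preserves membership in that range. *)
Definition round_up (x : R) : R := level (cell x).

Lemma level_le k l : (level k <= level l) = (k <= l)%N.
Proof. by rewrite lerD2l ler_pM2r// ler_nat. Qed.

Lemma cell_le l x : (l <= m)%N -> (cell x <= l)%N = (x <= level l).
Proof.
move=> lm; rewrite /cell.
have -> : iota 0 m.+1 = iota 0 l ++ l :: iota l.+1 (m - l).
  by rewrite (_ : m.+1 = l + (m - l).+1)%N ?iotaD//; lia.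
rewrite count_cat/=; apply/idP/idP => [|xl].
  apply: contraTT; rewrite -!ltNge => lx; rewrite lx -ltnNge.
  rewrite (_ : count _ (iota 0 l) = l) 1?addnA ?addn1 ?leq_addr//.
  rewrite -[RHS](size_iota 0 l); apply/eqP; rewrite -all_count.
  apply/allP => k; rewrite mem_iota => /andP[_ kl].
  by apply: le_lt_trans lx; rewrite level_le; lia.
rewrite ltNge xl/= add0n (_ : count _ (iota l.+1 _) = 0%N); last first.
  apply/eqP; rewrite -leqn0 leqNgt -has_count; apply/hasPn => k.
  rewrite mem_iota -leNgt => /andP[lk _].
  by apply: (le_trans xl); rewrite level_le; lia.
by rewrite addn0 (leq_trans (count_size _ _))// size_iota.
Qed.

Lemma cell_ub x : (cell x <= m.+1)%N.
Proof. by rewrite (leq_trans (count_size _ _))// size_iota. Qed.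

Lemma cell_homo : {homo cell : x y / x <= y >-> (x <= y)%N}.
Proof. by move=> x y xy; apply: sub_count => l /= /lt_le_trans; apply. Qed.

Lemma round_up_homo : {homo round_up : x y / x <= y}.
Proof. by move=> x y xy; rewrite /round_up level_le cell_homo. Qed.

Lemma round_up_gt x : (level 0 < round_up x) = (level 0 < x).
Proof.
by rewrite [RHS]ltNge -(cell_le _ (leq0n _)) /round_up ltNge level_le.
Qed.

Lemma round_up_le x : (round_up x <= level m) = (x <= level m).
Proof. by rewrite /round_up level_le cell_le. Qed.

Lemma round_up_dist x : level 0 < x <= level m -> `|round_up x - x| <= delta.
Proof.
move=> /andP[x0 xm]; rewrite /round_up.
have cm : (cell x <= m)%N by rewrite cell_le.
have c0 : (0 < cell x)%N by rewrite ltnNge cell_le// -ltNge.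
have h1 : x <= level (cell x) by rewrite -cell_le.
have h2 : level (cell x).-1 < x by rewrite ltNge -cell_le; lia.
have h3 : level (cell x) = level (cell x).-1 + delta.
  by rewrite /level -[in LHS](prednK c0) -natr1; ring.
by rewrite ger0_norm; lra.
Qed.

Definition clamp (a b x : R) : R := Num.min b (Num.max a x).

Lemma continuous_clamp a b : continuous (clamp a b).
Proof.
move=> x.
have c1 : {for x, continuous (fun y : R => Num.max a y : R^o)}.
  exact: (@continuous_max R R (cst a) id x (cvg_cst _) (cvg_id)).
exact: (@continuous_min R R (cst b) _ x (cvg_cst _) c1).
Qed.

Lemma clamp_bound a b x : a <= b -> a <= clamp a b x <= b.
Proof. by move=> ab; rewrite /clamp le_min ab le_max lexx /= ge_min lexx. Qed.

Lemma bm_clamp d (T : measurableType d) (a b : R) (f : T -> R) : a <= b ->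
  measurable_fun setT f -> bounded_measurable (fun w => clamp a b (f w)).
Proof.
move=> ab mf; split.
  apply: (measurableT_comp _ mf); apply: continuous_measurable_fun.
  exact: continuous_clamp.
exists (`|a| + `|b|) => w; have /andP[h1 h2] := clamp_bound (f w) ab.
rewrite ler_norml (le_trans _ h1) ?(le_trans h2)//.
  by rewrite (le_trans (ler_norm b)) ?lerDr.
by rewrite lerNl (le_trans (ler_norm _))// normrN lerDl.
Qed.

Definition ramp (k : nat) (x : R) : R := clamp 0 1 (k%:R * x).

Lemma continuous_ramp k : continuous (ramp k).
Proof.
move=> x.
have c1 : {for x, continuous (fun y : R => k%:R * y)}.
  by apply: cvgM; [exact: cvg_cst|exact: cvg_id].
exact: (continuous_comp c1 (@continuous_clamp 0 1 _)).
Qed.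

Lemma ramp_cvg x : ramp k x @[k --> \oo] --> ((0 < x)%R%:R : R).
Proof.
have [x0|x0] := leP x 0.
  rewrite (_ : (fun k => _) = cst 0); first exact: cvg_cst.
  apply/funext => k; rewrite /ramp /clamp max_l ?mulr_ge0_le0//.
  by rewrite min_r.
apply: cvg_near_cst; near=> k; rewrite /ramp /clamp.
have h : 1 <= k%:R * x.
  rewrite -ler_pdivrMr//; near: k; exact: nbhs_infty_ger.
by rewrite max_r ?min_l// (le_trans _ h).
Unshelve. all: by end_near. Qed.

(** Telescoping over the levels below x writes a function of the cell as a combination of strict
    step functions, which are limits of ramps. *)
Lemma cell_step (z : nat -> R) x :
  z (cell x) = z 0%N + \sum_(0 <= l < m.+1) (z l.+1 - z l) * ((0 < x - level l)%R%:R : R).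
Proof.
rewrite (@big_cat_nat _ _ _ (cell x)) ?cell_ub//=.
rewrite [X in _ + (_ + X)]big_nat [X in _ + (_ + X)]big1 ?addr0; last first.
  move=> l /andP[cl lm]; rewrite subr_gt0 ltNge -cell_le ?cl ?mulr0//; lia.
rewrite (@telescope_sumr_eq _ _ _ z)//; first by ring.
move=> l /andP[_ lc]; rewrite subr_gt0 ltNge -cell_le.
  by rewrite -ltnNge lc mulr1.
by have := cell_ub x; lia.
Qed.

Lemma cell_approx (z : nat -> R) M : (forall c, 0 <= z c <= M) ->
  exists h_ : nat -> R -> R, [/\ forall k, continuous (h_ k),
    forall k x, 0 <= h_ k x <= M &
    forall x, h_ k x @[k --> \oo] --> z (cell x)].
Proof.
move=> zM; have M0 : 0 <= M by have /andP[h1 h2] := zM 0%N; exact: le_trans h2.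
pose g k x := z 0%N + \sum_(0 <= l < m.+1) (z l.+1 - z l) * ramp k (x - level l).
(* The clamp provides the bounds and does not affect the limit, which already lies in [0, M]. *)
exists (fun k x => clamp 0 M (g k x)); split.
- move=> k x; apply: (@continuous_comp _ _ _ (g k) (clamp 0 M)); last exact: continuous_clamp.
  apply: cvgD; first exact: cvg_cst.
  apply: cvg_big => [|l _]; first exact: add_continuous.
  apply: cvgM; first exact: cvg_cst.
  apply: (@continuous_comp _ _ _ (fun y => y - level l) (ramp k)); last exact: continuous_ramp.
  by apply: cvgB; [exact: cvg_id|exact: cvg_cst].
- by move=> k x; exact: clamp_bound.
- move=> x; rewrite -[X in _ --> X](_ : clamp 0 M (z (cell x)) = _); last first.
    have /andP[h1 h2] := zM (cell x).
    by rewrite /clamp max_r// min_r.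
  apply: continuous_cvg; first exact: continuous_clamp.
  rewrite cell_step; apply: cvgD; first exact: cvg_cst.
  apply: cvg_big => [|l _]; first exact: add_continuous.
  by apply: cvgM; [exact: cvg_cst|exact: ramp_cvg].
Qed.

End cells.

Lemma ex_finite_valued (R : realType) d (T : measurableType d) (P : probability T R)
    (F : finType) (V : T -> F) (theta : F -> R) :
  (forall v, bounded_measurable (fun w => (V w == v)%:R : R)) ->
  \int[P]_w theta (V w) = \sum_v theta v * \int[P]_w ((V w == v)%:R : R).
Proof.
move=> bV.
transitivity (\int[P]_w \sum_v theta v * ((V w == v)%:R : R)).
  apply: eq_Rintegral => w _; rewrite (bigD1 (V w))//= eqxx mulr1 big1 ?addr0//.
  by move=> v; rewrite eq_sym => /negbTE ->; rewrite mulr0.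
rewrite ex_sum => [|v _]; last exact: bmZ.
by apply: eq_bigr => v _; rewrite exZ.
Qed.

Lemma bm_finite_valued (R : realType) d (T : measurableType d)
    (F : finType) (V : T -> F) (theta : F -> R) :
  (forall v, bounded_measurable (fun w => (V w == v)%:R : R)) ->
  bounded_measurable (fun w => theta (V w)).
Proof.
move=> bV.
rewrite (_ : (fun w => _) = fun w => \sum_v theta v * ((V w == v)%:R : R)).
  by apply: bm_sum => v _; exact: bmZ.
apply/funext => w; rewrite (bigD1 (V w))//= eqxx mulr1 big1 ?addr0//.
by move=> v; rewrite eq_sym => /negbTE ->; rewrite mulr0.
Qed.

Lemma ffun_eq_prod (R : comPzRingType) (C : finType) n (u v : {ffun 'I_n -> C}) :
  ((u == v)%:R : R) = \prod_i (u i == v i)%:R.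
Proof.
have [->|uv] := eqVneq u v; first by rewrite big1// => i _; rewrite eqxx.
have [i ui] : exists i, u i != v i.
  apply/existsP; rewrite -negb_forall; apply: contra uv => /forallP uv.
  by apply/eqP/ffunP => i; exact/eqP.
by rewrite (bigD1 i)//= (negbTE ui) mul0r.
Qed.

(** * Laws of the vectors of cells *)

Section renyi_cells.
Context (R : realType) (C : finType) (cl : R -> C).
(** The form of approximation that [renyi_product] accepts; the measurability of [cl] is drawn from
    it too. *)
Hypothesis cl_approx : forall z : C -> R, (forall c, 0 <= z c) ->
  exists (h_ : nat -> R -> R) (M : R), [/\ forall k, continuous (h_ k),
    forall k x, 0 <= h_ k x <= M & forall x, h_ k x @[k --> \oo] --> z (cl x)].

Lemma bm_cl_eq c : bounded_measurable (fun x => (cl x == c)%:R : R).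
Proof.
have [h_ [M [ch _ hc]]] := @cl_approx (fun c' => (c' == c)%:R) (fun c' => ler0n _ _).
split; last by exists 1 => x; case: eqP; rewrite ?normr1 ?normr0.
apply: (@measurable_fun_cvg _ _ _ _ h_) => [k|x _]; last exact: hc.
exact: continuous_measurable_fun.
Qed.

Definition renyi_cells n (s : R) (e : nat -> R) : {ffun 'I_n -> C} :=
  [ffun i : 'I_n => cl (s + renyi e n i.+1)].

Lemma bm_renyi_cells d (T : measurableType d) (e : nat -> T -> R) n s v :
  (forall i, (0 < i <= n)%N -> measurable_fun setT (e i)) ->
  bounded_measurable (fun w => (renyi_cells n s (e ^~ w) == v)%:R : R).
Proof.
move=> me.
rewrite (_ : (fun w => _) = fun w => \prod_(i < n)
    ((cl (s + renyi (e ^~ w) n i.+1) == v i)%:R : R)); last first.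
  by apply/funext => w; rewrite ffun_eq_prod; apply: eq_bigr => i _; rewrite ffunE.
apply: bm_prod => i _; have [mc _] := bm_cl_eq (v i); split.
  apply: (measurableT_comp mc); apply: measurable_funD; first exact: measurable_cst.
  exact: measurable_renyi.
by exists 1 => w; case: eqP; rewrite ?normr1 ?normr0.
Qed.

Context d (T : measurableType d) (Q : probability T R).

Section one_family.
Variable xi : nat -> {RV Q >-> R}.
Hypothesis xi_indep : independent_family [set n | (0 < n)%N] xi.
Hypothesis xi_exp : unit_exponentials xi.

Definition cell_prob (s : R) (c : C) : R := \int[Q]_w ((cl (s + xi 1 w) == c)%:R : R).

Let bcl s c : bounded_measurable (fun w => (cl (s + xi 1 w) == c)%:R : R).
Proof.
have [mc _] := bm_cl_eq c; split.
  by apply: (measurableT_comp mc); exact: measurable_funD.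
by exists 1 => w; case: eqP; rewrite ?normr1 ?normr0.
Qed.

Lemma cell_prob_ge0 s c : 0 <= cell_prob s c.
Proof. by apply: Rintegral_ge0 => w _. Qed.

Lemma sum_cell_prob s : \sum_c cell_prob s c = 1.
Proof.
have := ex_finite_valued Q (fun=> 1) (bcl s).
rewrite ex_cst => ->; apply: eq_bigr => c _; by rewrite mul1r.
Qed.

(** The ordered Renyi sums and an iid sample have different laws of cell vectors, but by
    [renyi_product] the difference [r] of these laws kills every product prod_i z(v_i), hence by
    [symmetric_annihilator] every symmetric [psi]. *)
Lemma renyi_cells_symmetric n s (psi : {ffun 'I_n -> C} -> R) :
  (forall (f : {ffun 'I_n -> 'I_n}) (v : {ffun 'I_n -> C}), injective f ->
    psi [ffun i => v (f i)] = psi v) ->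
  \sum_v \int[Q]_w ((renyi_cells n s (xi ^~ w) == v)%:R : R) * psi v =
  \sum_(v : {ffun 'I_n -> C}) (\prod_i cell_prob s (v i)) * psi v.
Proof.
move=> psi_sym.
have bv v : bounded_measurable (fun w => (renyi_cells n s (xi ^~ w) == v)%:R : R).
  by apply: bm_renyi_cells => i _; exact: measurable_funPT.
apply/eqP; rewrite -subr_eq0 -sumrB; apply/eqP.
under eq_bigr do rewrite -mulrBl.
apply: symmetric_annihilator psi_sym => z z0.
under eq_bigr do rewrite mulrBl.
rewrite sumrB; apply/eqP; rewrite subr_eq0; apply/eqP.
transitivity (\int[Q]_w \prod_i z (renyi_cells n s (xi ^~ w) i)).
  rewrite (ex_finite_valued Q (fun v : {ffun 'I_n -> C} => \prod_i z (v i)) bv).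
  by apply: eq_bigr => v _; rewrite mulrC.
have [h_ [M [ch hM hc]]] := cl_approx z0.
transitivity ((\int[Q]_w z (cl (s + xi 1 w))) ^+ n).
  have := @renyi_product _ _ _ Q xi xi_indep xi_exp (z \o cl) h_ M n s ch hM hc.
  move=> /= <-; apply: eq_Rintegral => w _.
  by rewrite big_add1/= big_mkord; apply: eq_bigr => i _; rewrite ffunE.
rewrite (ex_finite_valued Q z (bcl s)).
under [RHS]eq_bigr do rewrite -big_split/=.
rewrite -(bigA_distr_bigA (fun _ c => cell_prob s c * z c))/= prodr_const card_ord.
by congr (_ ^+ _); apply: eq_bigr => c _; rewrite mulrC.
Qed.

End one_family.

Section two_families.
Variables xi1 xi2 : nat -> {RV Q >-> R}.
Variables (G1 G2 : set (set T)).
Hypotheses (G1m : G1 `<=` measurable) (G2m : G2 `<=` measurable).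
Hypothesis G12 : independent_systems Q <<s G1 >> <<s G2 >>.
Hypothesis xi1G : forall j, (0 < j)%N ->
  measurable_fun setT (xi1 j : g_sigma_algebraType G1 -> R).
Hypothesis xi2G : forall j, (0 < j)%N ->
  measurable_fun setT (xi2 j : g_sigma_algebraType G2 -> R).
Hypothesis xi1_indep : independent_family [set n | (0 < n)%N] xi1.
Hypothesis xi2_indep : independent_family [set n | (0 < n)%N] xi2.
Hypothesis xi1_exp : unit_exponentials xi1.
Hypothesis xi2_exp : unit_exponentials xi2.

(** Independence of the two families factorises the weights, so that symmetry can be used in one
    argument while the other is frozen. Two vectors are then zipped into a vector of pairs, the form
    in which the cells of the (X_i, Y_i) appear. *)
Lemma ex_renyi_cells n s (theta : {ffun 'I_n -> C} -> {ffun 'I_n -> C} -> R) :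
  (forall (f : {ffun 'I_n -> 'I_n}) (u v : {ffun 'I_n -> C}), injective f ->
    theta [ffun i => u (f i)] v = theta u v) ->
  (forall (f : {ffun 'I_n -> 'I_n}) (u v : {ffun 'I_n -> C}), injective f ->
    theta u [ffun i => v (f i)] = theta u v) ->
  \int[Q]_w theta (renyi_cells n s (xi1 ^~ w)) (renyi_cells n s (xi2 ^~ w)) =
  \sum_(v : {ffun 'I_n -> C * C})
    (\prod_i (cell_prob xi1 s (v i).1 * cell_prob xi2 s (v i).2)) *
    theta [ffun i => (v i).1] [ffun i => (v i).2].
Proof.
move=> sym1 sym2.
pose V w := (renyi_cells n s (xi1 ^~ w), renyi_cells n s (xi2 ^~ w)).
have bv1 v : bounded_measurable
    ((fun w => (renyi_cells n s (xi1 ^~ w) == v)%:R : R) : g_sigma_algebraType G1 -> R).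
  by apply: bm_renyi_cells => i /andP[i0 _]; exact: xi1G.
have bv2 v : bounded_measurable
    ((fun w => (renyi_cells n s (xi2 ^~ w) == v)%:R : R) : g_sigma_algebraType G2 -> R).
  by apply: bm_renyi_cells => i /andP[i0 _]; exact: xi2G.
have VE v w : ((V w == v)%:R : R) = (renyi_cells n s (xi1 ^~ w) == v.1)%:R *
    (renyi_cells n s (xi2 ^~ w) == v.2)%:R.
  by case: v => a b; rewrite /V xpair_eqE -natrM mulnb.
have bV v : bounded_measurable (fun w => (V w == v)%:R : R).
  rewrite (_ : (fun w => _) = fun w => (renyi_cells n s (xi1 ^~ w) == v.1)%:R *
    (renyi_cells n s (xi2 ^~ w) == v.2)%:R :> R); last exact/funext/VE.
  by apply: bmM; [exact: bm_g_sigma (bv1 _)|exact: bm_g_sigma (bv2 _)].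
rewrite (@ex_finite_valued _ _ _ Q _ V (fun v => theta v.1 v.2) bV).
transitivity (\sum_u \sum_v \int[Q]_w ((renyi_cells n s (xi1 ^~ w) == u)%:R : R) *
    (\int[Q]_w ((renyi_cells n s (xi2 ^~ w) == v)%:R : R) * theta u v)).
  rewrite pair_big/=; apply: eq_bigr => v _.
  rewrite mulrA mulrC; congr (_ * _).
  rewrite -(exM_indep G1m G2m G12)//.
  by apply: eq_Rintegral => w _; exact: VE.
transitivity (\sum_(u : {ffun 'I_n -> C}) \sum_(v : {ffun 'I_n -> C}) (\prod_i cell_prob xi1 s (u i)) *
    ((\prod_i cell_prob xi2 s (v i)) * theta u v)).
  under eq_bigr => u _.
    rewrite -mulr_sumr (renyi_cells_symmetric xi2_indep xi2_exp); last first.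
      by move=> f v finj; exact: sym2.
    over.
  rewrite (renyi_cells_symmetric xi1_indep xi1_exp).
    by apply: eq_bigr => u _; rewrite mulr_sumr.
  by move=> f v finj; apply: eq_bigr => u _; rewrite sym1.
rewrite pair_big/=.
rewrite (reindex (fun v : {ffun 'I_n -> C * C} =>
  ([ffun i => (v i).1] : {ffun 'I_n -> C}, [ffun i => (v i).2] : {ffun 'I_n -> C})))/=.
  apply: eq_bigr => v _; rewrite mulrA -big_split/=; congr (_ * _).
  by apply: eq_bigr => i _; rewrite !ffunE.
exists (fun uv : {ffun 'I_n -> C} * {ffun 'I_n -> C} => [ffun i => (uv.1 i, uv.2 i)]) => [v _|[u v] _].
  by apply/ffunP => i; rewrite !ffunE; case: (v i).
by congr pair; apply/ffunP => i; rewrite !ffunE.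
Qed.

End two_families.

End renyi_cells.

Section iid_cells.
Context (R : realType) d (T : measurableType d) (P : probability T R).
Context d' (U : measurableType d') (X : nat -> {RV P >-> U}).
Hypothesis X_indep : independent_family [set n | (0 < n)%N] X.
Hypothesis X_ident : identically_distributed [set n | (0 < n)%N] X.
Context (C : finType) (cl : U -> C).
Hypothesis mcl : forall c, measurable [set z | cl z = c].

Definition iid_cell_prob (c : C) : R := \int[P]_w ((cl (X 1 w) == c)%:R : R).

Let bcl j c : bounded_measurable (fun w => (cl (X j w) == c)%:R : R).
Proof.
rewrite (_ : (fun w => _) = \1_(X j @^-1` [set z | cl z = c])).
  by apply: bm_indic; exact: measurable_funPTI.
apply/funext => w; rewrite indicE; congr (_%:R); congr nat_of_bool.
by apply/eqP/idP; rewrite inE.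
Qed.

Let probE j c : (0 < j)%N ->
  P (X j @^-1` [set z | cl z = c]) = (iid_cell_prob c)%:E.
Proof.
move=> j0; transitivity (P (X 1 @^-1` [set z | cl z = c])).
  exact: (X_ident (i := j) (j := 1%N)).
rewrite /iid_cell_prob -[LHS]fineK; last first.
  by apply: fin_num_measure; exact: measurable_funPTI.
rewrite -(ex_indic P); last exact: measurable_funPTI.
congr EFin; apply: eq_Rintegral => w _; rewrite indicE; congr (_%:R); congr nat_of_bool.
by apply/idP/eqP; rewrite inE.
Qed.

Lemma iid_cell_prob_ge0 c : 0 <= iid_cell_prob c.
Proof. by apply: Rintegral_ge0 => w _. Qed.

Lemma sum_iid_cell_prob : \sum_c iid_cell_prob c = 1.
Proof.
have := ex_finite_valued P (fun=> 1) (bcl 1).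
rewrite ex_cst => ->; apply: eq_bigr => c _; by rewrite mul1r.
Qed.

Definition iid_cells n w : {ffun 'I_n -> C} := [ffun i : 'I_n => cl (X i.+1 w)].

Lemma bm_iid_cells n v : bounded_measurable (fun w => (iid_cells n w == v)%:R : R).
Proof.
rewrite (_ : (fun w => _) = fun w => \prod_(i < n) ((cl (X i.+1 w) == v i)%:R : R)).
  by apply: bm_prod => i _.
by apply/funext => w; rewrite ffun_eq_prod; apply: eq_bigr => i _; rewrite ffunE.
Qed.

Lemma ex_iid_cells n (theta : {ffun 'I_n -> C} -> R) :
  \int[P]_w theta (iid_cells n w) =
  \sum_(v : {ffun 'I_n -> C}) (\prod_i iid_cell_prob (v i)) * theta v.
Proof.
rewrite (ex_finite_valued P theta (@bm_iid_cells n)); apply: eq_bigr => v _.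
rewrite mulrC; congr (_ * _).
(* [inord] needs a nonempty ordinal type, so n = 0 is separate. The sets below are shifted by one,
   as [X] is indexed from 1 and [v] from 0. *)
case: n theta v => [|n] theta v.
  rewrite big_ord0 -[RHS](ex_cst P); apply: eq_Rintegral => w _.
  by rewrite ffun_eq_prod big_ord0.
pose A (j : nat) := [set z | cl z = v (inord j.-1)].
pose s0 := [seq i.+1 | i <- iota 0 n.+1].
have s0P j : j \in s0 -> exists2 i, (i < n.+1)%N & j = i.+1.
  by move=> /mapP[i]; rewrite mem_iota => ilt ->; exists i.
have us0 : uniq s0 by rewrite map_inj_uniq ?iota_uniq//; exact: succn_inj.
have h1 : [set` s0] `<=` [set n0 | (0 < n0)%N].
  by move=> j js; have [i _ ->] := s0P j js.
have := X_indep (A := A) us0 h1 (fun j => mcl _).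
rewrite [in X in _ = X]/s0 big_map.
under eq_bigr do rewrite probE//.
rewrite prodEFin -[iota 0 n.+1]/(index_iota 0 n.+1) big_mkord/=.
under eq_bigr do rewrite inord_val.
move=> H; apply: EFin_inj; rewrite -H -[RHS]fineK; last first.
  apply: fin_num_measure; apply: fin_bigcap_measurable => // j _.
  by apply: measurable_funPTI; exact: mcl.
rewrite -(ex_indic P); last first.
  apply: fin_bigcap_measurable => // j _.
  by apply: measurable_funPTI; exact: mcl.
congr EFin; apply: eq_Rintegral => w _; rewrite indicE; congr (_%:R); congr nat_of_bool.
apply/eqP/idP; rewrite inE => E.
  move=> j js; have [i ilt ->] := s0P j js.
  by rewrite /A /= -E ffunE inordK.
apply/ffunP => i; rewrite ffunE.
have := E i.+1; rewrite /A/= inord_val; apply.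
by apply/mapP; exists (i : nat) => //; rewrite mem_iota add0n ltn_ord.
Qed.

End iid_cells.

(** * Tails of the bivariate distribution *)

Section power_limits.
Context (R : realType).

Lemma cvg_inv_pinfty : (t : R)^-1 @[t --> +oo] --> (0 : R).
Proof.
apply/(gtr0_cvgV0 (f := id)); last exact: cvg_id.
by near=> t; near: t; exact: nbhs_pinfty_gt.
Unshelve. all: by end_near. Qed.

(* - ln (g t) lies between 1 - g t and (1 - g t) / g t. *)
Lemma powR_tail_cvg (g : R -> R) (h : R) : 0 < h ->
  (\forall t \near +oo, 0 <= g t <= 1) ->
  g t `^ t @[t --> +oo] --> h ->
  t * (1 - g t) @[t --> +oo] --> - ln h.
Proof.
move=> h0 g01 gh.
pose L t := t * ln (g t).
have gpos : \forall t \near +oo, 0 < g t.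
  near=> t; have /andP[g0 _] : 0 <= g t <= 1 by near: t.
  rewrite lt_neqAle g0 andbT eq_sym; apply/eqP => gt0.
  have t0 : 0 < t by near: t; exact: nbhs_pinfty_gt.
  have : 0 < g t `^ t by near: t; apply: (cvgr_gt h).
  by rewrite gt0 powR0 ?ltxx// gt_eqF.
have Lh : L t @[t --> +oo] --> ln h.
  apply: cvg_trans (continuous_cvg _ (continuous_ln h0) gh).
  apply: near_eq_cvg; near=> t.
  by rewrite /= ln_powR.
have g1 : g t @[t --> +oo] --> (1 : R).
  rewrite -[X in _ --> X]expR0 -(mulr0 (ln h)).
  have : expR (L t * t^-1) @[t --> +oo] --> expR (ln h * 0).
    apply: continuous_cvg; first exact: continuous_expR.
    by apply: cvgM => //; exact: cvg_inv_pinfty.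
  apply: cvg_trans; apply: near_eq_cvg; near=> t.
  rewrite /L mulrAC divff ?mul1r ?lnK//.
    by rewrite posrE; near: t.
  by rewrite gt_eqF//; near: t; exact: nbhs_pinfty_gt.
apply: (@squeeze_cvgr _ _ _ _ (fun t => - L t * g t) (fun t => - L t)).
- near=> t.
  have gt0 : 0 < g t by near: t.
  have t0 : 0 < t by near: t; exact: nbhs_pinfty_gt.
  have e1 : 1 - g t <= - ln (g t).
    have := expR_ge1Dx (ln (g t)); rewrite lnK ?posrE//; lra.
  have e2 : - ln (g t) * g t <= 1 - g t.
    have := expR_ge1Dx (- ln (g t)); rewrite expRN lnK ?posrE// => e.
    have : g t * (1 - ln (g t)) <= g t * (g t)^-1 by rewrite ler_wpM2l// ltW.
    rewrite divff ?gt_eqF//; lra.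
  by rewrite /L -!mulrN -mulrA !ler_wpM2l// ltW.
- by rewrite -[X in _ --> X]mulr1; apply: cvgM => //; exact: cvgN.
- exact: cvgN.
Unshelve. all: by end_near. Qed.

End power_limits.

Section extreme_cdf.
Context (R : realType) d (T : measurableType d) (P : probability T R).
Context (V : {RV P >-> (R * R)%type}) (a1 b1 a2 b2 : R -> R).
Hypothesis a1_gt0 : forall t : R, 0 < t -> 0 < a1 t.
Hypothesis a2_gt0 : forall t : R, 0 < t -> 0 < a2 t.
Hypothesis V_cvg : forall e, 0 < e -> \forall t \near +oo, forall x y,
  `|joint_cdf V (a1 t * x + b1 t) (a2 t * y + b2 t) `^ t - bigumbel_cdf x y| <= e.

Lemma joint_cdfE x y : joint_cdf V x y = fine (P [set w | (V w).1 <= x /\ (V w).2 <= y]).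
Proof.
by rewrite /joint_cdf /distribution/= /pushforward; congr (fine (P _)).
Qed.

Let mXY x y : measurable [set w | (V w).1 <= x /\ (V w).2 <= y].
Proof.
rewrite (_ : [set w | _] = V @^-1` (`]-oo, x] `*` `]-oo, y])).
  by apply: measurable_funPTI; exact: measurableX.
by apply/seteqP; split=> w /=; rewrite !in_itv.
Qed.

Let mX x : measurable [set w | (V w).1 <= x].
Proof.
rewrite (_ : [set w | _] = V @^-1` (`]-oo, x] `*` setT)).
  by apply: measurable_funPTI; exact: measurableX.
by apply/seteqP; split=> w /=; rewrite !in_itv//= => -[].
Qed.

Lemma joint_cdf_le1 x y : 0 <= joint_cdf V x y <= 1.
Proof.
rewrite joint_cdfE fine_ge0//= -lee_fin fineK ?fin_num_measure//.
exact: probability_le1.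
Qed.

Definition cdf1 x := fine (P [set w | (V w).1 <= x]).

Lemma cdf1_le1 x : 0 <= cdf1 x <= 1.
Proof.
rewrite fine_ge0//= -lee_fin fineK ?fin_num_measure//.
exact: probability_le1.
Qed.

Lemma joint_cdf_le_cdf1 x y : joint_cdf V x y <= cdf1 x.
Proof.
rewrite joint_cdfE fine_le ?fin_num_measure//.
by apply: le_measure; rewrite ?inE// => w [].
Qed.

Lemma joint_cdf_cvg_cdf1 x : joint_cdf V x n%:R @[n --> \oo] --> cdf1 x.
Proof.
rewrite (_ : (fun n : nat => _) =
    fun n : nat => fine (P [set w | (V w).1 <= x /\ (V w).2 <= n%:R])); last first.
  by apply/funext => n; rewrite joint_cdfE.
apply: fine_cvg; rewrite fineK ?fin_num_measure//.
rewrite (_ : [set w | (V w).1 <= x] =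
    \bigcup_n [set w | (V w).1 <= x /\ (V w).2 <= n%:R]).
  apply: nondecreasing_cvg_mu => //; first exact: bigcupT_measurable.
  move=> m n mn; apply/subsetPset => w [wx wm]; split => //.
  by rewrite (le_trans wm)// ler_nat.
apply/seteqP; split=> [w /= wx|w [n _ []]//].
exists (Num.bound `|(V w).2|) => //; split=> //.
by apply: le_trans (ler_norm _) (ltW _); exact: archi_boundP.
Qed.

Lemma joint_tail_cvg x y :
  t * (1 - joint_cdf V (a1 t * x + b1 t) (a2 t * y + b2 t)) @[t --> +oo] -->
  expR (- x) + expR (- y).
Proof.
rewrite (_ : expR (- x) + expR (- y) = - ln (bigumbel_cdf x y)); last first.
  by rewrite /bigumbel_cdf expRK opprB opprK addrC.
apply: powR_tail_cvg; first exact: expR_gt0.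
  by apply: nearW => t; exact: joint_cdf_le1.
by apply/cvgrPdist_le => e e0; near=> t; rewrite distrC; near: t;
  move: (V_cvg e0); apply: filterS => t; apply.
Unshelve. all: by end_near. Qed.

(** The marginal is the limit y -> +oo of the joint distribution function at fixed t; the uniformity
    of [V_cvg] in y permits this before t -> +oo. One finite y gives the lower bound, all y = n
    together give the upper one. *)
Lemma cdf1_tail_cvg x :
  t * (1 - cdf1 (a1 t * x + b1 t)) @[t --> +oo] --> expR (- x).
Proof.
pose G := expR (- expR (- x)).
rewrite (_ : expR (- x) = - ln G); last by rewrite expRK opprK.
apply: powR_tail_cvg; first exact: expR_gt0.
  by apply: nearW => t; exact: cdf1_le1.
have cG : bigumbel_cdf x y @[y --> +oo] --> G.
  rewrite /bigumbel_cdf; apply: continuous_cvg; first exact: continuous_expR.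
  rewrite -[X in _ --> X]subr0; apply: cvgB; first exact: cvg_cst.
  exact: cvg_expRN.
have HG y : bigumbel_cdf x y <= G.
  by rewrite ler_expR lerBlDr lerDl expR_ge0.
apply/cvgrPdist_le => e e0.
have e2 : 0 < e / 2 by rewrite divr_gt0.
have [y Hy] : exists y, G - bigumbel_cdf x y <= e / 2.
  move/cvgrPdist_le : cG => /(_ _ e2)[M [_ HM]]; exists (M + 1).
  by apply: le_trans (ler_norm _) _; apply: HM; rewrite ltrDl.
near=> t.
have t0 : 0 < t by near: t; exact: nbhs_pinfty_gt.
have tn0 : t != 0 by rewrite gt_eqF.
have Ht : forall x y, `|joint_cdf V (a1 t * x + b1 t) (a2 t * y + b2 t) `^ t -
    bigumbel_cdf x y| <= e / 2 by near: t; exact: V_cvg.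
set g := cdf1 _; have /andP[g0 g1] : 0 <= g <= 1 by exact: cdf1_le1.
have low : G - e <= g `^ t.
  have h1 : joint_cdf V (a1 t * x + b1 t) (a2 t * y + b2 t) `^ t <= g `^ t.
    have /andP[j0 _] := joint_cdf_le1 (a1 t * x + b1 t) (a2 t * y + b2 t).
    by apply: ge0_ler_powR; rewrite ?nnegrE ?(ltW t0)// joint_cdf_le_cdf1.
  by have := Ht x y; rewrite ler_norml => /andP[]; lra.
have up : g `^ t <= G + e.
  have Ge0 : 0 <= G + e by rewrite addr_ge0 ?expR_ge0 ?ltW.
  (* The t-th root moves the bound to the distribution function itself, for which the limit in n is
     known. *)
  have gle : g <= (G + e) `^ t^-1.
    apply: (cvgr_to_le (@joint_cdf_cvg_cdf1 (a1 t * x + b1 t))).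
    apply: nearW => n.
    pose z := (n%:R - b2 t) / a2 t.
    have -> : n%:R = a2 t * z + b2 t.
      by rewrite /z mulrCA divff ?mulr1 ?subrK// gt_eqF// a2_gt0.
    have /andP[j0 _] := joint_cdf_le1 (a1 t * x + b1 t) (a2 t * z + b2 t).
    have h1 : joint_cdf V (a1 t * x + b1 t) (a2 t * z + b2 t) `^ t <= G + e.
      by have := Ht x z; have := HG z; rewrite ler_norml => ? /andP[]; lra.
    rewrite -[leLHS](powRr1 j0) -(mulfV tn0) powRrM.
    by apply: ge0_ler_powR; rewrite ?nnegrE ?invr_ge0 ?(ltW t0) ?powR_ge0.
  rewrite -[leRHS](powRr1 Ge0) -(mulVf tn0) powRrM.
  by apply: ge0_ler_powR; rewrite ?nnegrE ?powR_ge0 ?(ltW t0).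
by rewrite ler_norml; lra.
Unshelve. all: by end_near. Qed.

End extreme_cdf.

Section second_marginal.
Context (R : realType) d (T : measurableType d) (P : probability T R).
Context (V : {RV P >-> (R * R)%type}).

Let swap_mfun : measurable_fun setT (fun w => ((V w).2, (V w).1)).
Proof.
apply: measurable_fun_pair.
  by apply: (measurableT_comp measurable_snd).
by apply: (measurableT_comp measurable_fst).
Qed.

Let swapV : {RV P >-> (R * R)%type} :=
  HB.pack (fun w => ((V w).2, (V w).1)) (isMeasurableFun.Build _ _ _ _ _ swap_mfun).

Definition cdf2 y := fine (P [set w | (V w).2 <= y]).

(** Exchanging the coordinates of [V] reduces this to the first marginal, [bigumbel_cdf] being
    symmetric. *)
Lemma cdf2_tail_cvg (a1 b1 a2 b2 : R -> R) y :
  (forall t : R, 0 < t -> 0 < a1 t) ->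
  (forall e, 0 < e -> \forall t \near +oo, forall x y,
    `|joint_cdf V (a1 t * x + b1 t) (a2 t * y + b2 t) `^ t - bigumbel_cdf x y| <= e) ->
  t * (1 - cdf2 (a2 t * y + b2 t)) @[t --> +oo] --> expR (- y).
Proof.
move=> a10 HV.
apply: (@cdf1_tail_cvg _ _ _ P swapV a2 b2 a1 b1 a10) => e e0.
move: (HV e e0); apply: filterS => t Ht x z.
rewrite joint_cdfE (_ : [set w | _] = [set w | (V w).1 <= a1 t * z + b1 t /\
    (V w).2 <= a2 t * x + b2 t]); last by apply/seteqP; split=> w /= [].
rewrite -joint_cdfE (_ : bigumbel_cdf x z = bigumbel_cdf z x); first exact: Ht.
by rewrite /bigumbel_cdf; congr expR; rewrite addrC.
Qed.

End second_marginal.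

(** * Asymptotics of the cell probabilities *)

Section cell_probabilities.
Context (R : realType) (u0 delta : R) (m : nat).
Hypothesis delta_gt0 : 0 < delta.
Local Notation level := (level u0 delta).
Local Notation cell := (cell u0 delta m).

Definition ordcell (x : R) : 'I_m.+2 := inord (cell x).

Lemma ordcellE x : ordcell x = cell x :> nat.
Proof. by rewrite inordK// ltnS cell_ub. Qed.

Lemma ordcell_approx (z : 'I_m.+2 -> R) : (forall c, 0 <= z c) ->
  exists (h_ : nat -> R -> R) (M : R), [/\ forall k, continuous (h_ k),
    forall k x, 0 <= h_ k x <= M & forall x, h_ k x @[k --> \oo] --> z (ordcell x)].
Proof.
move=> z0.
have zM c : 0 <= z (inord c) <= \sum_c z c.
  by rewrite z0/= (bigD1 (inord c))//= lerDl sumr_ge0.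
have [h_ [ch hM hc]] := cell_approx u0 m delta_gt0 zM.
by exists h_, (\sum_c z c).
Qed.

(** Cumulative indicators: x <= level (l - 1) for 0 < l <= m.+1, with the extreme values 0 at l = 0
    and 1 at l = m.+2. Every cell, unbounded ones included, is a difference of two consecutive
    ones. *)
Let chi l x : R := (cell x < l)%N%:R.

Let chiE c x : ((ordcell x == c)%:R : R) = chi c.+1 x - chi c x.
Proof.
rewrite /chi -val_eqE/= ordcellE ltnS.
by case: ltngtP => _; rewrite ?subrr ?subr0.
Qed.

Let chi0 x : chi 0 x = 0. Proof. by []. Qed.

Let chi_level l x : (l <= m)%N -> chi l.+1 x = (x <= level l)%R%:R.
Proof. by move=> lm; rewrite /chi ltnS cell_le. Qed.

Let chi_top x : chi m.+2 x = 1.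
Proof. by rewrite /chi ltnS cell_ub. Qed.

Let bm_chi l : bounded_measurable (chi l).
Proof.
rewrite (_ : chi l = fun x => \sum_(c : 'I_m.+2 | (c < l)%N) ((ordcell x == c)%:R : R)).
  by apply: bm_sum => c _; exact: (bm_cl_eq ordcell_approx).
apply/funext => x; rewrite /chi -ordcellE.
case: (boolP (ordcell x < l)%N) => H.
  by rewrite (bigD1 (ordcell x))//= eqxx big1 ?addr0// => c /andP[_]; rewrite eq_sym => /negbTE ->.
by rewrite big1// => c cl; case: eqP => // cE; rewrite cE cl in H.
Qed.

(** The limit of t times the probability that [chi l] is 0 in one coordinate; it is 0 at the top
    index, where [chi] is identically 1. *)
Let tail l : R := if l == m.+2 then 0 else expR (- level l.-1).

Section exponential_side.
Context d (T : measurableType d) (Q : probability T R) (xi : nat -> {RV Q >-> R}).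
Hypothesis xi_exp : unit_exponentials xi.

Let g t l := \int[Q]_w chi l (- ln t + xi 1 w).

Let bm_g t l : bounded_measurable (fun w => chi l (- ln t + xi 1 w)).
Proof.
have [mc [M cM]] := bm_chi l; split; last by exists M.
by apply: (measurableT_comp mc); exact: measurable_funD.
Qed.

(** Once level + ln t is positive, the exponential tail there is exactly e^(-level) / t, so the
    expression is eventually constant. *)
Lemma exponential_chi_tail l : (0 < l <= m.+2)%N ->
  t * (1 - g t l) @[t --> +oo] --> tail l.
Proof.
move=> /andP[l0 lm]; rewrite /tail; have [->|lm2] := eqVneq l m.+2.
  rewrite (_ : (fun t => _) = cst 0); first exact: cvg_cst.
  apply/funext => t /=; rewrite /g; under eq_Rintegral do rewrite chi_top.
  by rewrite ex_cst subrr mulr0.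
have {}lm : (l.-1 <= m)%N by lia.
apply: cvg_near_cst; near=> t.
have t0 : 0 < t by near: t; exact: nbhs_pinfty_gt.
have te : expR (- level l.-1) < t by near: t; exact: nbhs_pinfty_gt.
have x0 : 0 < level l.-1 + ln t.
  have : - level l.-1 < ln t by rewrite -ltr_expR lnK ?posrE.
  by lra.
rewrite (_ : g t l = 1 - expR (- level l.-1) / t); first by field; rewrite gt_eqF.
rewrite /g.
transitivity (\int[Q]_w \1_(xi 1%N @^-1` `]-oo, level l.-1 + ln t]) w).
  apply: eq_Rintegral => w _; rewrite -(prednK l0) chi_level// indicE.
  congr (_%:R); congr nat_of_bool.
  by apply/idP/idP; rewrite inE /= in_itv/=; lra.
rewrite ex_indic; last exact: measurable_funPTI.
have -> : Q (xi 1%N @^-1` `]-oo, level l.-1 + ln t]) =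
    exponential_prob 1 `]-oo, level l.-1 + ln t] by exact: xi_exp.
have -> : exponential_prob 1 `]-oo, level l.-1 + ln t] =
    exponential_prob 1 `[0, level l.-1 + ln t].
  rewrite /exponential_prob [LHS]integral_mkcond [RHS]integral_mkcond.
  apply: eq_integral => x _; rewrite !patchE.
  have [x0'|x0'] := ltP x 0.
    rewrite lt0_exponential_pdf//; by do 2 case: ifP.
  congr (if _ then _ else _); apply/idP/idP; rewrite !inE/= !in_itv/= ?x0'//.
rewrite (exponential_prob_itv0c 1 x0) mulN1r /=; congr (1 - _).
by rewrite opprD expRD expRN (expRN (ln t)) lnK// -expRN.
Unshelve. all: by end_near. Qed.

Lemma cell_probE t c : cell_prob ordcell xi (- ln t) c = g t c.+1 - g t c.
Proof. by rewrite /cell_prob -exB//; apply: eq_Rintegral => w _; exact: chiE. Qed.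

Lemma exponential_chi0 t : g t 0 = 0.
Proof. by rewrite /g; under eq_Rintegral do rewrite chi0; rewrite ex_cst. Qed.

End exponential_side.

Section extreme_side.
Context d (T : measurableType d) (P : probability T R).
Context (V : {RV P >-> (R * R)%type}) (a1 b1 a2 b2 : R -> R).
Hypothesis a1_gt0 : forall t : R, 0 < t -> 0 < a1 t.
Hypothesis a2_gt0 : forall t : R, 0 < t -> 0 < a2 t.
Hypothesis V_cvg : forall e, 0 < e -> \forall t \near +oo, forall x y,
  `|joint_cdf V (a1 t * x + b1 t) (a2 t * y + b2 t) `^ t - bigumbel_cdf x y| <= e.

Let X t w := ((V w).1 - b1 t) / a1 t.
Let Y t w := ((V w).2 - b2 t) / a2 t.

Let mX t : measurable_fun setT (X t).
Proof.
apply: measurable_funM => //; apply: measurable_funB => //.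
by apply: (measurableT_comp measurable_fst).
Qed.

Let mY t : measurable_fun setT (Y t).
Proof.
apply: measurable_funM => //; apply: measurable_funB => //.
by apply: (measurableT_comp measurable_snd).
Qed.

Definition extreme_cells t (z : R * R) : 'I_m.+2 * 'I_m.+2 :=
  (ordcell ((z.1 - b1 t) / a1 t), ordcell ((z.2 - b2 t) / a2 t)).

Let G t l l' := \int[P]_w (chi l (X t w) * chi l' (Y t w)).

Let bm_chi_comp d0 (T0 : measurableType d0) l (f : T0 -> R) : measurable_fun setT f ->
  bounded_measurable (fun w => chi l (f w)).
Proof.
move=> mf; have [mc [M cM]] := bm_chi l; split; last by exists M.
exact: (measurableT_comp mc).
Qed.

Let bm_G t l l' : bounded_measurable (fun w => chi l (X t w) * chi l' (Y t w)).
Proof. by apply: bmM; apply: bm_chi_comp. Qed.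

Let X_le t w l : 0 < t -> (X t w <= l) = ((V w).1 <= a1 t * l + b1 t).
Proof. by move=> t0; rewrite /X ler_pdivrMr ?a1_gt0// lerBlDr mulrC. Qed.

Let Y_le t w l : 0 < t -> (Y t w <= l) = ((V w).2 <= a2 t * l + b2 t).
Proof. by move=> t0; rewrite /Y ler_pdivrMr ?a2_gt0// lerBlDr mulrC. Qed.

(** The index m.+2 removes the constraint on its coordinate, so the four cases call for the joint
    distribution function, for either marginal, or for nothing. *)
Lemma extreme_chi_tail l l' : (0 < l <= m.+2)%N -> (0 < l' <= m.+2)%N ->
  t * (1 - G t l l') @[t --> +oo] --> tail l + tail l'.
Proof.
move=> /andP[l0 lm] /andP[l'0 l'm]; rewrite /tail.
have [lE|lm2] := eqVneq l m.+2; have [l'E|l'm2] := eqVneq l' m.+2.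
- rewrite (_ : (fun t => _) = cst 0) ?addr0; first exact: cvg_cst.
  apply/funext => t /=; rewrite /G lE l'E.
  under eq_Rintegral do rewrite !chi_top mulr1.
  by rewrite ex_cst subrr mulr0.
- have {}l'm : (l'.-1 <= m)%N by lia.
  rewrite add0r.
  apply: cvg_trans (cdf2_tail_cvg (y := level l'.-1) a1_gt0 V_cvg).
  apply: near_eq_cvg; near=> t.
  have t0 : 0 < t by near: t; exact: nbhs_pinfty_gt.
  congr (_ * (1 - _)); rewrite /cdf2 -ex_indic; last first.
    rewrite (_ : [set w | _] = Y t @^-1` `]-oo, level l'.-1]).
      by rewrite -[X in measurable X]setTI; exact: mY.
    by apply/seteqP; split=> w /=; rewrite in_itv/= Y_le.
  apply: eq_Rintegral => w _.
  rewrite lE chi_top mul1r -(prednK l'0) chi_level// Y_le// indicE.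
  by congr (_%:R); congr nat_of_bool; apply/idP/idP; rewrite inE.
- have {}lm : (l.-1 <= m)%N by lia.
  rewrite addr0.
  apply: cvg_trans (cdf1_tail_cvg (x := level l.-1) a2_gt0 V_cvg).
  apply: near_eq_cvg; near=> t.
  have t0 : 0 < t by near: t; exact: nbhs_pinfty_gt.
  congr (_ * (1 - _)); rewrite /cdf1 -ex_indic; last first.
    rewrite (_ : [set w | _] = X t @^-1` `]-oo, level l.-1]).
      by rewrite -[X in measurable X]setTI; exact: mX.
    by apply/seteqP; split=> w /=; rewrite in_itv/= X_le.
  apply: eq_Rintegral => w _.
  rewrite l'E chi_top mulr1 -(prednK l0) chi_level// X_le// indicE.
  by congr (_%:R); congr nat_of_bool; apply/idP/idP; rewrite inE.
- have {}lm : (l.-1 <= m)%N by lia.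
  have {}l'm : (l'.-1 <= m)%N by lia.
  apply: cvg_trans (joint_tail_cvg (x := level l.-1) (y := level l'.-1) V_cvg).
  apply: near_eq_cvg; near=> t.
  have t0 : 0 < t by near: t; exact: nbhs_pinfty_gt.
  congr (_ * (1 - _)); rewrite joint_cdfE -ex_indic; last first.
    rewrite (_ : [set w | _] = (X t @^-1` `]-oo, level l.-1]) `&`
        (Y t @^-1` `]-oo, level l'.-1])).
      apply: measurableI; first by rewrite -[X in measurable X]setTI; exact: mX.
      by rewrite -[X in measurable X]setTI; exact: mY.
    by apply/seteqP; split=> w /=; rewrite !in_itv/= Y_le// X_le.
  apply: eq_Rintegral => w _.
  rewrite -(prednK l0) -(prednK l'0) !chi_level// Y_le// X_le// indicE -natrM mulnb.
  congr (_%:R); congr nat_of_bool; apply/idP/idP; rewrite inE /=.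
    by move=> [-> ->].
  by move=> /andP[].
Unshelve. all: by end_near. Qed.

Lemma extreme_chi0l t l' : G t 0 l' = 0.
Proof. by rewrite /G; under eq_Rintegral do rewrite chi0 mul0r; rewrite ex_cst. Qed.

Lemma extreme_chi0r t l : G t l 0 = 0.
Proof. by rewrite /G; under eq_Rintegral do rewrite chi0 mulr0; rewrite ex_cst. Qed.

Lemma extreme_cell_probE t c :
  \int[P]_w ((extreme_cells t (V w) == c)%:R : R) =
  G t c.1.+1 c.2.+1 - G t c.1 c.2.+1 - G t c.1.+1 c.2 + G t c.1 c.2.
Proof.
pose f l l' w := chi l (X t w) * chi l' (Y t w).
have bf l l' : bounded_measurable (f l l') := bm_G t l l'.
rewrite -[G t c.1.+1 c.2.+1]/(\int[P]_w f _ _ w) -[G t c.1 c.2.+1]/(\int[P]_w f _ _ w).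
rewrite -[G t c.1.+1 c.2]/(\int[P]_w f _ _ w) -[G t c.1 c.2]/(\int[P]_w f _ _ w).
rewrite -exB// -exB//; last exact: bmB.
rewrite -exD//; last by apply: bmB => //; exact: bmB.
apply: eq_Rintegral => w _; case: c => c c'.
rewrite /extreme_cells xpair_eqE -mulnb natrM !chiE /=.
by rewrite /f /X /Y; ring.
Qed.

Context d' (T' : measurableType d') (Q : probability T' R) (xi1 xi2 : nat -> {RV Q >-> R}).
Hypothesis xi1_exp : unit_exponentials xi1.
Hypothesis xi2_exp : unit_exponentials xi2.

Let g1 t l := \int[Q]_w chi l (- ln t + xi1 1 w).
Let g2 t l := \int[Q]_w chi l (- ln t + xi2 1 w).

(** With a = 1 - g1 and b = 1 - g2 one has G - g1 g2 = a + b - a b - (1 - G). The tails cancel in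
    the limit because - ln H is a sum of functions of x and of y, and t a b = (t a)(t b) / t tends
    to 0. At an index 0 everything vanishes. *)
Let diff_cvg l l' : (l <= m.+2)%N -> (l' <= m.+2)%N ->
  t * (G t l l' - g1 t l * g2 t l') @[t --> +oo] --> 0.
Proof.
move=> lm l'm; have [->|l0] := posnP l.
  rewrite (_ : (fun t => _) = cst 0); first exact: cvg_cst.
  by apply/funext => t /=; rewrite extreme_chi0l [g1 t 0]exponential_chi0 mul0r subrr mulr0.
have [->|l'0] := posnP l'.
  rewrite (_ : (fun t => _) = cst 0); first exact: cvg_cst.
  by apply/funext => t /=; rewrite extreme_chi0r [g2 t 0]exponential_chi0 mulr0 subrr mulr0.
have hl : (0 < l <= m.+2)%N by rewrite l0.
have hl' : (0 < l' <= m.+2)%N by rewrite l'0.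
have c1 := exponential_chi_tail xi1_exp hl; have c2 := exponential_chi_tail xi2_exp hl'.
have cG := extreme_chi_tail hl hl'.
have c12 : (t * (1 - g1 t l)) * (t * (1 - g2 t l')) * t^-1 @[t --> +oo] -->
    tail l * tail l' * 0.
  by apply: cvgM; [exact: cvgM|exact: cvg_inv_pinfty].
have H : t * (1 - g1 t l) + t * (1 - g2 t l') -
    (t * (1 - g1 t l)) * (t * (1 - g2 t l')) * t^-1 - t * (1 - G t l l')
    @[t --> +oo] --> 0.
  rewrite -[X in _ --> X](subrr (tail l + tail l')); apply: cvgB => //.
  rewrite -[X in _ --> X]subr0 -[X in _ - X](mulr0 (tail l * tail l')).
  by apply: cvgB => //; exact: cvgD.
apply: cvg_trans H; apply: near_eq_cvg; near=> t.
have t0 : t != 0 by rewrite gt_eqF//; near: t; exact: nbhs_pinfty_gt.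
by field.
Unshelve. all: by end_near. Qed.

Lemma cell_prob_diff_cvg :
  t * (\sum_c `|\int[P]_w ((extreme_cells t (V w) == c)%:R : R) -
    cell_prob ordcell xi1 (- ln t) c.1 * cell_prob ordcell xi2 (- ln t) c.2|)
  @[t --> +oo] --> 0.
Proof.
have cvgc (c : 'I_m.+2 * 'I_m.+2) :
    t * `|\int[P]_w ((extreme_cells t (V w) == c)%:R : R) -
    cell_prob ordcell xi1 (- ln t) c.1 * cell_prob ordcell xi2 (- ln t) c.2|
    @[t --> +oo] --> 0.
  have lc1 : (c.1 < m.+2)%N by [].
  have lc2 : (c.2 < m.+2)%N by [].
  have h1 := diff_cvg lc1 lc2; have h2 := diff_cvg (ltnW lc1) lc2.
  have h3 := diff_cvg lc1 (ltnW lc2); have h4 := diff_cvg (ltnW lc1) (ltnW lc2).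
  have H : `|t * (G t c.1.+1 c.2.+1 - g1 t c.1.+1 * g2 t c.2.+1) -
      t * (G t c.1 c.2.+1 - g1 t c.1 * g2 t c.2.+1) -
      t * (G t c.1.+1 c.2 - g1 t c.1.+1 * g2 t c.2) +
      t * (G t c.1 c.2 - g1 t c.1 * g2 t c.2)| @[t --> +oo] --> 0.
    rewrite -[X in _ --> X](@normr0 _ R); apply: cvg_norm.
    rewrite -[X in _ --> X](addr0 (0 : R)); apply: cvgD => //.
    rewrite -[X in _ --> X](subr0 (0 : R)); apply: cvgB => //.
    by rewrite -[X in _ --> X](subr0 (0 : R)); apply: cvgB.
  apply: cvg_trans H; apply: near_eq_cvg; near=> t.
  have t0 : 0 < t by near: t; exact: nbhs_pinfty_gt.
  rewrite extreme_cell_probE !cell_probE -/(g1 t _) -/(g1 t _) -/(g2 t _) -/(g2 t _).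
  have tN (x : R) : t * `|x| = `|t * x| by rewrite normrM gtr0_norm.
  rewrite tN; congr (`|_|).
  by rewrite /g1 /g2; ring.
have E : \sum_(c : 'I_m.+2 * 'I_m.+2) (0 : R) = 0 by rewrite big1.
rewrite -[X in _ --> X]E; under eq_fun do rewrite mulr_sumr.
apply: cvg_big => [|c _]; first exact: add_continuous.
exact: cvgc.
Unshelve. all: by end_near. Qed.

End extreme_side.

End cell_probabilities.

(** * Comparison of the rounded samples *)

(** Required below in each argument separately, which is stronger than invariance under a common
    permutation of the pairs; it holds because the components are ordered separately. *)
Definition multiset_fun (R : realType) n (theta : (nat -> R) -> R) : Prop :=
  forall x y, perm_eq [seq x j | j <- iota 1 n] [seq y j | j <- iota 1 n] ->
    theta x = theta y.

Section rounded_models.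
Context (R : realType) (u0 delta : R) (m : nat).
Hypothesis delta_gt0 : 0 < delta.
Local Notation level := (level u0 delta).
Local Notation rho := (round_up u0 delta m).
Local Notation C := 'I_m.+2.
Local Notation ordcell := (ordcell u0 delta m).

(** Reads a vector of cells back as a sequence of rounded values indexed from 1. The default 0
    beyond n is harmless, as only the entries 1 to n are inspected. *)
Let ext n (v : {ffun 'I_n -> C}) (j : nat) : R :=
  if insub j.-1 is Some i then level (v i) else 0.

Let map_ext n (v : {ffun 'I_n -> C}) :
  [seq ext v j | j <- iota 1 n] = [seq level (v i) | i <- enum 'I_n].
Proof.
rewrite -[1%N]addn0 iotaDl -map_comp -val_enum_ord -map_comp.
by apply: eq_map => i; rewrite /ext /= valK.
Qed.

Let ext_perm n (f : {ffun 'I_n -> 'I_n}) (v : {ffun 'I_n -> C}) : injective f ->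
  perm_eq [seq ext [ffun i => v (f i)] j | j <- iota 1 n] [seq ext v j | j <- iota 1 n].
Proof.
move=> finj; rewrite !map_ext.
rewrite (eq_map (g := (fun i => level (v i)) \o f)); last by move=> i; rewrite /= ffunE.
rewrite map_comp; apply: perm_map; apply: uniq_perm.
- by rewrite map_inj_uniq ?enum_uniq.
- exact: enum_uniq.
- move=> i; rewrite mem_enum inE; have [g fg gf] := injF_bij finj.
  by apply/mapP; exists (g i); rewrite ?mem_enum// gf.
Qed.

Let ext_round n (x : nat -> R) :
  perm_eq [seq (rho \o x) j | j <- iota 1 n]
          [seq ext [ffun i : 'I_n => ordcell (x i.+1)] j | j <- iota 1 n].
Proof.
rewrite map_ext -[1%N]addn0 iotaDl -map_comp -val_enum_ord -map_comp.
apply/permP => a; congr count; apply: eq_map => i.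
by rewrite /= ffunE ordcellE.
Qed.

Context d (T : measurableType d) (P : probability T R) (XY : nat -> {RV P >-> (R * R)%type}).
Hypothesis XY_indep : independent_family [set n | (0 < n)%N] XY.
Hypothesis XY_ident : identically_distributed [set n | (0 < n)%N] XY.
Context d' (T' : measurableType d') (Q : probability T' R).
Variables xi1 xi2 : nat -> {RV Q >-> R}.
Variables (G1 G2 : set (set T')).
Hypotheses (G1m : G1 `<=` measurable) (G2m : G2 `<=` measurable).
Hypothesis G12 : independent_systems Q <<s G1 >> <<s G2 >>.
Hypothesis xi1G : forall j, (0 < j)%N ->
  measurable_fun setT (xi1 j : g_sigma_algebraType G1 -> R).
Hypothesis xi2G : forall j, (0 < j)%N ->
  measurable_fun setT (xi2 j : g_sigma_algebraType G2 -> R).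
Hypothesis xi1_indep : independent_family [set n | (0 < n)%N] xi1.
Hypothesis xi2_indep : independent_family [set n | (0 < n)%N] xi2.
Hypothesis xi1_exp : unit_exponentials xi1.
Hypothesis xi2_exp : unit_exponentials xi2.
Context (a1 b1 a2 b2 : R -> R).

Definition normX t w (j : nat) := ((XY j w).1 - b1 t) / a1 t.
Definition normY t w (j : nat) := ((XY j w).2 - b2 t) / a2 t.
Definition renyi1 t n w j := - ln t + renyi (xi1 ^~ w) n j.
Definition renyi2 t n w j := - ln t + renyi (xi2 ^~ w) n j.

Definition cell_discrepancy t : R :=
  \sum_c `|\int[P]_w ((extreme_cells u0 delta m a1 b1 a2 b2 t (XY 1 w) == c)%:R : R) -
    cell_prob ordcell xi1 (- ln t) c.1 * cell_prob ordcell xi2 (- ln t) c.2|.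

Let mcl t c : measurable [set z | extreme_cells u0 delta m a1 b1 a2 b2 t z = c].
Proof.
pose fx (z : R * R) := (z.1 - b1 t) / a1 t.
pose fy (z : R * R) := (z.2 - b2 t) / a2 t.
have mfx : measurable_fun setT fx.
  by apply: measurable_funM => //; apply: measurable_funB => //; exact: measurable_fst.
have mfy : measurable_fun setT fy.
  by apply: measurable_funM => //; apply: measurable_funB => //; exact: measurable_snd.
have mcell (f : R * R -> R) c' : measurable_fun setT f ->
    measurable [set z | ordcell (f z) = c'].
  move=> mf; have [mc _] := bm_cl_eq (@ordcell_approx R u0 delta m delta_gt0) c'.
  rewrite (_ : [set z | _] =
      setT `&` ((fun x => (ordcell x == c')%:R : R) \o f) @^-1` [set 1]).
    exact: (measurableT_comp mc mf).
  apply/seteqP; split=> z /=; first by move=> ->; rewrite eqxx.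
  by move=> [_]; case: eqP => // _ /eqP; rewrite eq_sym oner_eq0.
rewrite (_ : [set z | _] = [set z | ordcell (fx z) = c.1] `&` [set z | ordcell (fy z) = c.2]).
  by apply: measurableI; exact: mcell.
by case: c => c c'; apply/seteqP; split=> z /=; [case=> <- <-|case=> <- <-].
Qed.

Section comparison.
Variables (n : nat) (theta : (nat -> R) -> (nat -> R) -> R) (M : R).
Hypothesis theta_ms1 : forall y, multiset_fun n (theta ^~ y).
Hypothesis theta_ms2 : forall x, multiset_fun n (theta x).
Hypothesis theta_bound : forall x y, `|theta x y| <= M.

Let th (v : {ffun 'I_n -> C * C}) :=
  theta (ext [ffun i => (v i).1]) (ext [ffun i => (v i).2]).

Let roundP t w : theta (rho \o normX t w) (rho \o normY t w) =
  th (iid_cells XY (extreme_cells u0 delta m a1 b1 a2 b2 t) n w).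
Proof.
rewrite (theta_ms1 _ (ext_round n _)) (theta_ms2 _ (ext_round n _)) /th.
by congr (theta _ _); congr ext; apply/ffunP => i; rewrite !ffunE.
Qed.

Let roundQ t w : theta (rho \o renyi1 t n w) (rho \o renyi2 t n w) =
  theta (ext (renyi_cells ordcell n (- ln t) (xi1 ^~ w)))
        (ext (renyi_cells ordcell n (- ln t) (xi2 ^~ w))).
Proof.
by rewrite (theta_ms1 _ (ext_round n _)) (theta_ms2 _ (ext_round n _)).
Qed.

Lemma bm_roundP t :
  bounded_measurable (fun w => theta (rho \o normX t w) (rho \o normY t w)).
Proof.
rewrite (_ : (fun w => _) =
    fun w => th (iid_cells XY (extreme_cells u0 delta m a1 b1 a2 b2 t) n w)).
  by apply: bm_finite_valued => v; exact: bm_iid_cells.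
by apply/funext => w; exact: roundP.
Qed.

Lemma bm_roundQ t :
  bounded_measurable (fun w => theta (rho \o renyi1 t n w) (rho \o renyi2 t n w)).
Proof.
pose V w := (renyi_cells ordcell n (- ln t) (xi1 ^~ w), renyi_cells ordcell n (- ln t) (xi2 ^~ w)).
rewrite (_ : (fun w => _) = fun w => (fun uv => theta (ext uv.1) (ext uv.2)) (V w)).
  apply: (@bm_finite_valued _ _ _ _ V (fun uv => theta (ext uv.1) (ext uv.2))) => -[u v].
  rewrite (_ : (fun w => _) = fun w =>
      (renyi_cells ordcell n (- ln t) (xi1 ^~ w) == u)%:R *
      (renyi_cells ordcell n (- ln t) (xi2 ^~ w) == v)%:R :> R).
    by apply: bmM; apply: (bm_renyi_cells (@ordcell_approx R u0 delta m delta_gt0)).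
  by apply/funext => w; rewrite /V xpair_eqE -natrM mulnb.
by apply/funext => w; exact: roundQ.
Qed.

(** After rounding, both sides are sums over vectors of cell pairs with product weights: immediately
    so for the iid pairs, and for the Renyi sums because [theta] is symmetric in each argument.
    [sum_prod_dist] compares the weights. *)
Lemma rounded_comparison t :
  `|\int[P]_w theta (rho \o normX t w) (rho \o normY t w) -
    \int[Q]_w theta (rho \o renyi1 t n w) (rho \o renyi2 t n w)| <=
  M * (n%:R * cell_discrepancy t).
Proof.
have -> : \int[P]_w theta (rho \o normX t w) (rho \o normY t w) =
    \int[P]_w th (iid_cells XY (extreme_cells u0 delta m a1 b1 a2 b2 t) n w).
  by apply: eq_Rintegral => w _; exact: roundP.
have -> : \int[Q]_w theta (rho \o renyi1 t n w) (rho \o renyi2 t n w) =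
    \int[Q]_w theta (ext (renyi_cells ordcell n (- ln t) (xi1 ^~ w)))
        (ext (renyi_cells ordcell n (- ln t) (xi2 ^~ w))).
  by apply: eq_Rintegral => w _; exact: roundQ.
rewrite (ex_iid_cells XY_indep XY_ident (mcl t)).
rewrite (ex_renyi_cells (@ordcell_approx R u0 delta m delta_gt0) G1m G2m G12 xi1G xi2G
  xi1_indep xi2_indep xi1_exp xi2_exp (-ln t)
  (theta := fun u v => theta (ext u) (ext v))); last 2 first.
- by move=> f u v finj; apply: theta_ms1; exact: ext_perm.
- by move=> f u v finj; apply: theta_ms2; exact: ext_perm.
pose pB (c : C * C) := cell_prob ordcell xi1 (- ln t) c.1 * cell_prob ordcell xi2 (- ln t) c.2.
have M0 : 0 <= M by exact: le_trans (normr_ge0 _) (theta_bound (fun=> 0) (fun=> 0)).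
rewrite -sumrB (le_trans (ler_norm_sum _ _ _))//.
have pB1 : \sum_c pB c = 1.
  rewrite /pB -(pair_bigA _ (fun c c' => cell_prob ordcell xi1 (- ln t) c *
    cell_prob ordcell xi2 (- ln t) c'))/=.
  under eq_bigr do rewrite -mulr_sumr (sum_cell_prob (@ordcell_approx R u0 delta m delta_gt0)) mulr1.
  exact: (sum_cell_prob (@ordcell_approx R u0 delta m delta_gt0)).
apply: le_trans (ler_wpM2l M0 (@sum_prod_dist _ _ n _ pB _ _ _ pB1)).
- rewrite mulr_sumr; apply: ler_sum => v _.
  rewrite -mulrBl normrM mulrC.
  by apply: ler_wpM2r; [exact: normr_ge0|exact: theta_bound].
- by move=> c; exact: iid_cell_prob_ge0.
- by move=> c; rewrite mulr_ge0// cell_prob_ge0.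
- exact: (sum_iid_cell_prob XY (mcl t)).
Qed.

End comparison.

End rounded_models.

(** * Reduction to uniformly continuous test functions *)

Section continuous_functions_of_pairs.
Context (R : realType).

Definition uniform_on_plane (f : R * R -> R) := forall e, 0 < e -> exists2 delta,
  0 < delta & forall x y x' y', `|x - x'| <= delta -> `|y - y'| <= delta ->
    `|f (x, y) - f (x', y')| <= e.

(** Compactness in its near-covering form gives one [delta] for the whole square; only the first of
    the two points has to lie in it. *)
Lemma uniform_on_square (f : R * R -> R) (L e : R) : continuous f -> 0 < e ->
  exists2 delta, 0 < delta & forall x y x' y', `|x| <= L -> `|y| <= L ->
    `|x - x'| <= delta -> `|y - y'| <= delta -> `|f (x, y) - f (x', y')| <= e.
Proof.
move=> cf e0.
have cK : compact (`[- L, L]%classic `*` `[- L, L]%classic : set (R * R)).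
  by apply: compact_setX; exact: segment_compact.
pose good d (z : R * R) := forall z' : R * R,
  `|z.1 - z'.1| <= d -> `|z.2 - z'.2| <= d -> `|f z - f z'| <= e.
have e2 : 0 < e / 2 by rewrite divr_gt0.
have cover (z : R * R) : (`[- L, L]%classic `*` `[- L, L]%classic) z ->
    \forall z1 \near z & d \near 0^'+, good d z1.
  move=> _; have /cvgrPdist_le/(_ _ e2)/nbhs_ballP[r /= r0 Hr] := cf z.
  have r2 : 0 < r / 2 by rewrite divr_gt0.
  exists (ball z (r / 2), [set d : R | d < r / 2]) => /=.
    by split; [exact: nbhsx_ballx|exact: nbhs_right_lt].
  move=> [z1 d] /= [[z11 z12] dr] z' z'1 z'2; rewrite /ball/= in z11 z12.
  have h1 : `|f z - f z1| <= e / 2.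
    by apply: Hr; split; rewrite /ball/=; lra.
  have h2 : `|f z - f z'| <= e / 2.
    apply: Hr; split; rewrite /ball/=.
      by have := ler_distD z1.1 z.1 z'.1; lra.
    by have := ler_distD z1.2 z.2 z'.2; lra.
  have := ler_distD (f z) (f z1) (f z'); rewrite (distrC (f z1) (f z)); lra.
have H := (compact_near_coveringP _).1 cK _ _ good _ cover.
have [d [Hd d0]] := filter_ex (filterI (H _) (nbhs_right_gt (0 : R))).
exists d => // x y x' y' xL yL xx' yy'.
by apply: (Hd (x, y)) => //=; rewrite /= !in_itv/= -!ler_norml.
Qed.

Lemma uniform_compact_support (f : R * R -> R) (L : R) : continuous f ->
  (forall x y, L < `|x| \/ L < `|y| -> f (x, y) = 0) -> uniform_on_plane f.
Proof.
move=> cf f0 e e0.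
(* The margin 1 in the square and in the bound on the distance ensures that when (x, y) leaves the
   larger square, both points are off the support. *)
have [delta d0 Hd] := uniform_on_square (L + 1) cf e0.
exists (Num.min delta 1); first by rewrite lt_min d0 ltr01.
move=> x y x' y'; rewrite !le_min => /andP[xd x1] /andP[yd y1].
have [xL|xL] := leP `|x| (L + 1); last first.
  rewrite !f0 ?subrr ?normr0 ?ltW//; left; last by lra.
  have := ler_distD x' x 0; rewrite !subr0; lra.
have [yL|yL] := leP `|y| (L + 1); last first.
  rewrite !f0 ?subrr ?normr0 ?ltW//; right; last by lra.
  have := ler_distD y' y 0; rewrite !subr0; lra.
exact: Hd.
Qed.

(** 2 (k+1)^2 steps of length 1/(k+1) lead from -(k+1) to k+1, so the grid refines and exhausts the
    line at once. *)
Lemma round_up_cvg (x : R) :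
  round_up (- k.+1%:R) (k.+1%:R^-1) (k.+1 * k.+1 * 2) x @[k --> \oo] --> x.
Proof.
apply/cvgrPdist_le => e e0; near=> k.
have k0 : 0 < k.+1%:R :> R by [].
have kx : `|x| < k.+1%:R.
  near: k; have [N _ HN] := nbhs_infty_gtr `|x|; exists N => // k /= Nk.
  by rewrite (lt_trans (HN _ Nk))// ltr_nat.
have ki0 : 0 < k.+1%:R^-1 :> R by rewrite invr_gt0.
have H : level (- k.+1%:R) (k.+1%:R^-1) 0 < x <= level (- k.+1%:R) (k.+1%:R^-1) (k.+1 * k.+1 * 2).
  rewrite /level mul0r addr0 !natrM (_ : - k.+1%:R + _ = k.+1%:R).
    by move: kx; rewrite ltr_norml => /andP[-> /ltW ->].
  have : k.+1%:R != 0 :> R by rewrite pnatr_eq0.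
  by move: (k.+1%:R : R) => c c0; field.
rewrite distrC; apply: le_trans (round_up_dist ki0 H) _.
near: k; apply: filterS (near_infty_natSinv_lt (PosNum e0)) => k /=.
exact: ltW.
Unshelve. all: by end_near. Qed.

(** Measurability for the product sigma-algebra: f (U, V) is the pointwise limit of f at rounded
    arguments, a function of finitely many measurable cells. *)
Lemma bm_continuous_pair d (T : measurableType d) (f : R * R -> R) (U V : T -> R) :
  continuous f -> (exists M, forall u, `|f u| <= M) ->
  measurable_fun setT U -> measurable_fun setT V ->
  bounded_measurable (fun w => f (U w, V w)).
Proof.
move=> cf [M fM] mU mV; split; last by exists M.
pose rd k := @round_up R (- k.+1%:R) (k.+1%:R^-1) (k.+1 * k.+1 * 2).
have d0 k : 0 < k.+1%:R^-1 :> R by rewrite invr_gt0.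
apply: (@measurable_fun_cvg _ _ _ _ (fun k w => f (rd k (U w), rd k (V w)))); last first.
  move=> w _; apply: continuous_cvg; first exact: cf.
  exact: (cvg_pair (@round_up_cvg (U w)) (@round_up_cvg (V w))).
move=> k; pose oc := @ordcell R (- k.+1%:R) (k.+1%:R^-1) (k.+1 * k.+1 * 2).
pose lv l := level (- k.+1%:R) (k.+1%:R^-1 : R) l.
have bo (g : T -> R) c : measurable_fun setT g ->
    bounded_measurable (fun w => (oc (g w) == c)%:R : R).
  move=> mg; have [mc [M' cM]] := bm_cl_eq (@ordcell_approx _ (- k.+1%:R) _ _ (d0 k)) c.
  split; last by exists M'.
  exact: (measurableT_comp mc mg).
rewrite (_ : (fun w => _) = fun w => f (lv (oc (U w)), lv (oc (V w)))).
  have [//] : bounded_measurable (fun w => f (lv (oc (U w)), lv (oc (V w)))).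
  apply: (@bm_finite_valued _ _ _ _ (fun w => (oc (U w), oc (V w)))
     (fun c => f (lv (c.1 : nat), lv (c.2 : nat)))) => -[c c'].
  rewrite (_ : (fun w => _) = fun w => (oc (U w) == c)%:R * (oc (V w) == c')%:R :> R).
    by apply: bmM; exact: bo.
  by apply/funext => w; rewrite xpair_eqE -natrM mulnb.
by apply/funext => w; rewrite /rd /round_up /lv /= !ordcellE.
Qed.

End continuous_functions_of_pairs.

Section cutoff.
Context (R : realType).

Let bump (L x : R) := clamp 0 1 (L + 1 - `|x|).

Let continuous_bump L : continuous (bump L).
Proof.
move=> x; have c1 : {for x, continuous (fun y : R => L + 1 - `|y|)}.
  by apply: cvgB; [exact: cvg_cst|apply: cvg_norm; exact: cvg_id].
exact: (continuous_comp c1 (@continuous_clamp R 0 1 _)).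
Qed.

Let bump01 L x : 0 <= bump L x <= 1.
Proof. by apply: clamp_bound. Qed.

Let bump_out L x : L + 1 < `|x| -> bump L x = 0.
Proof. by move=> xL; rewrite /bump /clamp max_l ?min_r//; lra. Qed.

Let bump_in L x : `|x| <= L -> bump L x = 1.
Proof. by move=> xL; rewrite /bump /clamp max_r ?min_l//; lra. Qed.

Let cut L (u : R * R) := bump L u.1 * bump L u.2.

Let continuous_cut L : continuous (cut L).
Proof.
move=> u; apply: cvgM.
  by apply: (continuous_comp (@cvg_fst _ _ _ _ _) (@continuous_bump L u.1)).
by apply: (continuous_comp (@cvg_snd _ _ _ _ _) (@continuous_bump L u.2)).
Qed.

Let cut01 L u : 0 <= cut L u <= 1.
Proof.
have /andP[h1 h2] := bump01 L u.1; have /andP[h3 h4] := bump01 L u.2.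
by rewrite mulr_ge0//= mulr_ile1.
Qed.

(* The cutoff is tested against both laws, so no tightness of U, V is assumed. *)
Lemma ex_cvg_compact_support d (T : measurableType d) (P : probability T R)
    d' (T' : measurableType d') (Q : probability T' R)
    (U V : R -> T -> R) (U' V' : T' -> R) :
  (forall t, measurable_fun setT (U t)) -> (forall t, measurable_fun setT (V t)) ->
  measurable_fun setT U' -> measurable_fun setT V' ->
  (forall f : R * R -> R, continuous f -> (exists M, forall u, `|f u| <= M) ->
    uniform_on_plane f ->
    \int[P]_w f (U t w, V t w) @[t --> +oo] --> \int[Q]_w f (U' w, V' w)) ->
  forall f : R * R -> R, continuous f -> (exists M, forall u, `|f u| <= M) ->
    \int[P]_w f (U t w, V t w) @[t --> +oo] --> \int[Q]_w f (U' w, V' w).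
Proof.
move=> mU mV mU' mV' H f cf bf; have [M fM] := bf.
have M0 : 0 <= M by exact: le_trans (normr_ge0 _) (fM (0, 0)).
have bcut L : exists M, forall u, `|cut L u| <= M.
  by exists 1 => u; have /andP[h1 h2] := cut01 L u; rewrite ger0_norm.
have ucut L (g : R * R -> R) : continuous g ->
    uniform_on_plane (fun u => g u * cut L u).
  move=> cg; apply: (@uniform_compact_support _ _ (L + 1)).
    by move=> u; apply: cvgM; [exact: cg|exact: continuous_cut].
  move=> x y [xL|yL]; rewrite /cut/=.
    by rewrite (bump_out xL) mul0r mulr0.
  by rewrite (bump_out yL) !mulr0.
have Hcut L : \int[P]_w cut L (U t w, V t w) @[t --> +oo] -->
    \int[Q]_w cut L (U' w, V' w).
  apply: (H (cut L) (@continuous_cut L) (bcut L)).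
  have := ucut L (cst 1) (@cst_continuous _ _ _).
  by rewrite (_ : (fun u => _) = cut L)//; apply/funext => u; rewrite mul1r.
have Hf L : \int[P]_w (f (U t w, V t w) * cut L (U t w, V t w)) @[t --> +oo] -->
    \int[Q]_w (f (U' w, V' w) * cut L (U' w, V' w)).
  apply: (H (fun u => f u * cut L u)); last exact: ucut.
    by move=> u; apply: cvgM; [exact: cf|exact: continuous_cut].
  exists (M * 1) => u; rewrite normrM ler_pM//.
  by have /andP[h1 h2] := cut01 L u; rewrite ger0_norm.
have bP t L := bm_continuous_pair (@continuous_cut L) (bcut L) (mU t) (mV t).
have bQ L := bm_continuous_pair (@continuous_cut L) (bcut L) mU' mV'.
have bfP t := bm_continuous_pair cf bf (mU t) (mV t).
have bfQ := bm_continuous_pair cf bf mU' mV'.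
have Q1 : \int[Q]_w cut n%:R (U' w, V' w) @[n --> \oo] --> (1 : R).
  rewrite -[X in _ --> X](ex_cst Q); apply: (ex_cvg (M := 1)) => //.
  - by move=> n; case: (bQ n%:R).
  - by move=> n w; have /andP[h1 h2] := cut01 n%:R (U' w, V' w); rewrite ger0_norm.
  - apply: aeW => w; apply: cvg_near_cst; near=> n.
    rewrite /cut !bump_in ?mulr1//=; near: n; exact: nbhs_infty_ger.
have est d0 (T0 : measurableType d0) (P0 : probability T0 R) (g c : T0 -> R) :
    bounded_measurable g -> bounded_measurable c -> (forall w, 0 <= c w <= 1) ->
    (forall w, `|g w| <= M) ->
    `|\int[P0]_w g w - \int[P0]_w (g w * c w)| <= M * (1 - \int[P0]_w c w).
  move=> bg bc c01 gM.
  have bd : bounded_measurable (fun w => M * (1 - c w)).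
    by apply: bmZ; apply: bmB => //; exact: bm_cst.
  apply: le_trans (ex_dist P0 bg (bmM bg bc) bd _) _.
    move=> w; have /andP[c0 c1] := c01 w.
    rewrite (_ : g w - g w * c w = g w * (1 - c w)); last by ring.
    by rewrite normrM (ger0_norm (x := 1 - c w)) ?subr_ge0// ler_wpM2r ?subr_ge0.
  rewrite exZ; last by apply: bmB => //; exact: bm_cst.
  by rewrite exB ?ex_cst//; exact: bm_cst.
apply/cvgrPdist_le => e e0.
(* The errors are e' for the cut function, M e' for the mass cut off under [Q] and 2 M e' under [P],
   in all (1 + 3 M) e'; M + 1 leaves a margin. *)
pose e' := e / (1 + 3 * (M + 1)).
have e'0 : 0 < e' by rewrite divr_gt0//; lra.
have [n Hn] : exists n : nat, 1 - \int[Q]_w cut n%:R (U' w, V' w) <= e'.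
  move/cvgrPdist_le : Q1 => /(_ _ e'0)[N _ HN]; exists N.
  exact: le_trans (ler_norm _) (HN N (leqnn N)).
have /cvgrPdist_le/(_ _ e'0) cP := Hcut n%:R.
have /cvgrPdist_le/(_ _ e'0) cf' := Hf n%:R.
near=> t.
have h1 : `|\int[Q]_w cut n%:R (U' w, V' w) - \int[P]_w cut n%:R (U t w, V t w)| <= e'.
  by near: t.
have h2 : `|\int[Q]_w (f (U' w, V' w) * cut n%:R (U' w, V' w)) -
    \int[P]_w (f (U t w, V t w) * cut n%:R (U t w, V t w))| <= e' by near: t.
have h3 := est _ _ Q _ _ bfQ (bQ n%:R) (fun w => cut01 _ _) (fun w => fM _).
have h4 := est _ _ P _ _ (bfP t) (bP t n%:R) (fun w => cut01 _ _) (fun w => fM _).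
have h5 : M * (1 - \int[Q]_w cut n%:R (U' w, V' w)) <= M * e' by rewrite ler_wpM2l.
have h6 : M * (1 - \int[P]_w cut n%:R (U t w, V t w)) <= M * (2 * e').
  by rewrite ler_wpM2l//; move: h1; rewrite ler_norml => /andP[]; lra.
have eE : e = e' + 3 * (M * e') + 3 * e'.
  by rewrite /e'; field; lra.
move: h2 h3 h4; rewrite !ler_norml => /andP[? ?] /andP[? ?] /andP[? ?].
by apply/andP; split; lra.
Unshelve. all: by end_near. Qed.

End cutoff.

(** * Convergence of the centered exponential series *)

Section exponential_moments.
Context (R : realType).
Local Notation mu := (@lebesgue_measure R).

Local Notation Rp := `[(0 : R), +oo[%classic.

(* Dominates x^2 e^(-x) on [0, +oo[. *)
Let maj (x : R) : R := 16 * expR (- (x / 2)).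

Let cvg_half : expR (- (x / 2 : R)) @[x --> +oo] --> (0 : R).
Proof.
apply: (@cvg_comp _ _ _ (fun x : R => x / 2) (fun y => expR (- y)) _ (pinfty_nbhs R)).
  apply/cvgryPge => A; exists (A * 2); split; first by rewrite num_real.
  by move=> x /ltW xA; rewrite ler_pdivlMr.
exact: cvg_expRN.
Qed.

Let continuous_half : continuous (fun x : R => expR (- (x / 2))).
Proof.
move=> x.
have c1 : {for x, continuous (fun y : R => y / 2)}.
  by apply: cvgM; [exact: cvg_id|exact: cvg_cst].
exact: (continuous_comp c1 (@continuous_expRN R _)).
Qed.

Lemma integral_expR_half : (\int[mu]_(x in Rp) (maj x)%:E = 32%:E)%E.
Proof.
rewrite (@ge0_continuous_FTC2y _ _ (fun x => - (32 * expR (- (x / 2)))) 0 0).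
- by rewrite mul0r oppr0 expR0 mulr1 -EFinB sub0r opprK.
- by move=> x _; rewrite mulr_ge0 ?expR_ge0.
- apply: continuous_subspaceT => x.
  by apply: cvgM; [exact: cvg_cst|exact: continuous_half].
- rewrite -oppr0; apply: cvgN; rewrite -[X in _ --> X](mulr0 (32 : R)).
  by apply: cvgM; [exact: cvg_cst|exact: cvg_half].
- by move=> x _; apply: ex_derive.
- apply/cvg_at_right_filter; apply: cvgN; apply: cvgM; first exact: cvg_cst.
  exact: continuous_half.
- move=> x _; rewrite derive1E; apply: derive_val.
  by apply: is_derive_eq; rewrite /GRing.scale/= /maj; field.
Qed.

Let x_le (x : R) : 0 <= x -> x * expR (- x) <= 2 * expR (- (x / 2)).
Proof.
move=> x0; rewrite (_ : expR (- x) = expR (- (x / 2)) * expR (- (x / 2))); last first.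
  by rewrite -expRD; congr expR; field.
rewrite mulrA ler_wpM2r ?expR_ge0// expRN ler_pdivrMr ?expR_gt0//.
by have := expR_ge1Dx (x / 2); lra.
Qed.

(** Squaring x/4 <= e^(x/4) gives x^2 <= 16 e^(x/2), the origin of the 16. The integral of [maj],
    32, thus bounds the second moments of all truncations. *)
Let x2_le (x : R) : 0 <= x -> x ^+ 2 * expR (- x) <= maj x.
Proof.
move=> x0; rewrite /maj (_ : expR (- x) = expR (- (x / 2)) * expR (- (x / 2))); last first.
  by rewrite -expRD; congr expR; field.
rewrite mulrA ler_wpM2r ?expR_ge0// expRN ler_pdivrMr ?expR_gt0//.
have e4 : x / 4 <= expR (x / 4) by have := expR_ge1Dx (x / 4); lra.
rewrite (_ : expR (x / 2) = expR (x / 4) ^+ 2); last first.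
  by rewrite -expRM_natl; congr expR; field.
have : (x / 4) ^+ 2 <= expR (x / 4) ^+ 2 by rewrite lerXn2r// nnegrE ?expR_ge0// divr_ge0.
by rewrite exprMn; lra.
Qed.

Let maj_integrable (g : R -> R) : measurable_fun setT g ->
  (forall x, 0 <= x -> `|g x| <= maj x) -> mu.-integrable Rp (EFin \o g).
Proof.
move=> mg gm.
have mm : measurable_fun setT maj.
  apply: continuous_measurable_fun => x.
  by apply: cvgM; [exact: cvg_cst|exact: continuous_half].
have im : mu.-integrable Rp (EFin \o maj).
  apply/integrableP; split; first by apply/measurable_EFinP; exact: measurable_funTS.
  under eq_integral => x _ do rewrite /= ger0_norm ?mulr_ge0 ?expR_ge0//.
  by rewrite integral_expR_half ltry.
apply: (le_integrable _ _ _ im) => //.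
  by apply/measurable_EFinP; exact: measurable_funTS.
move=> x; rewrite /= in_itv/= andbT => x0; rewrite lee_fin (le_trans (gm _ x0))//.
by rewrite ler_norm.
Qed.

Let mE : measurable_fun setT (fun x : R => expR (- x)).
Proof. exact: continuous_measurable_fun (@continuous_expRN R). Qed.

Let Rmaj : \int[mu]_(x in Rp) maj x = 32.
Proof. by rewrite /Rintegral integral_expR_half. Qed.

Let id_integrable : mu.-integrable Rp (EFin \o (fun x : R => x * expR (- x))).
Proof.
apply: maj_integrable; first exact: measurable_funM.
move=> x x0; rewrite ger0_norm ?mulr_ge0 ?expR_ge0// (le_trans (x_le x0))//.
by rewrite ler_wpM2r ?expR_ge0//; lra.
Qed.

Lemma exponential_mean : \int[mu]_(x in Rp) (x * expR (- x)) = 1.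
Proof.
rewrite (@Rintegral_ge0_continuous_FTC2y _ _ (fun x => - ((x + 1) * expR (- x))) 0 0).
- by rewrite sub0r opprK add0r mul1r oppr0 expR0.
- by move=> x x0; rewrite mulr_ge0 ?expR_ge0.
- apply: continuous_subspaceT => x.
  by apply: cvgM; [exact: cvg_id|exact: continuous_expRN].
- rewrite -oppr0; apply: cvgN.
  have c0 : 2 * expR (- (x / 2)) + expR (- x) @[x --> +oo] --> (2 * 0 + 0 : R).
    by apply: cvgD; [apply: cvgM; [exact: cvg_cst|exact: cvg_half]|exact: cvg_expRN].
  rewrite mulr0 addr0 in c0.
  apply: (@squeeze_cvgr _ _ _ _ (cst 0) _ _ _ 0 (cvg_cst _) c0).
  near=> x; have x0 : 0 <= x by near: x; apply: nbhs_pinfty_ge; rewrite num_real.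
  rewrite mulr_ge0 ?expR_ge0 ?addr_ge0//= mulrDl mul1r lerD2r.
  exact: x_le.
- by move=> x _; apply: ex_derive.
- apply/cvg_at_right_filter; apply: cvgN; apply: cvgM; last exact: continuous_expRN.
  by apply: cvgD; [exact: cvg_id|exact: cvg_cst].
- move=> x _; rewrite derive1E; apply: derive_val.
  by apply: is_derive_eq; rewrite /GRing.scale/=; ring.
Unshelve. all: by end_near. Qed.

Context d (T : measurableType d) (Q : probability T R) (xi : {RV Q >-> R}).
Hypothesis xi_exp : forall A : set R, measurable A ->
  distribution Q xi A = exponential_prob 1 A.

Let clampb (K : R) : bounded_measurable (clamp 0 K).
Proof.
split; first by apply: continuous_measurable_fun; exact: continuous_clamp.
exists `|K| => x; rewrite /clamp; have [K0|K0] := leP 0 K.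
  rewrite ger0_norm; last by rewrite le_min K0 le_max lexx.
  by rewrite (le_trans _ (ler_norm _))// ge_min lexx.
by rewrite min_l// le_max (ltW K0).
Qed.

Let clamp_le (K x : R) : 0 <= K -> 0 <= x -> 0 <= clamp 0 K x <= x.
Proof.
move=> K0 x0; rewrite /clamp le_min K0 le_max lexx/= ge_min.
by rewrite (max_r x0) lexx orbT.
Qed.

Definition truncated_mean (K : R) : R := \int[mu]_(x in Rp) (clamp 0 K x * expR (- x)).

Lemma ex_truncated K : \int[Q]_w clamp 0 K (xi w) = truncated_mean K.
Proof. exact: (ex_exponential xi_exp (clampb K)). Qed.

Lemma ex_truncated_sqr K : 0 <= K -> \int[Q]_w (clamp 0 K (xi w)) ^+ 2 <= 32.
Proof.
move=> K0.
have bs : bounded_measurable (fun x => clamp 0 K x ^+ 2).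
  under eq_fun do rewrite expr2; exact: bmM.
rewrite (ex_exponential xi_exp bs) -Rmaj.
have h x : 0 <= x -> 0 <= clamp 0 K x ^+ 2 * expR (- x) <= maj x.
  move=> x0; have /andP[h1 h2] := clamp_le K0 x0.
  rewrite mulr_ge0 ?exprn_ge0 ?expR_ge0//= (le_trans _ (x2_le x0))//.
  by rewrite ler_wpM2r ?expR_ge0// lerXn2r// nnegrE.
apply: le_Rintegral => //.
- apply: maj_integrable; first by apply: measurable_funM => //; case: bs.
  by move=> x x0; have /andP[h1 h2] := h x x0; rewrite ger0_norm.
- apply: maj_integrable.
    apply: continuous_measurable_fun => x.
    by apply: cvgM; [exact: cvg_cst|exact: continuous_half].
  by move=> x x0; rewrite ger0_norm// mulr_ge0 ?expR_ge0.
- by move=> x; rewrite /= in_itv/= andbT => /h/andP[].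
Qed.

Lemma truncated_mean_cvg : truncated_mean n.+1%:R @[n --> \oo] --> (1 : R).
Proof.
have lo n : 1 - 8 / n.+1%:R <= truncated_mean n.+1%:R <= 1.
  have K0 : 0 < n.+1%:R :> R by [].
  set K := n.+1%:R in K0 *.
  have ic : mu.-integrable Rp (EFin \o (fun x => clamp 0 K x * expR (- x))).
    apply: maj_integrable; first by apply: measurable_funM => //; case: (clampb K).
    move=> x x0; have /andP[h1 h2] := clamp_le (ltW K0) x0.
    rewrite ger0_norm ?mulr_ge0 ?expR_ge0//.
    apply: (@le_trans _ _ (x * expR (- x))); first by rewrite ler_wpM2r ?expR_ge0.
    by rewrite (le_trans (x_le x0))// ler_wpM2r ?expR_ge0//; lra.
  have im : mu.-integrable Rp (EFin \o maj).
    apply: maj_integrable.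
      apply: continuous_measurable_fun => x.
      by apply: cvgM; [exact: cvg_cst|exact: continuous_half].
    by move=> x x0; rewrite ger0_norm// mulr_ge0 ?expR_ge0.
  apply/andP; split; last first.
    rewrite -exponential_mean; apply: le_Rintegral => //.
    move=> x; rewrite /= in_itv/= andbT => x0.
    by rewrite ler_wpM2r ?expR_ge0//; have /andP[] := clamp_le (ltW K0) x0.
  have im4 : mu.-integrable Rp (EFin \o (fun x => (4 * K)^-1 * maj x)).
    rewrite (_ : EFin \o _ = fun x => ((4 * K)^-1%:E * (EFin \o maj) x)%E)//.
    exact: integrableZl.
  (* The minorant is x - x^2 / (4K) <= min(x, K), which for x >= K amounts to (x - 2K)^2 >= 0. With
     the majorant [maj] of x^2 e^(-x), the loss is 32 / (4K) = 8 / K. *)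
  rewrite (_ : 1 - 8 / K = \int[mu]_(x in Rp) (x * expR (- x) - (4 * K)^-1 * maj x)).
    apply: le_Rintegral => //.
      rewrite (_ : EFin \o _ = fun x : R => ((x * expR (- x))%:E -
        ((4 * K)^-1 * maj x)%:E)%E)//.
      exact: integrableB.
    move=> x; rewrite /= in_itv/= andbT => x0.
    rewrite lerBlDr; apply: le_trans (lerD (lexx _) (ler_wpM2l _ (x2_le x0))); last first.
      by rewrite invr_ge0 mulr_ge0// ltW.
    rewrite mulrA -mulrDl ler_wpM2r ?expR_ge0//.
    rewrite /clamp (max_r x0); have [Kx|/ltW xK] := leP K x; last first.
      by rewrite lerDl mulr_ge0 ?sqr_ge0// invr_ge0 mulr_ge0// ltW.
    rewrite -lerBlDl ler_pdivlMl ?mulr_gt0//.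
    by have := sqr_ge0 (x - 2 * K); rewrite !expr2; lra.
  rewrite RintegralB// exponential_mean RintegralZl// Rmaj.
  by field; rewrite gt_eqF.
have c0 : (1 - 8 / n.+1%:R : R) @[n --> \oo] --> (1 - 8 * 0 : R).
  apply: cvgB; first exact: cvg_cst.
  apply: cvgM; first exact: cvg_cst.
  exact: cvg_harmonic.
rewrite mulr0 subr0 in c0.
by apply: (squeeze_cvgr _ c0 (cvg_cst _)); apply: nearW.
Qed.

Lemma exponential_ge0 : {ae Q, forall w, 0 <= xi w}.
Proof.
exists (xi @^-1` `]-oo, 0[); split; first exact: measurable_funPTI.
  transitivity (exponential_prob 1 `]-oo, (0 : R)[); first exact: xi_exp.
  rewrite /exponential_prob; apply: integral0_eq => x; rewrite /= in_itv/= => x0.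
  by rewrite lt0_exponential_pdf.
by move=> w /= /negP; rewrite -ltNge in_itv.
Qed.

End exponential_moments.

Definition centered_block (R : realType) (e : nat -> R) (a b : nat) : R :=
  \sum_(a <= j < b) (e j - 1) / j%:R.

(** The block has 3 k^2 + 3 k + 1 <= 7 k^2 terms, each at most k^(-6). *)
Lemma cube_block_bound (R : realType) k : (0 < k)%N ->
  \sum_((k ^ 3).+1 <= j < (k.+1 ^ 3).+1) (j%:R ^- 2 : R) <= 7 / k%:R ^+ 4.
Proof.
move=> k0; have kR : 0 < k%:R :> R by rewrite ltr0n.
apply: (@le_trans _ _ (\sum_((k ^ 3).+1 <= j < (k.+1 ^ 3).+1) (k%:R ^- 6 : R))).
  rewrite !big_nat; apply: ler_sum => j /andP[kj _].
  rewrite lef_pV2 ?posrE ?exprn_gt0// ?ltr0n; last by lia.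
  rewrite (exprM _ 3 2) lerXn2r// ?nnegrE// ?exprn_ge0//.
  by rewrite -natrX ler_nat ltnW.
rewrite sumr_const_nat subSS -[leLHS]mulr_natl.
have -> : (k.+1 ^ 3 - k ^ 3 = 3 * k ^ 2 + 3 * k + 1)%N by lia.
rewrite ler_pdivlMr ?exprn_gt0// -mulrA (_ : k%:R ^- 6 * k%:R ^+ 4 = k%:R ^- 2); last first.
  by field; rewrite gt_eqF.
rewrite ler_pdivrMr ?exprn_gt0// -natrX -natrM ler_nat; nia.
Qed.

Lemma cube_harmonic_bound (R : realType) k : (0 < k)%N ->
  \sum_((k ^ 3).+1 <= j < (k.+1 ^ 3).+1) (j%:R^-1 : R) <= 7 / k%:R.
Proof.
move=> k0; have kR : 0 < k%:R :> R by rewrite ltr0n.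
apply: (@le_trans _ _ (\sum_((k ^ 3).+1 <= j < (k.+1 ^ 3).+1) (k%:R ^- 3 : R))).
  rewrite !big_nat; apply: ler_sum => j /andP[kj _].
  rewrite lef_pV2 ?posrE ?exprn_gt0// ?ltr0n; last by lia.
  by rewrite -natrX ler_nat ltnW.
rewrite sumr_const_nat subSS -[leLHS]mulr_natl.
have -> : (k.+1 ^ 3 - k ^ 3 = 3 * k ^ 2 + 3 * k + 1)%N by lia.
rewrite ler_pdivlMr// -mulrA (_ : k%:R ^- 3 * k%:R = k%:R ^- 2); last first.
  by field; rewrite gt_eqF.
rewrite ler_pdivrMr ?exprn_gt0// -natrX -natrM ler_nat; nia.
Qed.

(* Between two consecutive cubes the sums of e_j / j are monotone and the
   harmonic sum grows by O(1/k), so convergence along the cubes suffices. *)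
Lemma centered_series_cvg (R : realType) (e : nat -> R) :
  (forall j, (0 < j)%N -> 0 <= e j) ->
  cvgn (series (fun k => `|centered_block e (k.+1 ^ 3).+1 (k.+2 ^ 3).+1|)) ->
  cvgn (fun n => centered_block e 1 n).
Proof.
move=> e0 cabs.
pose D k := centered_block e (k.+1 ^ 3).+1 (k.+2 ^ 3).+1.
have cs : cvgn (series D) by apply: normed_cvg.
have D0 : D k @[k --> \oo] --> 0 by exact: cvg_series_cvg_0.
have cat a b c : (a <= b)%N -> (b <= c)%N ->
    centered_block e a c = centered_block e a b + centered_block e b c.
  by move=> ab bc; rewrite /centered_block (big_cat_nat ab bc).
have cubeS k : (k ^ 3 < k.+1 ^ 3)%N by rewrite ltn_exp2r.
have sD k : centered_block e 1 (k.+1 ^ 3).+1 = centered_block e 1 2 + series D k.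
  elim: k => [|k IH]; first by rewrite /series/= big_geq// addr0.
  rewrite (cat _ (k.+1 ^ 3).+1)//; last by rewrite ltnS ltnW.
  by rewrite IH -addrA; congr (_ + _); rewrite /series/= big_nat_recr.
apply/cvg_ex; exists (centered_block e 1 2 + limn (series D)).
have cs' : centered_block e 1 (k.+1 ^ 3).+1 @[k --> \oo] -->
    centered_block e 1 2 + limn (series D).
  by under eq_fun do rewrite sD; apply: cvgD => //; exact: cvg_cst.
apply/cvgrPdist_le => eps eps0.
have eps3 : 0 < eps / 3 by rewrite divr_gt0.
have /cvgrPdist_le/(_ _ eps3)[K1 _ H1] := cs'.
have /cvgrPdist_le/(_ _ eps3)[K2 _ H2] := D0.
have h7 : 7 / k.+1%:R @[k --> \oo] --> (7 * 0 : R).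
  by apply: cvgM; [exact: cvg_cst|exact: cvg_harmonic].
rewrite mulr0 in h7.
have /cvgrPdist_le/(_ _ eps3)[K3 _ H3] := h7.
pose K := maxn K1 (maxn K2 K3).
exists (K.+1 ^ 3).+1 => // n /= Kn.
have [k [Kk kn nk]] : exists k, [/\ (K <= k)%N, (k.+1 ^ 3 < n)%N & (n <= (k.+2 ^ 3).+1)%N].
  have ex : exists k, (k.+1 ^ 3 < n)%N by exists K.
  have ub k : (k.+1 ^ 3 < n)%N -> (k <= n)%N.
    move=> kn; apply: leq_trans (ltnW kn).
    by apply: leq_trans (leqnSn k) _; rewrite -[leqLHS]expn1 leq_pexp2l.
  case: (ex_maxnP ex ub) => k kn kmax; exists k; split => //.
    exact: kmax.
  by rewrite ltnW// ltnS leqNgt; apply/negP => /kmax; rewrite ltnn.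
have S0 := H1 k (leq_trans (leq_maxl _ _) Kk).
have S1 := H2 k (leq_trans (leq_trans (leq_maxl _ _) (leq_maxr _ _)) Kk).
have S2 := H3 k (leq_trans (leq_trans (leq_maxr _ _) (leq_maxr _ _)) Kk).
have H7 := cube_harmonic_bound R (ltn0Sn k).
have E1 : centered_block e 1 n = centered_block e 1 (k.+1 ^ 3).+1 +
   centered_block e (k.+1 ^ 3).+1 n by rewrite -cat.
have E2 : D k = centered_block e (k.+1 ^ 3).+1 n + centered_block e n (k.+2 ^ 3).+1.
  by rewrite -cat.
(* Nonnegativity of [e] bounds any piece of a block from below by minus its harmonic sum. The same
   bound for the complementary piece, subtracted from the full block [D k], gives the upper
   estimate. *)
have lo a b : (0 < a)%N -> - \sum_(a <= j < b) (j%:R^-1 : R) <= centered_block e a b.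
  move=> a0; rewrite /centered_block -sumrN !big_nat; apply: ler_sum => j /andP[aj _].
  by rewrite mulrBl mul1r lerDr divr_ge0// e0//; lia.
have split7 : \sum_((k.+1 ^ 3).+1 <= j < (k.+2 ^ 3).+1) (j%:R^-1 : R) =
   \sum_((k.+1 ^ 3).+1 <= j < n) (j%:R^-1 : R) + \sum_(n <= j < (k.+2 ^ 3).+1) (j%:R^-1 : R).
  by rewrite -big_cat_nat.
have p1 : 0 <= \sum_((k.+1 ^ 3).+1 <= j < n) (j%:R^-1 : R) by apply: sumr_ge0.
have p2 : 0 <= \sum_(n <= j < (k.+2 ^ 3).+1) (j%:R^-1 : R) by apply: sumr_ge0.
have l1 := lo (k.+1 ^ 3).+1 n isT; have l2 := lo n (k.+2 ^ 3).+1 (leq_ltn_trans (leq0n _) kn).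
move: S0 S1 S2; rewrite /= !sub0r !normrN !ler_norml => /andP[? ?] /andP[? ?] /andP[_ q3].
have := le_trans H7 q3; rewrite split7 => A3le.
rewrite -/(D k) in E2 *; rewrite E1.
by apply/andP; split; lra.
Qed.

Lemma euler_mascheroni_cvg (R : realType) :
  cvgn (fun n : nat => \sum_(1 <= l < n.+1) (l%:R : R)^-1 - ln (n%:R : R)).
Proof.
pose g n : R := \sum_(1 <= l < n.+1) (l%:R : R)^-1 - ln (n%:R : R).
have lnS n : ln (n.+2%:R : R) - ln n.+1%:R <= n.+1%:R^-1.
  rewrite -ln_div ?posrE// (_ : n.+2%:R / n.+1%:R = 1 + n.+1%:R^-1).
    by apply: le_ln1Dx; rewrite (@lt_trans _ _ 0)// ?invr_gt0// oppr_lt0.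
  by rewrite -natr1 mulrDl divff ?pnatr_eq0// mul1r.
have lnS' n : n.+2%:R^-1 <= ln (n.+2%:R : R) - ln n.+1%:R.
  rewrite -lerN2 opprB -ln_div ?posrE//.
  rewrite (_ : n.+1%:R / n.+2%:R = 1 + - n.+2%:R^-1).
    by apply: le_ln1Dx; rewrite ltrN2 invf_lt1 ?ltr0n// ltr1n.
  have -> : n.+1%:R = n.+2%:R - 1 :> R by rewrite -[n.+2%:R]natr1 addrK.
  by rewrite mulrBl divff ?pnatr_eq0// mul1r.
have lnH n : ln (n.+1%:R : R) <= \sum_(1 <= l < n.+1) (l%:R : R)^-1.
  elim: n => [|n IH]; first by rewrite ln1 big_geq.
  rewrite big_nat_recr//=; apply: le_trans (lerD IH (lexx _)).
  by rewrite -lerBlDl.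
(* Monotonicity starts at n = 1, since [ln] takes a default value at 0. *)
have cg : cvgn (fun n => g n.+1).
  apply: nonincreasing_is_cvgn.
    apply/nonincreasing_seqP => n.
    rewrite /g big_nat_recr//= lerBlDr -addrA lerD2l addrC.
    exact: lnS'.
  exists 0 => _ [n _ <-]; rewrite /g big_nat_recr//=.
  by rewrite subr_ge0 (le_trans (lnH n))// lerDl invr_ge0.
apply/cvg_ex; have /cvg_ex[l cl] := cg; exists l.
by move: cl; rewrite cvg_shiftS.
Qed.

Section almost_sure_convergence.
Context (R : realType) d (T : measurableType d) (Q : probability T R).
Variable xi : nat -> {RV Q >-> R}.
Hypothesis xi_indep : independent_family [set n | (0 < n)%N] xi.
Hypothesis xi_exp : unit_exponentials xi.

(** Truncated and recentred, so that products and variances are expectations of bounded functions;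
    the truncation is removed in [ex_min_D]. *)
Let Y (K : nat) j w : R := clamp 0 K.+1%:R (xi j w) - truncated_mean K.+1%:R.

Let bY (K : nat) d' (T' : measurableType d') (f : T' -> R) : measurable_fun setT f ->
  bounded_measurable (fun w => clamp 0 K.+1%:R (f w) - truncated_mean K.+1%:R).
Proof. by move=> mf; apply: bmB; [exact: bm_clamp (ler0n _ _) mf|exact: bm_cst]. Qed.

Let exY K j : (0 < j)%N -> \int[Q]_w Y K j w = 0.
Proof.
move=> j0; rewrite exB ?ex_cst; [|exact: bm_clamp|exact: bm_cst].
by rewrite (ex_truncated (xi_exp j0)) subrr.
Qed.

Let exYY K i j : (0 < i)%N -> (0 < j)%N -> i != j -> \int[Q]_w (Y K i w * Y K j w) = 0.
Proof.
move=> i0 j0 ij.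
have ind := @independent_blocks _ _ _ Q _ _ _ xi _ [set i] [set j] xi_indep.
rewrite (@exM_indep _ _ _ Q (generators xi [set i]) (generators xi [set j])).
- by rewrite exY// mul0r.
- exact: generators_measurable.
- exact: generators_measurable.
- apply: ind; [by move=> _ ->|by move=> _ ->|].
  by rewrite -subset0 => k [-> /eqP]; rewrite (negbTE ij).
- by apply: bY => //; exact: measurable_generators.
- by apply: bY => //; exact: measurable_generators.
Qed.

Let exY2 K j : (0 < j)%N -> \int[Q]_w (Y K j w * Y K j w) <= 32.
Proof.
move=> j0; pose m : R := truncated_mean K.+1%:R.
have bc := bm_clamp (ler0n R K.+1) (measurable_funPT (xi j)).
have -> : \int[Q]_w (Y K j w * Y K j w) =
    \int[Q]_w (clamp 0 K.+1%:R (xi j w) ^+ 2 - (2 * m * clamp 0 K.+1%:R (xi j w) - m ^+ 2)).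
  by apply: eq_Rintegral => w _; rewrite /Y -/m; ring.
have b2 : bounded_measurable (fun w => clamp 0 K.+1%:R (xi j w) ^+ 2).
  by under eq_fun do rewrite expr2; exact: bmM.
have b3 : bounded_measurable (fun w => 2 * m * clamp 0 K.+1%:R (xi j w)) by exact: bmZ.
have b4 : bounded_measurable (fun w : T => m ^+ 2) by exact: bm_cst.
rewrite exB//; last exact: bmB.
rewrite exB// exZ// ex_cst (ex_truncated (xi_exp j0)) -/m.
have := ex_truncated_sqr (xi_exp j0) (ler0n _ K.+1).
by have := sqr_ge0 m; rewrite expr2; lra.
Qed.

Let block K a b w := \sum_(a <= j < b) Y K j w / j%:R.

Let bm_block K a b : bounded_measurable (block K a b).
Proof.
apply: bm_sum => j _; apply: bmM; last exact: bm_cst.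
by apply: bY.
Qed.

(** Distinct [Y] are orthogonal, so second moments add up; each is at most 32 uniformly in the
    truncation. *)
Let ex_block2 K a b : (0 < a)%N ->
  \int[Q]_w (block K a b w * block K a b w) <= 32 * \sum_(a <= j < b) (j%:R ^- 2 : R).
Proof.
move=> a0; elim: b => [|b IH].
  rewrite big_geq// mulr0 (_ : \int[Q]_w _ = 0)//.
  by under eq_Rintegral do rewrite /block big_geq// mul0r; rewrite ex_cst.
have [ab|ba] := leqP a b; last first.
  rewrite big_geq// mulr0 (_ : \int[Q]_w _ = 0)//.
  by under eq_Rintegral do rewrite /block big_geq// mul0r; rewrite ex_cst.
have b0 : (0 < b)%N by lia.
rewrite big_nat_recr//= mulrDr.
have byb : bounded_measurable (Y K b) by apply: bY.
have -> : \int[Q]_w (block K a b.+1 w * block K a b.+1 w) =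
    \int[Q]_w (block K a b w * block K a b w +
      (2 / b%:R * (\sum_(a <= j < b) j%:R^-1 * (Y K j w * Y K b w)) +
       b%:R ^- 2 * (Y K b w * Y K b w))).
  apply: eq_Rintegral => w _.
  have -> : block K a b.+1 w = block K a b w + Y K b w / b%:R.
    by rewrite /block big_nat_recr.
  have -> : \sum_(a <= j < b) j%:R^-1 * (Y K j w * Y K b w) = block K a b w * Y K b w.
    by rewrite /block mulr_suml; apply: eq_bigr => j _; ring.
  have : b%:R != 0 :> R by rewrite pnatr_eq0 -lt0n.
  by move=> bn0; field.
have bs : bounded_measurable (fun w => \sum_(a <= j < b) j%:R^-1 * (Y K j w * Y K b w)).
  by apply: bm_sum => j _; apply: bmZ; apply: bmM => //; apply: bY.
have b1 := bmM (bm_block K a b) (bm_block K a b).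
have b2 := bmZ (2 / b%:R) bs.
have b3 := bmZ (b%:R ^- 2) (bmM byb byb).
rewrite exD//; last exact: bmD.
rewrite exD// exZ// exZ//; last exact: bmM.
rewrite ex_sum; last by move=> j _; apply: bmZ; apply: bmM => //; apply: bY.
rewrite [X in 2 / _ * X]big_nat [X in 2 / _ * X]big1; last first.
  move=> j /andP[aj jb]; rewrite exZ; last by apply: bmM => //; apply: bY.
  by rewrite exYY ?mulr0//; [lia|rewrite neq_ltn jb].
rewrite mulr0 add0r lerD//.
by rewrite mulrC ler_wpM2r ?invr_ge0 ?exprn_ge0// exY2.
Qed.

(** From 2 |x| <= c^(-2) + c^2 x^2 with c = k+1: the second moment is at most 32 * 7 / c^4, which
    yields (1 + 224) / 2 <= 113 over c^2, summable in k. *)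
Let ex_abs_block K k :
  \int[Q]_w `|block K (k.+1 ^ 3).+1 (k.+2 ^ 3).+1 w| <= 113 / k.+1%:R ^+ 2.
Proof.
set a := (k.+1 ^ 3).+1; set b := (k.+2 ^ 3).+1.
have c0 : 0 < k.+1%:R :> R by [].
set c : R := k.+1%:R in c0 *.
have bb := bm_block K a b.
have := @ex_block2 K a b isT; have := cube_block_bound R (ltn0Sn k).
rewrite -/a -/b -/c => h1 h2.
apply: (@le_trans _ _ (\int[Q]_w (2^-1 * (c ^- 2 + c ^+ 2 * (block K a b w * block K a b w))))).
  apply: ex_le; first exact: bm_norm.
    by apply: bmZ; apply: bmD; [exact: bm_cst|apply: bmZ; exact: bmM].
  move=> w; set x := block _ _ _ _.
  have : 0 <= (c^-1 - c * `|x|) ^+ 2 by exact: sqr_ge0.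
  rewrite (_ : _ ^+ 2 = c ^- 2 + c ^+ 2 * (`|x| * `|x|) - 2 * `|x|); last first.
    by field; rewrite gt_eqF.
  rewrite -normrM ger0_norm -?expr2 ?sqr_ge0// subr_ge0 => H.
  by rewrite ler_pdivlMl.
rewrite exZ; last by apply: bmD; [exact: bm_cst|apply: bmZ; exact: bmM].
rewrite exD; [|exact: bm_cst|by apply: bmZ; exact: bmM].
rewrite ex_cst exZ; last exact: bmM.
have h3 : c ^+ 2 * \int[Q]_w (block K a b w * block K a b w) <= 224 / c ^+ 2.
  apply: (@le_trans _ _ (c ^+ 2 * (32 * (7 / c ^+ 4)))).
    by rewrite ler_wpM2l ?sqr_ge0// (le_trans h2)// ler_wpM2l.
  by rewrite le_eqVlt; apply/orP; left; apply/eqP; field; rewrite gt_eqF.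
have h4 : 0 < c ^- 2 by rewrite invr_gt0 exprn_gt0.
rewrite ler_pdivrMl//; apply: le_trans (lerD (lexx _) h3) _.
by rewrite -[X in X + _]mul1r -mulrDl mulrA ler_wpM2r ?(ltW h4)//; lra.
Qed.

Let Dl k w := centered_block (xi ^~ w) (k.+1 ^ 3).+1 (k.+2 ^ 3).+1.

Let mD k : measurable_fun setT (Dl k).
Proof.
apply: measurable_sum => j; apply: measurable_funM => //.
by apply: measurable_funB.
Qed.

Lemma exponential_all_ge0 : {ae Q, forall w j, (0 < j)%N -> 0 <= xi j w}.
Proof.
apply/ae_foralln => j; case: (posnP j) => [->|j0]; first exact: aeW.
by apply: filterS (exponential_ge0 (xi_exp j0)) => w xi0 _.
Qed.

(** The cap [L] permits bounded convergence in [K]: at nonnegative values the truncations are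
    eventually exact, and the truncated means tend to 1. *)
Let ex_min_D (L k : nat) : \int[Q]_w clamp 0 L%:R `|Dl k w| <= 113 / k.+1%:R ^+ 2.
Proof.
have bclamp (f : T -> R) : measurable_fun setT f ->
    bounded_measurable (fun w => clamp 0 L%:R `|f w|).
  by move=> mf; apply: bm_clamp (ler0n _ _) _; exact: measurableT_comp.
have H : \int[Q]_w clamp 0 L%:R `|block K (k.+1 ^ 3).+1 (k.+2 ^ 3).+1 w| @[K --> \oo] -->
    \int[Q]_w clamp 0 L%:R `|Dl k w|.
  apply: (ex_cvg (M := L%:R)).
  - by move=> K; have [mb _] := bm_block K (k.+1 ^ 3).+1 (k.+2 ^ 3).+1; case: (bclamp _ mb).
  - by case: (bclamp _ (mD k)).
  - move=> K w; have /andP[h1 h2] := clamp_bound `|block K (k.+1 ^ 3).+1 (k.+2 ^ 3).+1 w| (ler0n R L).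
    by rewrite ger0_norm.
  - apply: filterS exponential_all_ge0 => w w0.
    apply: continuous_cvg; first exact: continuous_clamp.
    apply: cvg_norm; rewrite /Dl /centered_block /block.
    under eq_fun do rewrite big_nat_cond; rewrite big_nat_cond.
    apply: cvg_big => [|j /andP[/andP[kj _] _]]; first exact: add_continuous.
    have j0 : (0 < j)%N by lia.
    apply: cvgM; last exact: cvg_cst.
    apply: cvgB; last exact: (@truncated_mean_cvg R).
    apply: cvg_near_cst; near=> K.
    rewrite /clamp (max_r (w0 j j0)) min_r//.
    near: K; have [N _ HN] := nbhs_infty_ger (xi j w); exists N => // n /= Nn.
    by rewrite (le_trans (HN _ Nn))// ler_nat.
apply: (cvgr_to_le H); apply: nearW => K.
apply: le_trans (ex_abs_block K k); apply: ex_le.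
- by have [mb _] := bm_block K (k.+1 ^ 3).+1 (k.+2 ^ 3).+1; exact: bclamp.
- exact: bm_norm.
- by move=> w; rewrite /clamp (max_r (normr_ge0 _)) ge_min lexx orbT.
Unshelve. all: by end_near. Qed.

(** Monotone convergence in [L] removes the cap; the integral stays in the extended reals because
    integrability is only a consequence. *)
Let int_D k : (\int[Q]_w (`|Dl k w|)%:E <= (113 / k.+1%:R ^+ 2)%:E)%E.
Proof.
pose g (L : nat) w := (clamp 0 L%:R `|Dl k w|)%:E.
have bg L : bounded_measurable (fun w => clamp 0 L%:R `|Dl k w|).
  by apply: bm_clamp (ler0n _ _) _; exact: measurableT_comp.
have mg L : measurable_fun setT (g L) by apply/measurable_EFinP; case: (bg L).
have g0 L w : setT w -> (0 <= g L w)%E.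
  by rewrite lee_fin; have /andP[] := clamp_bound `|Dl k w| (ler0n R L).
have ndg w : setT w -> nondecreasing_seq (g ^~ w).
  move=> _ m n mn; rewrite lee_fin /clamp (max_r (normr_ge0 _)).
  by rewrite le_min !ge_min lexx orbT ler_nat mn.
have := @cvg_monotone_convergence _ _ _ Q _ measurableT _ mg g0 ndg.
have -> : (fun w => limn (g ^~ w)) = fun w => (`|Dl k w|)%:E.
  apply/funext => w; apply/cvg_lim => //; apply: cvg_near_cst; near=> n.
  rewrite /g /clamp (max_r (normr_ge0 _)) min_r//; near: n; exact: nbhs_infty_ger.
move=> cg; rewrite -(cvg_lim _ cg)//; apply: lime_le; first by apply/cvg_ex; eexists; exact: cg.
apply: nearW => L; rewrite -[X in (X <= _)%E]fineK; last first.
  by apply: integrable_fin_num => //; exact: (bm_integrable Q (bg L)).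
by rewrite lee_fin; exact: ex_min_D.
Unshelve. all: by end_near. Qed.

Lemma sum_inv_sqr n : \sum_(0 <= k < n) (k.+1%:R ^- 2 : R) <= 2.
Proof.
suff H : \sum_(0 <= k < n.+1) (k.+1%:R ^- 2 : R) <= 2 - n.+1%:R^-1.
  apply: (@le_trans _ _ (2 - n.+1%:R^-1)); last by rewrite gerBl invr_ge0.
  by apply: le_trans H; rewrite big_nat_recr//= lerDl invr_ge0 exprn_ge0.
elim: n => [|n IH]; first by rewrite big_nat1 expr1n invr1; lra.
rewrite big_nat_recr//= (le_trans (lerD IH (lexx _)))//.
rewrite -addrA lerD2l addrC -lerBrDr opprK addrC.
have n1 : (0 : R) < n.+1%:R by rewrite ltr0n.
rewrite -[n.+2]addn1 natrD; move: (n.+1%:R : R) n1 => x x0.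
have -> : x^-1 - (x + 1%:R)^-1 = (x * (x + 1))^-1.
  by field; rewrite !gt_eqF// addr_gt0.
by rewrite lef_pV2 ?posrE ?mulr_gt0 ?exprn_gt0 ?addr_gt0// expr2 ler_wpM2r ?lerDl ?addr_ge0// ltW.
Qed.

(** The expected sum of the absolute blocks is at most 113 * 2 = 226, hence the sum is almost surely
    finite, and [centered_series_cvg] passes from cubes to all indices. Dropping the first p terms
    does not affect convergence. *)
Lemma centered_series_ae_cvg p :
  {ae Q, forall w, cvgn (centered_partial_sum p (xi ^~ w))}.
Proof.
have intS : (\int[Q]_w (\sum_(k <oo) (`|Dl k w|)%:E) < +oo)%E.
  rewrite integral_nneseries//; last first.
    by move=> k; apply/measurable_EFinP; apply: measurableT_comp.
  apply: (@le_lt_trans _ _ (226%:E)); last exact: ltry.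
  apply: lime_le; first by apply: is_cvg_nneseries => k _ _; exact: integral_ge0.
  apply: nearW => n.
  apply: (@le_trans _ _ (\sum_(0 <= k < n) (113 / k.+1%:R ^+ 2)%:E)%E).
    by apply: lee_sum => k _; exact: int_D.
  rewrite sumEFin lee_fin -mulr_sumr.
  by apply: le_trans (ler_wpM2l _ (sum_inv_sqr n)) _ => //; lra.
have mS : measurable_fun setT (fun w => \sum_(k <oo) (`|Dl k w|)%:E)%E.
  apply: (@ge0_emeasurable_sum _ _ _ _ (fun k w => (`|Dl k w|)%:E) xpredT) => // k _.
  by apply/measurable_EFinP; exact: measurableT_comp.
have iS : Q.-integrable setT (fun w => \sum_(k <oo) (`|Dl k w|)%:E)%E.
  apply/integrableP; split => //.
  by under eq_integral do rewrite gee0_abs ?nneseries_ge0//.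
have := integrable_ae measurableT iS; have := exponential_all_ge0.
apply: filterS2 => w w0 /(_ I) fS.
have c1 : cvgn (centered_block (xi ^~ w) 1).
  apply: centered_series_cvg => //.
  apply: nondecreasing_is_cvgn.
    by apply/nondecreasing_seqP => n; rewrite /series/= big_nat_recr//= lerDl.
  exists (fine (\sum_(k <oo) (`|Dl k w|)%:E)%E) => _ [n _ <-].
  rewrite -lee_fin fineK// /series/= -sumEFin.
  by apply: nneseries_lim_ge => k _.
have /cvg_ex[l cl] := c1; apply/cvg_ex; exists (l - centered_block (xi ^~ w) 1 p.+1).
have H : centered_block (xi ^~ w) 1 n - centered_block (xi ^~ w) 1 p.+1 @[n --> \oo] -->
    l - centered_block (xi ^~ w) 1 p.+1 by apply: cvgB => //; exact: cvg_cst.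
apply: cvg_trans H; apply: near_eq_cvg; near=> n.
have pn : (p.+1 <= n)%N by near: n; exact: nbhs_infty_ge.
by rewrite /centered_block (@big_cat_nat _ _ _ p.+1)//= addrAC subrr add0r.
Unshelve. all: by end_near. Qed.

End almost_sure_convergence.

(** * Limits of the Renyi sums *)

(** Cauchy's criterion with countable quantifiers only, which exhibits the set of convergence as
    measurable. *)
Lemma cvgnE (R : realType) (s : nat -> R) :
  cvgn s <-> forall k : nat, exists N : nat, forall n : nat, `|s (N + n)%N - s N| <= k.+1%:R^-1.
Proof.
split=> [/cvg_ex[l cl] k|H].
  have k0 : (0 : R) < k.+1%:R^-1 / 2 by rewrite divr_gt0.
  have /cvgrPdist_le/(_ _ k0)[N _ HN] := cl; exists N => n.
  have := ler_distD l (s (N + n)%N) (s N); move=> h; apply: (le_trans h).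
  rewrite [leRHS]splitr lerD//; last by rewrite HN/=.
  by rewrite distrC; apply: HN => /=; rewrite leq_addr.
apply: cauchy_cvg; apply: cauchy_exP => e e0.
have [k _ ke] := near_infty_natSinv_lt (PosNum e0).
have [N HN] := H k; exists (s N); rewrite /ball_/=.
exists N => // n /= Nn; rewrite -ball_normE /ball_/= distrC.
by rewrite -(subnKC Nn) (le_lt_trans (HN _))//; apply: ke => /=.
Qed.

Lemma measurable_limn (R : realType) d (T : measurableType d) (s : nat -> T -> R) :
  (forall n, measurable_fun setT (s n)) -> measurable_fun setT (fun w => limn (s ^~ w)).
Proof.
move=> ms; pose C := [set w | cvgn (s ^~ w)].
have mC : measurable C.
  rewrite (_ : C = \bigcap_k \bigcup_N \bigcap_n
      [set w | `|s (N + n)%N w - s N w| <= k.+1%:R^-1]); last first.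
    apply/seteqP; split=> w /=.
      by move=> /cvgnE H k _; have [N HN] := H k; exists N => // n _; exact: HN.
    by move=> H; apply/cvgnE => k; have [N _ HN] := H k I; exists N => n; exact: (HN n I).
  apply: bigcap_measurable => // k _; apply: bigcup_measurable => N _.
  apply: bigcap_measurable => // n _; rewrite -[X in measurable X]setTI.
  apply: (measurable_fun_le (f := fun w => `|s (N + n)%N w - s N w|) (g := cst (k.+1%:R^-1)) measurableT) => //.
  by apply: measurableT_comp => //; exact: measurable_funB.
(* Off the set of convergence [limn] is the default point; freezing the sequence there at this value
   makes it converge everywhere to [limn]. *)
apply: (@measurable_fun_cvg _ _ _ setT (fun n w => if w \in C then s n w else point)).
  move=> n; apply: measurable_fun_ifT => //; apply: (measurable_fun_bool true); rewrite setTI (_ : _ @^-1` _ = C) //; apply/seteqP; split=> w; rewrite /= ?inE; [exact: set_mem|exact: mem_set].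
move=> w _; case: (boolP (w \in C)) => [|/negP wC].
  by rewrite inE => /= wC.
rewrite dvgP; last by move=> cw; apply: wC; rewrite inE.
exact: cvg_cst.
Qed.

Section renyi_limits.
Context (R : realType).
Implicit Types e k : nat -> R.

(** The almost sure limit of T_j - ln n, split at p rather than at j to match the shape of
    [limit_component]. *)
Definition renyi_limit p e j :=
  \sum_(j <= i < p.+1) e i / i%:R +
  (limn (centered_partial_sum p e) + euler_mascheroni_tail R p).

Lemma renyi_cvg p e j : (0 < j <= p)%N -> cvgn (centered_partial_sum p e) ->
  renyi e n j - ln n%:R @[n --> \oo] --> renyi_limit p e j.
Proof.
move=> /andP[j0 jp] ce.
have H : \sum_(j <= i < p.+1) e i / i%:R + (centered_partial_sum p e n.+1 +
    ((\sum_(1 <= l < n.+1) (l%:R : R)^-1 - ln n%:R) - \sum_(1 <= l < p.+1) (l%:R : R)^-1))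
    @[n --> \oo] --> renyi_limit p e j.
  apply: cvgD; first exact: cvg_cst.
  apply: cvgD; first by rewrite cvg_shiftS.
  by apply: cvgB; [exact: euler_mascheroni_cvg|exact: cvg_cst].
apply: cvg_trans H; apply: near_eq_cvg; near=> n.
have pn : (p.+1 <= n.+1)%N by near: n; exact: nbhs_infty_ge.
rewrite /renyi [in RHS](@big_cat_nat _ _ _ p.+1)//=; last by lia.
rewrite [X in X - ln _](@big_cat_nat _ _ _ p.+1)//=.
rewrite /centered_partial_sum.
have -> : \sum_(p.+1 <= i < n.+1) (e i - 1) / i%:R =
    \sum_(p.+1 <= i < n.+1) e i / i%:R - \sum_(p.+1 <= i < n.+1) (i%:R : R)^-1.
  by rewrite -sumrB; apply: eq_bigr => i _; rewrite mulrBl div1r.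
by ring.
Unshelve. all: by end_near. Qed.

(** Exchanging the sums collects k_1 + ... + k_i in front of x_i; with x_i = e_i / i this produces
    the weight means of the limit. *)
Lemma triangular_sum k (x : nat -> R) p :
  \sum_(1 <= j < p.+1) k j * (\sum_(j <= i < p.+1) x i) =
  \sum_(1 <= i < p.+1) weight_sum k i * x i.
Proof.
elim: p => [|p IH]; first by rewrite !big_geq.
rewrite [RHS]big_nat_recr//= -IH.
rewrite (eq_big_nat _ _ (F2 := fun j => k j * (\sum_(j <= i < p.+1) x i) + k j * x p.+1)); last first.
  by move=> j /andP[_ jp]; rewrite big_nat_recr//= mulrDr.
rewrite big_split/= -mulr_suml big_nat_recr//= [X in k _ * X]big_geq//.
by rewrite mulr0 addr0.
Qed.

Lemma limit_componentE k p e z :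
  limit_component k p e z = \sum_(1 <= j < p.+1) k j * (renyi_limit p e j + ln z).
Proof.
rewrite /limit_component /renyi_limit.
rewrite [RHS](eq_bigr (fun j => k j * (\sum_(j <= i < p.+1) e i / i%:R) +
  k j * (limn (centered_partial_sum p e) + ln z + euler_mascheroni_tail R p))); last first.
  by move=> j _; ring.
rewrite big_split/= -mulr_suml triangular_sum; congr (_ + _).
by apply: eq_bigr => i _; rewrite /weight_mean (mulrC i%:R^-1) mulrAC mulrA.
Qed.

Lemma measurable_renyi_limit d (T : measurableType d) (e : nat -> T -> R) p j :
  (forall i, (0 < i)%N -> measurable_fun setT (e i)) -> (0 < j)%N ->
  measurable_fun setT (fun w => renyi_limit p (e ^~ w) j).
Proof.
move=> me j0; apply: measurable_funD; first exact: (measurable_renyi (n := p) (fun i h => me i (proj1 (andP h)))).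
apply: measurable_funD; last exact: measurable_cst.
apply: measurable_limn => n; apply: measurable_sum_nat => i /andP[pi _].
apply: measurable_funM; last exact: measurable_cst.
by apply: measurable_funB => //; apply: me; exact: leq_trans pi.
Qed.

End renyi_limits.

(** * Tightness of the top Renyi sums *)

Section tightness.
Context (R : realType) d (T : measurableType d) (Q : probability T R).

Lemma bm_bool (A : T -> bool) : measurable_fun setT A ->
  bounded_measurable (fun w => (A w)%:R : R).
Proof.
move=> mA; have -> : (fun w => (A w)%:R : R) = \1_[set w | A w].
  by apply/funext => w; rewrite indicE mem_setE.
apply: bm_indic; rewrite -[X in measurable X]setTI.
exact: (mA measurableT [set true]).
Qed.

Lemma measurable_le_norm (f : T -> R) (L : R) : measurable_fun setT f ->
  measurable_fun setT (fun w => L <= `|f w|).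
Proof. by move=> mf; apply: measurable_fun_ler => //; exact: measurableT_comp. Qed.

(** The limit is finite, so its mass beyond K is small for large K. A continuous clamp carries this
    to the sequence by bounded convergence, which costs 1 in the threshold. *)
Lemma ae_cvg_tight (U_ : nat -> T -> R) (U : T -> R) :
  (forall n, measurable_fun setT (U_ n)) -> measurable_fun setT U ->
  {ae Q, forall w, U_ n w @[n --> \oo] --> U w} ->
  forall e, 0 < e -> exists2 L : R, 0 < L &
    \forall n \near \oo, \int[Q]_w ((L <= `|U_ n w|)%R%:R : R) <= e.
Proof.
move=> mU_ mU cU e e0.
have c01 (x : R) : `|clamp 0 1 x| <= 1.
  by have /andP[h1 h2] := clamp_bound x (@ler01 R); rewrite ger0_norm.
have mnorm (f : T -> R) L : measurable_fun setT f ->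
    measurable_fun setT (fun w => `|f w| - L).
  by move=> mf; apply: measurable_funB => //; exact: measurableT_comp.
have mc (f : T -> R) L : measurable_fun setT f ->
    bounded_measurable (fun w => clamp 0 1 (`|f w| - L)).
  by move=> mf; apply: bm_clamp => //; exact: mnorm.
have e2 : 0 < e / 2 by rewrite divr_gt0.
have cL : \int[Q]_w clamp 0 1 (`|U w| - k%:R) @[k --> \oo] --> \int[Q]_w (0 : R).
  apply: (ex_cvg (M := 1)) => //.
  - by move=> k; have [] := mc U k%:R mU.
  - apply: aeW => w; apply: cvg_near_cst; near=> k.
    rewrite /clamp max_l ?min_r ?subr_le0//; near: k; exact: nbhs_infty_ger.
rewrite ex_cst in cL.
have /cvgrPdist_lt/(_ _ e2)[K _ /(_ K (leqnn K))] := cL.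
rewrite sub0r normrN => HK.
have cn : \int[Q]_w clamp 0 1 (`|U_ n w| - K%:R) @[n --> \oo] -->
    \int[Q]_w clamp 0 1 (`|U w| - K%:R).
  apply: (ex_cvg (M := 1)) => //.
  - by move=> n; have [] := mc _ K%:R (mU_ n).
  - by have [] := mc _ K%:R mU.
  - apply: filterS cU => w cw.
    apply: continuous_cvg; first exact: continuous_clamp.
    by apply: cvgB; [exact: cvg_norm|exact: cvg_cst].
exists (K%:R + 1); first by rewrite ltr_wpDl.
have /cvgrPdist_lt/(_ _ e2) := cn; apply: filterS => n Hn.
apply: (@le_trans _ _ (\int[Q]_w clamp 0 1 (`|U_ n w| - K%:R))).
  apply: ex_le; [by apply: bm_bool; exact: measurable_le_norm|exact: mc|].
  move=> w; case: (boolP (_ <= `|U_ n w|)) => h /=.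
    rewrite /clamp le_min lexx le_max; apply/orP; right.
    by rewrite lerBrDl.
  by have /andP[] := clamp_bound (`|U_ n w| - K%:R) (@ler01 R).
rewrite -[leLHS](subrK (\int[Q]_w clamp 0 1 (`|U w| - K%:R))) [leRHS]splitr.
apply: lerD; last by rewrite (le_trans (ler_norm _))// ltW.
by rewrite (le_trans (ler_norm _))// distrC ltW.
Unshelve. all: by end_near. Qed.

End tightness.

Section sample_sizes.
Context (R : realType).

Lemma near_sample_size (S : nat -> Prop) (a : R) : 0 < a ->
  (\forall n \near \oo, S n) ->
  \forall t \near +oo, forall n : nat, a * t <= n%:R -> S n.
Proof.
move=> a0 [K _ HK]; near=> t.
have Kt : a^-1 * K%:R <= t by near: t; apply: nbhs_pinfty_ge; rewrite num_real.
by move=> n tn; apply: HK => /=; rewrite -(ler_nat R) (le_trans _ tn)// -ler_pdivrMl.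
Unshelve. all: by end_near. Qed.

End sample_sizes.

Lemma measurable_top_within (R : realType) d (T : measurableType d) (X : nat -> T -> R)
    u v p n : (forall j, (0 < j)%N -> measurable_fun setT (X j)) ->
  measurable_fun setT (fun w => top_within u v p (X ^~ w) n).
Proof.
by move=> mX; apply: measurable_and;
  [apply: measurable_fun_ltr|apply: measurable_fun_ler] => //; exact: measurable_order_stat.
Qed.

Section renyi_tightness.
Context (R : realType) d (T : measurableType d) (Q : probability T R).
Variable xi : nat -> {RV Q >-> R}.
Hypothesis xi_indep : independent_family [set n | (0 < n)%N] xi.
Hypothesis xi_exp : unit_exponentials xi.

Lemma renyi_ae_cvg p j : (0 < j <= p)%N ->
  {ae Q, forall w, renyi (xi ^~ w) n j - ln n%:R @[n --> \oo] --> renyi_limit p (xi ^~ w) j}.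
Proof.
move=> jp; apply: filterS (centered_series_ae_cvg xi_indep xi_exp p) => w.
exact: renyi_cvg.
Qed.

Lemma renyi_tight j : (0 < j)%N -> forall e, 0 < e -> exists2 L : R, 0 < L &
  \forall n \near \oo,
    \int[Q]_w ((L <= `|renyi (xi ^~ w) n j - ln n%:R|)%R%:R : R) <= e.
Proof.
move=> j0; apply: (ae_cvg_tight (U := fun w => renyi_limit j (xi ^~ w) j)).
- move=> n; apply: measurable_funB; last exact: measurable_cst.
  by apply: measurable_renyi => // i _.
- by apply: measurable_renyi_limit => // i _.
- by apply: renyi_ae_cvg; rewrite j0 leqnn.
Qed.

Lemma renyi_ae_decreasing : {ae Q, forall w n i, (0 < i)%N ->
  renyi (xi ^~ w) n i.+1 <= renyi (xi ^~ w) n i}.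
Proof.
apply: filterS (exponential_all_ge0 xi_exp) => w w0 n i i0.
rewrite /renyi; case: (ltnP n i) => ni; first by rewrite !big_geq// ltnW.
by rewrite [leRHS]big_ltn// lerDr divr_ge0// w0.
Qed.

Lemma renyi_top_within_tight p (a b e : R) : (0 < p)%N -> 0 < a -> 0 < e ->
  exists2 L : R, 0 < L & forall u v, u <= - L -> L <= v ->
    \forall t \near +oo, forall n : nat, a * t <= n%:R -> n%:R <= b * t ->
      \int[Q]_w ((~~ top_within u v p (fun j => - ln t + renyi (xi ^~ w) n j) n)%:R : R) <= e.
Proof.
move=> p0 a0 e0; have e2 : 0 < e / 2 by rewrite divr_gt0.
have [Lp Lp0 HLp] := renyi_tight p0 e2; have [L1 L10 HL1] := renyi_tight (ltn0Sn 0) e2.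
(* As the Renyi sums decrease in j, only T_p from below and T_1 from above matter. Their bounds
   relative to ln n are shifted by ln n - ln t, which lies between ln a and ln b. *)
exists (Lp + L1 + `|ln a| + `|ln b|); first by rewrite ltr_wpDr// ltr_wpDr// addr_gt0.
move=> u v uL Lv.
have H : \forall n \near \oo, [/\ (p <= n)%N,
    \int[Q]_w ((Lp <= `|renyi (xi ^~ w) n p - ln n%:R|)%R%:R : R) <= e / 2 &
    \int[Q]_w ((L1 <= `|renyi (xi ^~ w) n 1 - ln n%:R|)%R%:R : R) <= e / 2].
  by near=> n; split; near: n => //; exact: nbhs_infty_ge.
have tpos : \forall t \near +oo, (0 : R) < t by apply: nbhs_pinfty_gt; rewrite num_real.
have := near_sample_size a0 H; apply: filterS2 tpos => t t0 Ht n atn nbt.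
have {Ht} [pn Hp H1] := Ht n atn.
have n0 : 0 < n%:R :> R by apply: lt_le_trans atn; rewrite mulr_gt0.
have lna : ln a <= ln n%:R - ln t.
  by rewrite -ln_div ?posrE// ler_ln ?posrE ?divr_gt0// ler_pdivlMr.
have b0 : 0 < b by rewrite -(pmulr_lgt0 _ t0) (lt_le_trans n0).
have lnb : ln n%:R - ln t <= ln b.
  by rewrite -ln_div ?posrE// ler_ln ?posrE ?divr_gt0// ler_pdivrMr.
have mren j : (0 < j)%N -> measurable_fun setT (fun w => renyi (xi ^~ w) n j).
  by move=> j0; apply: measurable_renyi => // i _.
have mrenl j : (0 < j)%N -> measurable_fun setT (fun w => renyi (xi ^~ w) n j - ln n%:R).
  by move=> j0; apply: measurable_funB => //; exact: mren.
pose tw w := (u < - ln t + renyi (xi ^~ w) n p) && (- ln t + renyi (xi ^~ w) n 1 <= v).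
have bmtw : bounded_measurable (fun w => (~~ tw w)%:R : R).
  apply: bm_bool; apply: measurable_neg; apply: measurable_and;
    [apply: measurable_fun_ltr|apply: measurable_fun_ler] => //;
    by apply: measurable_funD => //; exact: mren.
rewrite (@ex_ae _ _ _ _ _ (fun w => (~~ tw w)%:R))//; last first.
- apply: filterS renyi_ae_decreasing => w Hw; rewrite top_within_decreasing ?p0//.
  by move=> i /andP[i0 _]; rewrite lerD2l Hw.
- apply: bm_bool; apply: measurable_neg; apply: measurable_top_within => j j0.
  by apply: measurable_funD => //; exact: mren.
have bmL L j : (0 < j)%N ->
    bounded_measurable (fun w => (L <= `|renyi (xi ^~ w) n j - ln n%:R|)%R%:R : R).
  by move=> j0; apply: bm_bool; apply: measurable_le_norm; exact: mrenl.
apply: (@le_trans _ _ (\int[Q]_w (((Lp <= `|renyi (xi ^~ w) n p - ln n%:R|)%R%:R : R) +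
    (L1 <= `|renyi (xi ^~ w) n 1 - ln n%:R|)%R%:R))); last first.
  by rewrite exD; [rewrite [leRHS]splitr lerD|exact: bmL|exact: bmL].
apply: ex_le => //; first by apply: bmD; exact: bmL.
move=> w; rewrite /tw negb_and -leNgt -ltNge.
have := ler_norm (- ln a); rewrite normrN => na; have nb := ler_norm (ln b).
have na0 := normr_ge0 (ln a); have nb0 := normr_ge0 (ln b).
case: (boolP (Lp <= `|_|)) => hp /=.
  by apply: (@le_trans _ _ 1); [case: (_ || _)|rewrite lerDl].
case: (boolP (L1 <= `|_|)) => h1 /=.
  by apply: (@le_trans _ _ 1); [case: (_ || _)|rewrite lerDr].
move: hp h1; rewrite -!ltNge !ltr_norml => /andP[hp _] /andP[_ h1].
have -> : (- ln t + renyi (xi ^~ w) n p <= u) = false.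
  by apply/negbTE; rewrite -ltNge; lra.
have -> : (v < - ln t + renyi (xi ^~ w) n 1) = false.
  by apply/negbTE; rewrite -leNgt; lra.
by rewrite addr0.
Unshelve. all: by end_near. Qed.

End renyi_tightness.

(** * Comparison of the samples *)

Section sample_comparison.
Context (R : realType).
Context d (T : measurableType d) (P : probability T R) (XY : nat -> {RV P >-> (R * R)%type}).
Hypothesis XY_indep : independent_family [set n | (0 < n)%N] XY.
Hypothesis XY_ident : identically_distributed [set n | (0 < n)%N] XY.
Context (a1 b1 a2 b2 : R -> R).
Hypothesis a1_gt0 : forall t : R, 0 < t -> 0 < a1 t.
Hypothesis a2_gt0 : forall t : R, 0 < t -> 0 < a2 t.
Hypothesis V_cvg : forall e : R, 0 < e -> \forall t \near +oo, forall x y,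
  `|joint_cdf (XY 1) (a1 t * x + b1 t) (a2 t * y + b2 t) `^ t - bigumbel_cdf x y| <= e.
Context d' (T' : measurableType d') (Q : probability T' R).
Variables xi1 xi2 : nat -> {RV Q >-> R}.
Variables (G1 G2 : set (set T')).
Hypotheses (G1m : G1 `<=` measurable) (G2m : G2 `<=` measurable).
Hypothesis G12 : independent_systems Q <<s G1 >> <<s G2 >>.
Hypothesis xi1G : forall j, (0 < j)%N ->
  measurable_fun setT (xi1 j : g_sigma_algebraType G1 -> R).
Hypothesis xi2G : forall j, (0 < j)%N ->
  measurable_fun setT (xi2 j : g_sigma_algebraType G2 -> R).
Hypothesis xi1_indep : independent_family [set n | (0 < n)%N] xi1.
Hypothesis xi2_indep : independent_family [set n | (0 < n)%N] xi2.
Hypothesis xi1_exp : unit_exponentials xi1.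
Hypothesis xi2_exp : unit_exponentials xi2.
Context (k1 k2 : nat -> R) (p q : nat).
Hypotheses (p0 : (0 < p)%N) (q0 : (0 < q)%N).
Context (f : R * R -> R) (M : R).
Hypotheses (cf : continuous f) (fM : forall u, `|f u| <= M) (M0 : 0 < M).
Hypothesis uf : uniform_on_plane f.

Definition top_functional n (x y : nat -> R) : R :=
  f (upper_order_sum k1 p x n, upper_order_sum k2 q y n).

Let off u v n (x y : nat -> R) : R :=
  (~~ (top_within u v p x n && top_within u v q y n))%:R.

Let off_ms1 u v n y : multiset_fun n (off u v n ^~ y).
Proof. by move=> x x' /top_within_perm xx'; rewrite /off xx'. Qed.

Let off_ms2 u v n x : multiset_fun n (off u v n x).
Proof. by move=> y y' /top_within_perm yy'; rewrite /off yy'. Qed.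

Let off_bound u v n x y : `|off u v n x y| <= 1.
Proof. by rewrite /off; case: (~~ _); rewrite ?normr1 ?normr0. Qed.

Let tf_ms1 n y : multiset_fun n (top_functional n ^~ y).
Proof. by move=> x x' /(upper_order_sum_perm k1 p) xx'; rewrite /top_functional xx'. Qed.

Let tf_ms2 n x : multiset_fun n (top_functional n x).
Proof. by move=> y y' /(upper_order_sum_perm k2 q) yy'; rewrite /top_functional yy'. Qed.

Let mnX t j : measurable_fun setT (fun w => normX XY a1 b1 t w j).
Proof.
apply: measurable_funM; last exact: measurable_cst.
apply: measurable_funB; last exact: measurable_cst.
exact: (measurableT_comp measurable_fst (measurable_funPT (XY j))).
Qed.

Let mnY t j : measurable_fun setT (fun w => normY XY a2 b2 t w j).
Proof.
apply: measurable_funM; last exact: measurable_cst.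
apply: measurable_funB; last exact: measurable_cst.
exact: (measurableT_comp measurable_snd (measurable_funPT (XY j))).
Qed.

Lemma bm_top_functional d0 (T0 : measurableType d0) n (X Y : nat -> T0 -> R) :
  (forall j, (0 < j)%N -> measurable_fun setT (X j)) ->
  (forall j, (0 < j)%N -> measurable_fun setT (Y j)) ->
  bounded_measurable (fun w => top_functional n (X ^~ w) (Y ^~ w)).
Proof.
move=> mX mY; apply: bm_continuous_pair => //; first by exists M.
- exact: measurable_upper_order_sum.
- exact: measurable_upper_order_sum.
Qed.

Lemma bm_top_functionalX n t : bounded_measurable (fun w =>
  top_functional n (normX XY a1 b1 t w) (normY XY a2 b2 t w)).
Proof.
by apply: (@bm_top_functional _ _ n (fun j w => normX XY a1 b1 t w j)
  (fun j w => normY XY a2 b2 t w j)) => j _.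
Qed.

Lemma bm_top_functionalQ n t : bounded_measurable (fun w =>
  top_functional n (renyi1 xi1 t n w) (renyi2 xi2 t n w)).
Proof.
apply: (@bm_top_functional _ _ n (fun j w => renyi1 xi1 t n w j)
  (fun j w => renyi2 xi2 t n w j)) => j j0;
  by apply: measurable_funD => //; apply: measurable_renyi => // i _.
Qed.

Section rounding.
Variables (u0 delta omega : R) (m n : nat).
Hypotheses (delta0 : 0 < delta) (pn : (p <= n)%N) (qn : (q <= n)%N).
Local Notation v0 := (level u0 delta m).
Local Notation rho := (round_up u0 delta m).
Hypothesis f_omega : forall x y x' y', `|x - x'| <= abs_weight k1 p * delta ->
  `|y - y'| <= abs_weight k2 q * delta -> `|f (x, y) - f (x', y')| <= omega.
Hypothesis omega0 : 0 <= omega.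

Let lev0 : level u0 delta 0 = u0.
Proof. by rewrite /level mul0r addr0. Qed.

Let off_round x y : off u0 v0 n (rho \o x) (rho \o y) = off u0 v0 n x y.
Proof.
have gt a : (u0 < rho a) = (u0 < a) by rewrite -{1 3}lev0; exact: round_up_gt.
have le a : (rho a <= v0) = (a <= v0) by exact: round_up_le.
have rh : {homo rho : a b / a <= b} by exact: round_up_homo.
by rewrite /off !top_within_homo// ?p0 ?q0.
Qed.

Let tf_round x y :
  `|top_functional n x y - top_functional n (rho \o x) (rho \o y)| <=
  omega + 2 * M * off u0 v0 n x y.
Proof.
have rd a : u0 < a <= v0 -> `|rho a - a| <= delta.
  by rewrite -{1}lev0; exact: round_up_dist.
have rh : {homo rho : a b / a <= b} by exact: round_up_homo.
rewrite /off; case: (boolP (_ && _)) => [/andP[tx ty]|_] /=.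
  rewrite mulr0 addr0 distrC; apply: f_omega.
    by apply: upper_order_sum_round rd tx => //; rewrite p0.
  by apply: upper_order_sum_round rd ty => //; rewrite q0.
rewrite mulr1 (le_trans (ler_normB _ _))//.
by rewrite ler_wpDl// mulr_natl mulr2n lerD//; exact: fM.
Qed.

(** Rounding costs omega + 2 M times the probability of the bad event in each model. That event is
    invariant under rounding, so its probability under [P] is at most that under [Q] plus the
    comparison error D; this adds 2 M D to the M D of the main comparison. *)
Lemma sample_comparison_rounding t :
  `|\int[P]_w top_functional n (normX XY a1 b1 t w) (normY XY a2 b2 t w) -
    \int[Q]_w top_functional n (renyi1 xi1 t n w) (renyi2 xi2 t n w)| <=
  2 * omega + 4 * M * \int[Q]_w off u0 v0 n (renyi1 xi1 t n w) (renyi2 xi2 t n w) +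
  3 * M * (n%:R * cell_discrepancy u0 delta m XY xi1 xi2 a1 b1 a2 b2 t).
Proof.
pose phi := top_functional n.
pose D := n%:R * cell_discrepancy u0 delta m XY xi1 xi2 a1 b1 a2 b2 t.
have cmp theta K := @rounded_comparison _ u0 delta m delta0 _ _ P XY XY_indep XY_ident
  _ _ Q xi1 xi2 G1 G2 G1m G2m G12 xi1G xi2G xi1_indep xi2_indep xi1_exp xi2_exp
  a1 b1 a2 b2 n theta K.
have bP theta := @bm_roundP _ u0 delta m delta0 _ _ P XY a1 b1 a2 b2 n theta.
have bQ theta := @bm_roundQ _ u0 delta m delta0 _ _ Q xi1 xi2 n theta.
have := cmp phi M (@tf_ms1 n) (@tf_ms2 n) (fun x y => fM _) t.
have := cmp (off u0 v0 n) 1 (@off_ms1 u0 v0 n) (@off_ms2 u0 v0 n) (@off_bound u0 v0 n) t.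
have bPphi := bP phi (@tf_ms1 n) (@tf_ms2 n) t.
have bQphi := bQ phi (@tf_ms1 n) (@tf_ms2 n) t.
have bPoff : bounded_measurable (fun w =>
    off u0 v0 n (normX XY a1 b1 t w) (normY XY a2 b2 t w)).
  have := bP _ (@off_ms1 u0 v0 n) (@off_ms2 u0 v0 n) t.
  by under eq_fun do rewrite off_round.
have bQoff : bounded_measurable (fun w =>
    off u0 v0 n (renyi1 xi1 t n w) (renyi2 xi2 t n w)).
  have := bQ _ (@off_ms1 u0 v0 n) (@off_ms2 u0 v0 n) t.
  by under eq_fun do rewrite off_round.
have bX := bm_top_functionalX n t.
have bY := bm_top_functionalQ n t.
under eq_Rintegral do rewrite off_round.
under [X in `|_ - X|]eq_Rintegral do rewrite off_round.
rewrite -/D mul1r => h1 h2.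
have h3 : `|\int[P]_w phi (normX XY a1 b1 t w) (normY XY a2 b2 t w) -
    \int[P]_w phi (rho \o normX XY a1 b1 t w) (rho \o normY XY a2 b2 t w)| <=
    omega + 2 * M * \int[P]_w off u0 v0 n (normX XY a1 b1 t w) (normY XY a2 b2 t w).
  have -> : omega + 2 * M * \int[P]_w off u0 v0 n (normX XY a1 b1 t w) (normY XY a2 b2 t w) =
      \int[P]_w (omega + 2 * M * off u0 v0 n (normX XY a1 b1 t w) (normY XY a2 b2 t w)).
    by rewrite exD ?exZ ?ex_cst//; [exact: bm_cst|exact: bmZ].
  by apply: ex_dist; [by []|by []|apply: bmD; [exact: bm_cst|exact: bmZ]|move=> w; exact: tf_round].
have h4 : `|\int[Q]_w phi (renyi1 xi1 t n w) (renyi2 xi2 t n w) -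
    \int[Q]_w phi (rho \o renyi1 xi1 t n w) (rho \o renyi2 xi2 t n w)| <=
    omega + 2 * M * \int[Q]_w off u0 v0 n (renyi1 xi1 t n w) (renyi2 xi2 t n w).
  have -> : omega + 2 * M * \int[Q]_w off u0 v0 n (renyi1 xi1 t n w) (renyi2 xi2 t n w) =
      \int[Q]_w (omega + 2 * M * off u0 v0 n (renyi1 xi1 t n w) (renyi2 xi2 t n w)).
    by rewrite exD ?exZ ?ex_cst//; [exact: bm_cst|exact: bmZ].
  by apply: ex_dist; [by []|by []|apply: bmD; [exact: bm_cst|exact: bmZ]|move=> w; exact: tf_round].
rewrite -/phi -/D; move: h1 h2 h3 h4.
set A := \int[P]_w _; set B := \int[Q]_w _; set A1 := \int[P]_w _; set B1 := \int[Q]_w _.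
set A2 := \int[P]_w _; set B2 := \int[Q]_w _ => h1 h2 h3 h4.
have h5 : M * A <= M * (B + D).
  by rewrite ler_pM2l// -lerBlDl (le_trans (ler_norm _)).
move: h2 h3 h4; rewrite !ler_norml => /andP[h2 h2'] /andP[h3 h3'] /andP[h4 h4'].
apply/andP; split; lra.
Qed.

End rounding.

Lemma sample_comparison (a b e : R) : 0 < a -> a < b -> 0 < e ->
  \forall t \near +oo, forall n : nat, a * t <= n%:R -> n%:R <= b * t ->
  `|\int[P]_w top_functional n (normX XY a1 b1 t w) (normY XY a2 b2 t w) -
    \int[Q]_w top_functional n (renyi1 xi1 t n w) (renyi2 xi2 t n w)| <= e.
Proof.
move=> a0 ab e0; have b0 : 0 < b := lt_trans a0 ab.
(* The budget is 2 (e/4) for rounding, 4 M times 2 e / (32 M) = e/4 for the bad event, and 3 M times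
   e / (12 M) = e/4 for the discrepancy, whose factor n is at most b t. *)
have e4 : 0 < e / 4 by rewrite divr_gt0.
have [delta' delta'0 Hdelta'] := uf e4.
have aw0 k r : 0 <= abs_weight k r :> R by apply: sumr_ge0.
pose W := abs_weight k1 p + abs_weight k2 q + 1.
have W0 : 0 < W by rewrite ltr_wpDl// addr_ge0.
pose delta := delta' / W.
have delta0 : 0 < delta by rewrite divr_gt0.
have e32 : 0 < e / (32 * M) by rewrite divr_gt0// mulr_gt0.
have [L1 L10 H1] := renyi_top_within_tight xi1_indep xi1_exp b p0 a0 e32.
have [L2 L20 H2] := renyi_top_within_tight xi2_indep xi2_exp b q0 a0 e32.
(* The grid starts at - L with step [delta]; m is taken large enough for it to end beyond L. *)
pose L := L1 + L2; have [m _ Hm] := nbhs_infty_ger (2 * L / delta).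
have mL : L <= level (- L) delta m.
  rewrite /level; have := Hm m (leqnn m); rewrite /= ler_pdivrMr// => h.
  by rewrite addrC lerBrDr -mulr2n -[_ *+ 2]mulr_natl.
have L1L : L1 <= L by rewrite lerDl ltW.
have L2L : L2 <= L by rewrite lerDr ltW.
have := H2 (- L) (level (- L) delta m) _ (le_trans L2L mL); rewrite lerN2 => /(_ L2L).
have := H1 (- L) (level (- L) delta m) _ (le_trans L1L mL); rewrite lerN2 => /(_ L1L).
move=> {}H1 {}H2.
have eD : 0 < e / (12 * M * b) by rewrite divr_gt0// !mulr_gt0.
have := cell_prob_diff_cvg (- L) m delta0 a1_gt0 a2_gt0 V_cvg xi1_exp xi2_exp.
move=> /cvgrPdist_le/(_ _ eD) HD.
have Hn : \forall n \near \oo, (p <= n)%N /\ (q <= n)%N.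
  by near=> n; split; near: n; exact: nbhs_infty_ge.
have Hnt := near_sample_size a0 Hn.
near=> t => n an nb.
have t0 : 0 < t by near: t; apply: nbhs_pinfty_gt; rewrite num_real.
have [pn qn] : (p <= n)%N /\ (q <= n)%N by move: n an {nb}; near: t.
have h1 : \int[Q]_w ((~~ top_within (- L) (level (- L) delta m) p (renyi1 xi1 t n w) n)%:R : R)
    <= e / (32 * M) by move: n an nb {pn qn}; near: t.
have h2 : \int[Q]_w ((~~ top_within (- L) (level (- L) delta m) q (renyi2 xi2 t n w) n)%:R : R)
    <= e / (32 * M) by move: n an nb {pn qn h1}; near: t.
have hD : `|0 - t * cell_discrepancy (- L) delta m XY xi1 xi2 a1 b1 a2 b2 t| <=
    e / (12 * M * b) by near: t; exact: HD.
have f_omega : forall x y x' y', `|x - x'| <= abs_weight k1 p * delta ->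
    `|y - y'| <= abs_weight k2 q * delta -> `|f (x, y) - f (x', y')| <= e / 4.
  have wd w : w <= W -> w * delta <= delta'.
    by move=> wW; rewrite /delta mulrCA -ler_pdivlMl// mulVf ?gt_eqF// ler_pdivrMr// mul1r.
  move=> x y x' y' hx hy; apply: Hdelta'.
    by rewrite (le_trans hx)// wd// /W -addrA lerDl addr_ge0.
  by rewrite (le_trans hy)// wd// /W addrAC lerDr addr_ge0.
apply: le_trans (@sample_comparison_rounding (- L) delta (e / 4) m n delta0 pn qn f_omega (ltW e4) t) _.
set D := cell_discrepancy _ _ _ _ _ _ _ _ _ _ _ in hD *.
have mtw u v r (xi : nat -> {RV Q >-> R}) : bounded_measurable (fun w =>
    (~~ top_within u v r (fun j => - ln t + renyi (xi ^~ w) n j) n)%:R : R).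
  apply: bm_bool; apply: measurable_neg; apply: measurable_top_within => j j0.
  by apply: measurable_funD => //; apply: measurable_renyi => // i _.
have hoff : \int[Q]_w off (- L) (level (- L) delta m) n (renyi1 xi1 t n w) (renyi2 xi2 t n w) <=
    e / (32 * M) + e / (32 * M).
  apply: le_trans (lerD h1 h2); rewrite -exD; [|exact: mtw|exact: mtw].
  apply: ex_le; last first.
  - move=> w; rewrite /off; case: (top_within _ _ p _ _); case: (top_within _ _ q _ _) => //=;
    by rewrite ?addr0 ?add0r ?lerDl.
  - by apply: bmD; exact: mtw.
  - apply: bm_bool; apply: measurable_neg; apply: measurable_and;
    apply: measurable_top_within => j j0;
    by apply: measurable_funD => //; apply: measurable_renyi => // i _.
have hnD : n%:R * D <= e / (12 * M).
  apply: (@le_trans _ _ (b * t * D)).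
    rewrite ler_wpM2r//; exact: sumr_ge0.
  rewrite -mulrA; apply: (@le_trans _ _ (b * (e / (12 * M * b)))).
    by rewrite ler_pM2l// (le_trans (ler_norm _))// -normrN -sub0r.
  by rewrite le_eqVlt; apply/orP; left; apply/eqP; field; rewrite !gt_eqF.
have h3 := ler_wpM2l (_ : 0 <= 4 * M) hoff; have h4 := ler_wpM2l (_ : 0 <= 3 * M) hnD.
apply: (@le_trans _ _ (2 * (e / 4) + 4 * M * (e / (32 * M) + e / (32 * M)) + 3 * M * (e / (12 * M)))).
  by rewrite lerD ?lerD ?h3 ?h4// mulr_ge0// ltW.
by rewrite le_eqVlt; apply/orP; left; apply/eqP; field; rewrite gt_eqF.
Unshelve. all: by end_near. Qed.

End sample_comparison.

(** * The limit as a function of the logarithm of the size ratio *)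

Section limit_functional.
Context (R : realType) d (T : measurableType d) (Q : probability T R).
Variables xi1 xi2 : nat -> {RV Q >-> R}.
Hypothesis xi1_indep : independent_family [set n | (0 < n)%N] xi1.
Hypothesis xi2_indep : independent_family [set n | (0 < n)%N] xi2.
Hypothesis xi1_exp : unit_exponentials xi1.
Hypothesis xi2_exp : unit_exponentials xi2.
Context (k1 k2 : nat -> R) (p q : nat).
Context (f : R * R -> R) (M : R).
Hypotheses (cf : continuous f) (fM : forall u, `|f u| <= M).
Hypothesis uf : uniform_on_plane f.

Let M0 : 0 <= M. Proof. exact: le_trans (fM (0, 0)). Qed.

Definition renyi_component (k : nat -> R) r (e : nat -> R) (l : R) :=
  \sum_(1 <= j < r.+1) k j * (renyi_limit r e j + l).

Definition limit_functional (l : R) : R :=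
  \int[Q]_w f (renyi_component k1 p (xi1 ^~ w) l, renyi_component k2 q (xi2 ^~ w) l).

Lemma measurable_renyi_component d0 (T0 : measurableType d0) k r (e : nat -> T0 -> R)
    (l : T0 -> R) :
  (forall i, (0 < i)%N -> measurable_fun setT (e i)) -> measurable_fun setT l ->
  measurable_fun setT (fun w => renyi_component k r (e ^~ w) (l w)).
Proof.
move=> me ml; apply: measurable_sum_nat => j /andP[j0 _].
apply: measurable_funM; first exact: measurable_cst.
by apply: measurable_funD => //; exact: measurable_renyi_limit.
Qed.

Lemma bm_limit_functional d0 (T0 : measurableType d0) (e1 e2 : nat -> T0 -> R) (l : T0 -> R) :
  (forall i, (0 < i)%N -> measurable_fun setT (e1 i)) ->
  (forall i, (0 < i)%N -> measurable_fun setT (e2 i)) -> measurable_fun setT l ->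
  bounded_measurable (fun w =>
    f (renyi_component k1 p (e1 ^~ w) (l w), renyi_component k2 q (e2 ^~ w) (l w))).
Proof.
by move=> m1 m2 ml; apply: bm_continuous_pair; first by [];
  [exists M|exact: measurable_renyi_component|exact: measurable_renyi_component].
Qed.

Let mxi (xi : nat -> {RV Q >-> R}) i : (0 < i)%N -> measurable_fun setT (xi i).
Proof. by []. Qed.

Lemma renyi_componentB k r e l l' :
  renyi_component k r e l - renyi_component k r e l' = weight_sum k r * (l - l').
Proof.
by rewrite /renyi_component -sumrB /weight_sum mulr_suml; apply: eq_bigr => j _; ring.
Qed.

Lemma limit_functional_uniform e : 0 < e -> exists2 delta, 0 < delta &
  forall l l', `|l - l'| <= delta -> `|limit_functional l - limit_functional l'| <= e.
Proof.
move=> e0; have [delta delta0 H] := uf e0.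
pose W := `|weight_sum k1 p| + `|weight_sum k2 q| + 1.
have W0 : 0 < W by rewrite ltr_wpDl// addr_ge0.
exists (delta / W); first by rewrite divr_gt0.
move=> l l' ll'; rewrite -[leRHS](ex_cst Q).
apply: ex_dist; [| |exact: bm_cst|].
- by apply: (@bm_limit_functional _ _ xi1 xi2 (cst l)).
- by apply: (@bm_limit_functional _ _ xi1 xi2 (cst l')).
move=> w; rewrite ler_pdivlMr// in ll'.
by apply: H; rewrite renyi_componentB normrM (le_trans _ ll')// mulrC ler_wpM2l// /W;
  rewrite -?addrA ?lerDl ?addr_ge0// addrCA lerDl addr_ge0.
Qed.

Lemma limit_functional_le l : `|limit_functional l| <= M.
Proof.
apply: ex_norm_le; last by move=> w; exact: fM.
by apply: (@bm_limit_functional _ _ xi1 xi2 (cst l)).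
Qed.

Lemma continuous_limit_functional : continuous limit_functional.
Proof.
move=> l; apply/cvgrPdist_le => e e0; have [delta delta0 H] := limit_functional_uniform e0.
have : \forall l' \near l, `|l - l'| <= delta.
  by move: (@cvg_id _ (nbhs l)) => /cvgrPdist_le; apply.
by apply: filterS => l' ll'; exact: H.
Qed.

(** Taking l = ln n - ln t in the limit cancels the shift, so the error depends on n only; this
    makes the convergence uniform in t. *)
Let gap k r (xi : nat -> {RV Q >-> R}) n w :=
  \sum_(1 <= j < r.+1) k j * (renyi (xi ^~ w) n j - ln n%:R) -
  renyi_component k r (xi ^~ w) 0.

Let mgap k r xi n : measurable_fun setT (gap k r xi n).
Proof.
apply: measurable_funB; last exact: (@measurable_renyi_component _ _ k r xi (cst 0)).
apply: measurable_sum_nat => j /andP[j0 _].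
apply: measurable_funM; first exact: measurable_cst.
by apply: measurable_funB => //; apply: measurable_renyi => // i _.
Qed.

Let gap_cvg k r xi : independent_family [set n | (0 < n)%N] xi ->
  unit_exponentials xi ->
  forall delta, 0 < delta ->
  \int[Q]_w clamp 0 delta `|gap k r xi n w| @[n --> \oo] --> (0 : R).
Proof.
move=> xi_indep xi_exp delta delta0.
have c0 : clamp 0 delta 0 = 0 by rewrite /clamp maxxx min_r// ltW.
rewrite -[X in _ --> X](ex_cst Q 0); apply: (ex_cvg (M := delta)).
- move=> n; have [] // := @bm_clamp _ _ T 0 delta (fun w => `|gap k r xi n w|) (ltW delta0) _.
  exact: measurableT_comp.
- exact: measurable_cst.
- move=> n w; have /andP[h1 h2] := clamp_bound `|gap k r xi n w| (ltW delta0).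
  by rewrite ger0_norm.
have : {ae Q, forall w, forall j, (0 < j <= r)%N ->
    renyi (xi ^~ w) n j - ln n%:R @[n --> \oo] --> renyi_limit r (xi ^~ w) j}.
  apply: filterS (centered_series_ae_cvg xi_indep xi_exp r) => w cw j jr.
  exact: renyi_cvg.
apply: filterS => w cw; rewrite -[X in _ --> X]c0.
apply: continuous_cvg; first exact: continuous_clamp.
rewrite -[X in _ --> X](@normr0 R R); apply: cvg_norm.
rewrite -(subrr (renyi_component k r (xi ^~ w) 0)); apply: cvgB; last exact: cvg_cst.
under eq_fun do rewrite big_nat_cond; rewrite /renyi_component big_nat_cond.
apply: cvg_big => [|j /andP[jr _]]; first exact: add_continuous.
by rewrite addr0; apply: cvgM; [exact: cvg_cst|apply: cw; lia].
Qed.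

Lemma renyi_functional_cvg e : 0 < e -> \forall n \near \oo, forall t : R,
  `|\int[Q]_w top_functional k1 k2 p q f n (renyi1 xi1 t n w) (renyi2 xi2 t n w) -
    limit_functional (ln n%:R - ln t)| <= e.
Proof.
move=> e0; have e2 : 0 < e / 2 by rewrite divr_gt0.
have [delta delta0 Hd] := uf e2.
(* Where a gap exceeds [delta] its clamp equals [delta], and C times it is the trivial bound 2 M;
   elsewhere uniform continuity gives e/2. *)
pose C := 2 * M / delta.
have C0 : 0 <= C by rewrite divr_ge0 ?mulr_ge0// ltW.
have H : C * (\int[Q]_w clamp 0 delta `|gap k1 p xi1 n w| +
    \int[Q]_w clamp 0 delta `|gap k2 q xi2 n w|) @[n --> \oo] --> C * (0 + 0).
  apply: cvgM; first exact: cvg_cst.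
  by apply: cvgD; exact: gap_cvg.
rewrite addr0 mulr0 in H; have /cvgrPdist_le/(_ _ e2) := H.
move=> {}H; near=> n => t.
have pn : (p <= n)%N by near: n; exact: nbhs_infty_ge.
have qn : (q <= n)%N by near: n; exact: nbhs_infty_ge.
have Hn : `|0 - C * (\int[Q]_w clamp 0 delta `|gap k1 p xi1 n w| +
    \int[Q]_w clamp 0 delta `|gap k2 q xi2 n w|)| <= e / 2 by near: n.
have CE : C * delta = 2 * M by rewrite /C divfK// gt_eqF.
pose U k r (xi : nat -> {RV Q >-> R}) w :=
  \sum_(1 <= j < r.+1) k j * (- ln t + renyi (xi ^~ w) n j).
have mU k r xi : measurable_fun setT (U k r xi).
  apply: measurable_sum_nat => j /andP[j0 _].
  apply: measurable_funM; first exact: measurable_cst.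
  by apply: measurable_funD => //; apply: measurable_renyi => // i _.
have bU : bounded_measurable (fun w => f (U k1 p xi1 w, U k2 q xi2 w)).
  by apply: bm_continuous_pair => //; exists M.
have -> : \int[Q]_w top_functional k1 k2 p q f n (renyi1 xi1 t n w) (renyi2 xi2 t n w) =
    \int[Q]_w f (U k1 p xi1 w, U k2 q xi2 w).
  apply: ex_ae => //.
    apply: (bm_top_functional (M := M) k1 k2 p q cf fM n
      (X := fun j w => renyi1 xi1 t n w j) (Y := fun j w => renyi2 xi2 t n w j)) => j j0;
    by apply: measurable_funD => //; apply: measurable_renyi => // i _.
  have := renyi_ae_decreasing xi1_exp; have := renyi_ae_decreasing xi2_exp.
  apply: filterS2 => w d2 d1; rewrite /top_functional.
  by rewrite !upper_order_sum_decreasing// => i /andP[i0 _]; rewrite lerD2l ?d1 ?d2.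
pose g (k : nat -> R) (r : nat) (xi : nat -> {RV Q >-> R}) w :=
  clamp 0 delta `|gap k r xi n w|.
have bg k r xi : bounded_measurable (g k r xi).
  by apply: bm_clamp; [exact: ltW|exact: measurableT_comp].
have UB k r xi w : U k r xi w - renyi_component k r (xi ^~ w) (ln n%:R - ln t) =
    gap k r xi n w.
  rewrite /U /gap /renyi_component -!sumrB; apply: eq_bigr => j _; ring.
have gE k r xi w : delta < `|gap k r xi n w| -> g k r xi w = delta.
  move=> h; rewrite /g /clamp (max_r (normr_ge0 _)) min_l//; exact: ltW.
have g0 k r xi w : 0 <= g k r xi w.
  by have /andP[] := clamp_bound `|gap k r xi n w| (ltW delta0).
apply: (@le_trans _ _ (\int[Q]_w (e / 2 + C * (g k1 p xi1 w + g k2 q xi2 w)))).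
  apply: ex_dist => //.
  - by apply: (@bm_limit_functional _ _ xi1 xi2 (cst (ln n%:R - ln t))).
  - by apply: bmD; [exact: bm_cst|apply: bmZ; exact: bmD].
  move=> w; have [h1|h1] := leP `|gap k1 p xi1 n w| delta; last first.
    rewrite (gE _ _ _ _ h1) mulrDr CE (le_trans (ler_normB _ _))//.
    rewrite addrCA ler_wpDr//; first by rewrite addr_ge0 ?(ltW e2)// mulr_ge0.
    by rewrite mulr_natl mulr2n lerD.
  have [h2|h2] := leP `|gap k2 q xi2 n w| delta; last first.
    rewrite (gE _ _ _ _ h2) mulrDr CE (le_trans (ler_normB _ _))//.
    rewrite addrA ler_wpDl//; first by rewrite addr_ge0 ?(ltW e2)// mulr_ge0.
    by rewrite mulr_natl mulr2n lerD.
  rewrite (le_trans (Hd _ _ _ _ _ _)) ?UB// lerDl mulr_ge0// addr_ge0//.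
rewrite exD; [|exact: bm_cst|by apply: bmZ; exact: bmD].
rewrite ex_cst exZ; last exact: bmD.
rewrite exD//.
rewrite [leRHS]splitr lerD2l (le_trans (ler_norm _))//.
by move: Hn; rewrite sub0r normrN.
Unshelve. all: by end_near. Qed.

End limit_functional.

(** * Random sample sizes *)

Section random_index.
Context (R : realType) d (T : measurableType d) (P : probability T R).
Context d' (T' : measurableType d') (Q : probability T' R).
Variables (N : R -> {RV P >-> nat}) (Z : {RV Q >-> R}).
Hypothesis Z_gt0 : {ae Q, forall w, 0 < Z w}.
Hypothesis N_cvg : cvg_in_distribution P (fun t w => (N t w)%:R / t) Q Z.

Lemma bm_nat_comp d0 (T0 : measurableType d0) (n : T0 -> nat) (A : nat -> R) M :
  measurable_fun setT n -> (forall i, `|A i| <= M) -> bounded_measurable (fun w => A (n w)).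
Proof.
move=> mn AM; split; last by exists M => w; exact: AM.
by apply: (measurableT_comp _ mn) => ? ? ?.
Qed.

Let mNt t : measurable_fun setT (fun w => (N t w)%:R / t : R).
Proof.
apply: measurable_funM; last exact: measurable_cst.
by apply: (@measurableT_comp _ _ _ _ _ _ (fun n : nat => n%:R : R) _ (N t)) => // ? ? ?.
Qed.

Lemma random_index_continuous_cvg (g : R -> R) M : continuous g -> (forall x, `|g x| <= M) ->
  \int[P]_w g ((N t w)%:R / t) @[t --> +oo] --> \int[Q]_w g (Z w).
Proof.
move=> cg gM; have bg d0 (T0 : measurableType d0) (X : T0 -> R) :
    measurable_fun setT X -> bounded_measurable (fun w => g (X w)).
  move=> mX; split; last by exists M => w; exact: gM.
  by apply: (measurableT_comp _ mX); exact: continuous_measurable_fun.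
have := N_cvg cg (ex_intro _ M gM).
rewrite expectation_bm; last exact: bg.
rewrite (_ : (fun t => _) = fun t => (\int[P]_w g ((N t w)%:R / t))%:E).
  by move/fine_cvg.
by apply/funext => t; rewrite expectation_bm//; exact: (bg _ _ _ (mNt t)).
Qed.

(* A continuous function which is at least 1 off ]a, b + 1[. *)
Let outside (a b z : R) := 1 - clamp 0 1 (z / a - 1) + clamp 0 1 (z - b).

Let clamp01 (x : R) : 0 <= clamp 0 1 x <= 1.
Proof. by apply: clamp_bound. Qed.

Let outside_bound a b z : 0 <= outside a b z <= 2.
Proof.
have /andP[h1 h2] := clamp01 (z / a - 1); have /andP[h3 h4] := clamp01 (z - b).
by rewrite /outside; apply/andP; split; lra.
Qed.

Let outside_ge1 a b z : 0 < a -> (z <= a) || (b + 1 <= z) -> 1 <= outside a b z.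
Proof.
move=> a0; have /andP[h1 h2] := clamp01 (z / a - 1); have /andP[h3 h4] := clamp01 (z - b).
rewrite /outside => /orP[za|bz].
  have -> : clamp 0 1 (z / a - 1) = 0; last by lra.
  by rewrite /clamp max_l ?min_r// subr_le0 ler_pdivrMr// mul1r.
have -> : clamp 0 1 (z - b) = 1; last by lra.
have bz1 : 1 <= z - b by rewrite lerBrDl.
by rewrite /clamp min_l// le_max bz1 orbT.
Qed.

Let continuous_outside a b : continuous (outside a b).
Proof.
move=> z; apply: cvgD; last first.
  apply: continuous_cvg; first exact: continuous_clamp.
  by apply: cvgB; [exact: cvg_id|exact: cvg_cst].
apply: cvgB; first exact: cvg_cst.
apply: continuous_cvg; first exact: continuous_clamp.
apply: cvgB; last exact: cvg_cst.
by apply: cvgM; [exact: cvg_id|exact: cvg_cst].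
Qed.

(** Positivity of [Z] enters here: almost surely Z eventually lies in [2/(k+1), k], where [outside]
    vanishes. *)
Let outside_cvg : \int[Q]_w outside (k.+1%:R^-1) k%:R (Z w) @[k --> \oo] --> (0 : R).
Proof.
rewrite -[X in _ --> X](ex_cst Q 0); apply: (ex_cvg (M := 2)).
- move=> k; apply: (@measurableT_comp _ _ _ _ _ _ (outside _ _)) => //.
  by apply: continuous_measurable_fun; exact: continuous_outside.
- exact: measurable_cst.
- by move=> k w; have /andP[h1 h2] := outside_bound k.+1%:R^-1 k%:R (Z w); rewrite ger0_norm.
apply: filterS Z_gt0 => w z0; apply: cvg_near_cst; near=> k.
have h1 : Z w <= k%:R by near: k; exact: nbhs_infty_ger.
have h2 : 2 / Z w <= k%:R by near: k; exact: nbhs_infty_ger.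
have h3 : 1 <= Z w / k.+1%:R^-1 - 1.
  move: h2; rewrite invrK ler_pdivrMr// lerBrDl => h2.
  by rewrite (le_trans (_ : _ <= 2))// (le_trans h2)// mulrC ler_wpM2l ?ler_nat// ltW.
rewrite /outside {1}/clamp (@min_l _ _ 1) ?subrr ?add0r; last by rewrite le_max h3 orbT.
by rewrite /clamp max_l ?min_r// subr_le0.
Unshelve. all: by end_near. Qed.

Lemma random_index_cvg (A : nat -> R -> R) (G : R -> R) M :
  continuous G -> (forall x, `|G x| <= M) -> (forall n t, `|A n t| <= M) ->
  (forall a b e : R, 0 < a -> a < b -> 0 < e ->
    \forall t \near +oo, forall n : nat, a * t <= n%:R -> n%:R <= b * t ->
    `|A n t - G (ln n%:R - ln t)| <= e) ->
  \int[P]_w A (N t w) t @[t --> +oo] --> \int[Q]_w G (ln (Z w)).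
Proof.
move=> cG GM AM AG; apply/cvgrPdist_le => e e0.
have M0 : 0 <= M := le_trans (normr_ge0 _) (GM 0).
(* The errors are e1 for [Ga], e1 + 2 M (2 e1) for replacing [A] under [P], and 2 M e1 for undoing
   the cut of the logarithm under [Q]; a last e1 is margin. *)
pose e1 := e / (1 + 1 + 6 * M + 1).
have e10 : 0 < e1 by rewrite divr_gt0//; lra.
have /cvgrPdist_le/(_ _ e10)[k _ /(_ k (leqnn k))] := outside_cvg.
pose a : R := k.+1%:R^-1; have a0 : 0 < a by rewrite invr_gt0.
pose b : R := k%:R; rewrite /= -/a -/b sub0r normrN => hk.
have {hk} hZ : \int[Q]_w outside a b (Z w) <= e1 by rewrite (le_trans (ler_norm _)).
(* The range used is up to b + 2 and not b + 1, because for k = 0 one has a = b + 1 = 1. *)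
have ab : a < b + 2.
  by rewrite (@le_lt_trans _ _ 1) ?invf_le1 ?ler1n// ltr_wpDl// ltr1n.
(* The logarithm is cut at a to obtain a continuous function on the whole line; the change is
   confined to z <= a, where [outside] is at least 1. *)
pose Ga z := G (ln (Num.max a z)).
have cGa : continuous Ga.
  move=> z; have c1 : {for z, continuous (fun y : R => Num.max a y : R^o)}.
    exact: (@continuous_max R R (cst a) id z (cvg_cst _) (cvg_id)).
  have c2 : {for Num.max a z, continuous (@ln R)}.
    by apply: continuous_ln; rewrite lt_max a0.
  exact: (continuous_comp (continuous_comp c1 c2) (@cG _)).
have bo z : `|outside a b z| <= 2.
  by have /andP[l0 l2] := outside_bound a b z; rewrite ger0_norm.
have bmo d0 (T0 : measurableType d0) (X : T0 -> R) :
    measurable_fun setT X -> bounded_measurable (fun w => outside a b (X w)).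
  move=> mX; split; last by exists 2 => w; exact: bo.
  by apply: (measurableT_comp _ mX); apply: continuous_measurable_fun; exact: continuous_outside.
have bmG d0 (T0 : measurableType d0) (X : T0 -> R) :
    measurable_fun setT X -> bounded_measurable (fun w => Ga (X w)).
  move=> mX; split; last by exists M => w; exact: GM.
  by apply: (measurableT_comp _ mX); exact: continuous_measurable_fun.
have /cvgrPdist_le/(_ _ e10) c1 := random_index_continuous_cvg (@continuous_outside a b) bo.
have /cvgrPdist_le/(_ _ e10) c2 := random_index_continuous_cvg cGa (fun z => GM _).
have c3 := AG _ _ _ a0 ab e10.
have H4 : `|\int[Q]_w Ga (Z w) - \int[Q]_w G (ln (Z w))| <= 2 * M * e1.
  apply: (@le_trans _ _ (\int[Q]_w (2 * M * outside a b (Z w)))); last first.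
    by rewrite exZ; [rewrite ler_wpM2l// mulr_ge0|exact: bmo].
  apply: ex_dist; [exact: bmG| |by apply: bmZ; exact: bmo|].
    split; last by exists M => w; exact: GM.
    apply: (@measurableT_comp _ _ _ _ _ _ G); first exact: continuous_measurable_fun.
    by apply: measurableT_comp => //; exact: measurable_ln.
  move=> w; have /andP[l0 _] := outside_bound a b (Z w).
  have [za|az] := leP (Z w) a; last first.
    by rewrite /Ga (max_r (ltW az)) subrr normr0 !mulr_ge0.
  have o1 : 1 <= outside a b (Z w) by apply: outside_ge1; rewrite ?za.
  rewrite (le_trans (ler_normB _ _))// (@le_trans _ _ (2 * M))//.
    by rewrite [leRHS]mulr_natl mulr2n lerD//; exact: GM.
  by rewrite ler_peMr// mulr_ge0.
near=> t.
have t0 : 0 < t by near: t; apply: nbhs_pinfty_gt; rewrite num_real.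
have H1 : `|\int[Q]_w outside a b (Z w) - \int[P]_w outside a b ((N t w)%:R / t)| <= e1.
  by near: t.
have H2 : `|\int[Q]_w Ga (Z w) - \int[P]_w Ga ((N t w)%:R / t)| <= e1 by near: t.
have H3 : `|\int[P]_w A (N t w) t - \int[P]_w Ga ((N t w)%:R / t)| <=
    e1 + 2 * M * \int[P]_w outside a b ((N t w)%:R / t).
  have -> : e1 + 2 * M * \int[P]_w outside a b ((N t w)%:R / t) =
      \int[P]_w (e1 + 2 * M * outside a b ((N t w)%:R / t)).
    rewrite [RHS]exD; [|exact: bm_cst|by apply: bmZ; exact: bmo].
    by rewrite ex_cst exZ//; exact: bmo.
  apply: ex_dist.
  - by apply: (@bm_nat_comp _ _ (N t) (A ^~ t) M) => //.
  - exact: bmG.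
  - by apply: bmD; [exact: bm_cst|apply: bmZ; exact: bmo].
  move=> w; have /andP[l0 _] := outside_bound a b ((N t w)%:R / t).
  case: (boolP (((N t w)%:R / t <= a) || (b + 1 <= (N t w)%:R / t))) => h.
    have o1 := outside_ge1 a0 h.
    rewrite ler_wpDl ?(ltW e10)// (le_trans (ler_normB _ _))// (@le_trans _ _ (2 * M))//.
      by rewrite [leRHS]mulr_natl mulr2n lerD//; exact: GM.
    by rewrite ler_peMr// mulr_ge0.
  move: h; rewrite negb_or -!ltNge => /andP[h1 h2].
  rewrite ler_wpDr ?mulr_ge0// /Ga (max_r (ltW h1)).
  have n0 : 0 < (N t w)%:R :> R.
    by rewrite -(pmulr_lgt0 _ (_ : 0 < t^-1)) ?invr_gt0// (lt_trans a0).
  rewrite ln_div ?posrE//.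
  have : a * t <= (N t w)%:R by rewrite -ler_pdivlMr// ltW.
  have : (N t w)%:R <= (b + 2) * t.
    by rewrite -ler_pdivrMr// (le_trans (ltW h2))// lerD2l ler1n.
  by move=> h3 h4; move: (N t w) h4 h3 {l0 h1 h2 n0}; near: t.
have H5 : \int[P]_w outside a b ((N t w)%:R / t) <= 2 * e1.
  by move: H1; rewrite ler_norml => /andP[h1 h2]; lra.
have H6 : 2 * M * \int[P]_w outside a b ((N t w)%:R / t) <= 2 * M * (2 * e1).
  by rewrite ler_wpM2l// mulr_ge0.
have -> : e = e1 + e1 + 6 * M * e1 + e1.
  by rewrite /e1; field; rewrite gt_eqF//; lra.
move: H2 H3 H4; rewrite !ler_norml => /andP[g1 g1'] /andP[g2 g2'] /andP[g3 g3'].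
by apply/andP; split; lra.
Unshelve. all: by end_near. Qed.

End random_index.

(** * Uniform bounds from suprema, subfamilies and random indices *)

Lemma sup_cvg0_near (R : realType) (I : Type) (g : R -> I -> R) :
  ereal_sup (range (fun i => (g t i)%:E)) @[t --> +oo] --> 0%E ->
  forall e : R, 0 < e -> \forall t \near +oo, forall i, g t i <= e.
Proof.
move=> gcvg e e0.
have : \forall t \near +oo, (ereal_sup (range (fun i => (g t i)%:E)) < e%:E)%E.
  apply: (gcvg [set x | (x < e%:E)%E]).
  by apply: open_nbhs_nbhs; split; [exact: open_ereal_lt_ereal|rewrite /= lte_fin].
apply: filterS => t /= sup_lt i; rewrite -lee_fin (le_trans _ (ltW sup_lt))//.
by apply: ereal_sup_ubound; exists i.
Qed.

Lemma independent_family_comp (R : realType) d (T : measurableType d) (P : probability T R)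
    d' (U : measurableType d') (I J : eqType) (D : set I) (D' : set J) (X : I -> {RV P >-> U})
    (h : J -> I) (h' : I -> J) : cancel h h' -> h @` D' `<=` D ->
  independent_family D X -> independent_family D' (X \o h).
Proof.
move=> hK hD ind s A us sD mA.
have mA' i : measurable (A (h' i)) by exact: mA.
have uh : uniq [seq h j | j <- s] by rewrite map_inj_uniq//; exact: can_inj hK.
have sh : [set` [seq h j | j <- s]] `<=` D.
  by move=> _ /mapP[j js ->]; apply: hD; exists j => //; exact: sD.
have := ind _ (A \o h') uh sh mA'; rewrite big_map/=.
under eq_bigr do rewrite hK.
move=> <-; congr (P _); apply/seteqP; split=> w H.
  by move=> _ /mapP[j js ->]/=; rewrite hK; exact: H.
by move=> j js; have := H (h j); rewrite /= hK; apply; exact: map_f.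
Qed.

Lemma independent_systemsC (R : realType) d (T : measurableType d) (P : probability T R)
    (G G' : set (set T)) : independent_systems P G G' -> independent_systems P G' G.
Proof. by move=> ind A B GA GB; rewrite setIC ind// muleC. Qed.

Lemma measurable_index d (T : measurableType d) d' (U : measurableType d')
    (n : T -> nat) (F : nat -> T -> U) :
  measurable_fun setT n -> (forall i, measurable_fun setT (F i)) ->
  measurable_fun setT (fun w => F (n w) w).
Proof.
move=> mn mF _ B mB; rewrite setTI (_ : _ @^-1` _ =
    \bigcup_i (n @^-1` [set i] `&` F i @^-1` B)); last first.
  by apply/seteqP; split=> w /= => [FB|[i _ [<-]]//]; exists (n w).
apply: bigcup_measurable => i _; apply: measurableI.
  by rewrite -[X in measurable X]setTI; exact: mn.
by rewrite -[X in measurable X]setTI; exact: mF.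
Qed.

Section random_index_independence.
Context (R : realType) d (T : measurableType d) (P : probability T R).
Variables G1 G2 : set (set T).
Hypotheses (G1m : G1 `<=` measurable) (G2m : G2 `<=` measurable).
Hypothesis G12 : independent_systems P <<s G1 >> <<s G2 >>.
Local Notation T1 := (g_sigma_algebraType G1).
Local Notation T2 := (g_sigma_algebraType G2).

Lemma ex_random_index (n : T -> nat) (F : nat -> T -> R) M :
  measurable_fun setT (n : T1 -> nat) ->
  (forall i, measurable_fun setT (F i : T2 -> R)) -> (forall i w, `|F i w| <= M) ->
  \int[P]_w F (n w) w = \int[P]_w (\int[P]_v F (n w) v).
Proof.
move=> mn mF FM; apply: (ex_indep_sigma G1m G2m G12 (phi := fun w v => F (n w) v)).
split; last by exists M => z; exact: FM.
apply: (@measurable_index _ (T1 * T2)%type _ _ (fun z => n z.1) (fun i z => F i z.2)).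
  exact: (measurableT_comp mn measurable_fst).
by move=> i; exact: (measurableT_comp (mF i) measurable_snd).
Qed.

End random_index_independence.
Theorem proposition3p2 (R : realType)
    (* the space carrying (X_n, Y_n)_{n >= 1} and N *)
    (d : measure_display) (T : measurableType d) (P : probability T R)
    (XY : nat -> {RV P >-> (R * R)%type})
    (F : R -> R -> R)
    (XY_indep : independent_family [set n | (0 < n)%N] XY)
    (XY_ident : identically_distributed [set n | (0 < n)%N] XY)
    (XY_cdf : forall n, (0 < n)%N -> forall x y, joint_cdf (XY n) x y = F x y)
    (a1 b1 a2 b2 : R -> R)
    (a1_gt0 : forall t : R, 0 < t -> 0 < a1 t)
    (a2_gt0 : forall t : R, 0 < t -> 0 < a2 t)
    (F_cvg : ereal_sup (range (fun xy : R * R =>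
        `| F (a1 t * xy.1 + b1 t) (a2 t * xy.2 + b2 t) `^ t
           - bigumbel_cdf xy.1 xy.2 |%:E)) @[t --> +oo] --> 0%E)
    (N : R -> {RV P >-> nat})
    (N_indep : independent_systems P
       (sigma_generated [set t : R | 0 <= t] N)
       (sigma_generated [set n | (0 < n)%N] XY))
    (* the space carrying Z and the exponential variables E_{j i}, j >= 1 *)
    (d' : measure_display) (T' : measurableType d') (Q : probability T' R)
    (Z : {RV Q >-> R})
    (Z_gt0 : {ae Q, forall w, 0 < Z w})
    (N_cvg : cvg_in_distribution P (fun t w => (N t w)%:R / t) Q Z)
    (E : nat -> 'I_2 -> {RV Q >-> R})
    (E_indep : independent_family
       [set ji : nat * 'I_2 | (0 < ji.1)%N] (fun ji => E ji.1 ji.2))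
    (E_exp : forall (j : nat) (i : 'I_2), (0 < j)%N ->
       forall A : set R, measurable A ->
       distribution Q (E j i) A = exponential_prob 1 A)
    (E_Z_indep : independent_systems Q
       (sigma_generated [set ji : nat * 'I_2 | (0 < ji.1)%N]
          (fun ji => E ji.1 ji.2))
       (sigma_generated [set: unit] (fun=> Z)))
    (p q : nat) (p_gt0 : (0 < p)%N) (q_gt0 : (0 < q)%N)
    (k1 k2 : nat -> R) :
  let S1 t w := upper_order_sum k1 p (fun n => (XY n w).1) (N t w) in
  let S2 t w := upper_order_sum k2 q (fun n => (XY n w).2) (N t w) in
  let c1 := weight_sum k1 p in
  let c2 := weight_sum k2 q in
  let E1 w j := E j ord0 w in
  let E2 w j := E j ord_max w in
  [/\ {ae Q, forall w, cvgn (centered_partial_sum p (E1 w))},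
      {ae Q, forall w, cvgn (centered_partial_sum q (E2 w))} &
      cvg_in_distribution P
        (fun t w => ((S1 t w - b1 t * c1) / a1 t, (S2 t w - b2 t * c2) / a2 t))
        Q
        (fun w => (limit_component k1 p (E1 w) (Z w),
                   limit_component k2 q (E2 w) (Z w)))].
Proof.
move=> S1 S2 c1 c2 E1 E2.
pose EE (ji : nat * 'I_2) := E ji.1 ji.2.
pose DE : set (nat * 'I_2) := [set ji | (0 < ji.1)%N].
pose D1 : set (nat * 'I_2) := [set ji | (0 < ji.1)%N /\ ji.2 = ord0].
pose D2 : set (nat * 'I_2) := [set ji | (0 < ji.1)%N /\ ji.2 = ord_max].
pose xi1 j := E j ord0; pose xi2 j := E j ord_max.
have xi_indep i : independent_family [set n | (0 < n)%N] (fun j => E j i).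
  apply: (@independent_family_comp _ _ _ Q _ _ _ _ DE _ EE (fun j => (j, i)) fst) => //.
  by move=> _ [j j0 <-].
have xi1_indep : independent_family [set n | (0 < n)%N] xi1 by exact: xi_indep.
have xi2_indep : independent_family [set n | (0 < n)%N] xi2 by exact: xi_indep.
have xi1_exp : unit_exponentials xi1 by move=> j; exact: E_exp.
have xi2_exp : unit_exponentials xi2 by move=> j; exact: E_exp.
have G12 : independent_systems Q <<s generators EE D1 >> <<s generators EE D2 >>.
  apply: (independent_blocks E_indep); [by move=> ji []|by move=> ji []|].
  by rewrite -subset0 => ji [[_ h1] [_ h2]]; move: h2; rewrite h1.
have xi1G j : (0 < j)%N ->
    measurable_fun setT (xi1 j : g_sigma_algebraType (generators EE D1) -> R).
  by move=> j0; apply: (@measurable_generators _ _ _ Q _ _ _ EE D1 (j, ord0)).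
have xi2G j : (0 < j)%N ->
    measurable_fun setT (xi2 j : g_sigma_algebraType (generators EE D2) -> R).
  by move=> j0; apply: (@measurable_generators _ _ _ Q _ _ _ EE D2 (j, ord_max)).
have V_cvg e : 0 < e -> \forall t \near +oo, forall x y,
    `|joint_cdf (XY 1) (a1 t * x + b1 t) (a2 t * y + b2 t) `^ t - bigumbel_cdf x y| <= e.
  move=> e0; have := sup_cvg0_near F_cvg e0; apply: filterS => t Ht x y.
  by rewrite XY_cdf//; exact: (Ht (x, y)).
split; [exact: centered_series_ae_cvg|exact: centered_series_ae_cvg|].
pose GN := generators N [set t : R | 0 <= t].
pose GXY := generators XY [set n | (0 < n)%N].
have NG t : 0 <= t -> measurable_fun setT (N t : g_sigma_algebraType GN -> nat).
  by move=> t0; exact: (@measurable_generators _ _ _ P _ _ _ N _ t).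
have XYG j : (0 < j)%N -> measurable_fun setT (XY j : g_sigma_algebraType GXY -> (R * R)%type).
  by move=> j0; exact: (@measurable_generators _ _ _ P _ _ _ XY _ j).
pose GE := generators EE DE; pose GZ := generators (fun _ : unit => Z) setT.
have EG j i : (0 < j)%N -> measurable_fun setT (E j i : g_sigma_algebraType GE -> R).
  by move=> j0; apply: (@measurable_generators _ _ _ Q _ _ _ EE DE (j, i)).
have ZG : measurable_fun setT (Z : g_sigma_algebraType GZ -> R).
  exact: (@measurable_generators _ _ _ Q _ _ _ (fun _ : unit => Z) setT tt).
have mU (pr : R * R -> R) k r (a b c : R) d0 (T0 : measurableType d0) (X : nat -> T0 -> R * R) n :
    measurable_fun setT pr -> (forall j, (0 < j)%N -> measurable_fun setT (X j)) ->
    measurable_fun setT (fun w => (upper_order_sum k r (fun j => pr (X j w)) n - b * c) / a).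
  move=> mpr mX; apply: measurable_funM; last exact: measurable_cst.
  apply: measurable_funB; last exact: measurable_cst.
  apply: (@measurable_upper_order_sum _ _ _ (fun j w => pr (X j w))) => j j0.
  exact: (measurableT_comp mpr (mX j j0)).
have mXY j : (0 < j)%N -> measurable_fun setT (XY j) by [].
pose U t n w := (upper_order_sum k1 p (fun j => (XY j w).1) n - b1 t * c1) / a1 t.
pose V t n w := (upper_order_sum k2 q (fun j => (XY j w).2) n - b2 t * c2) / a2 t.
have mUN t : measurable_fun setT (fun w => U t (N t w) w).
  apply: (@measurable_index _ _ _ _ (N t) (U t)) => // n.
  by apply: mU => //; exact: measurable_fst.
have mVN t : measurable_fun setT (fun w => V t (N t w) w).
  apply: (@measurable_index _ _ _ _ (N t) (V t)) => // n.
  by apply: mU => //; exact: measurable_snd.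
have mxi i j : (0 < j)%N -> measurable_fun setT (E j i) by [].
have mlnZ : measurable_fun setT (fun w => ln (Z w)).
  by apply: measurableT_comp => //; exact: measurable_ln.
have lcE k r w z i : limit_component k r (E ^~ i ^~ w) z =
    renyi_component k r (E ^~ i ^~ w) (ln z).
  exact: limit_componentE.
have mlc k r i : measurable_fun setT (fun w => limit_component k r (E ^~ i ^~ w) (Z w)).
  under eq_fun do rewrite lcE.
  exact: (@measurable_renyi_component _ _ _ k r (E ^~ i)).
move=> f cf [M0 fM0].
rewrite expectation_bm; last by apply: bm_continuous_pair => //; [exists M0|exact: mlc|exact: mlc].
rewrite (_ : (fun t => _) = fun t => (\int[P]_w f (U t (N t w) w, V t (N t w) w))%:E); last first.
  by apply/funext => t; rewrite expectation_bm//;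
    exact: (bm_continuous_pair cf (ex_intro _ M0 fM0) (mUN t) (mVN t)).
apply: cvg_EFin; first exact: nearW.
rewrite (_ : fine \o _ = fun t => \int[P]_w f (U t (N t w) w, V t (N t w) w))//.
apply: (ex_cvg_compact_support (U := fun t w => U t (N t w) w) (V := fun t w => V t (N t w) w)
  (U' := fun w => limit_component k1 p (E1 w) (Z w))
  (V' := fun w => limit_component k2 q (E2 w) (Z w))) => //; [exact: mlc|exact: mlc| |by exists M0].
move=> {cf M0 fM0}f cf [M0 fM0] uf.
(* A strictly positive bound, since the error budgets divide by it. *)
pose M := `|M0| + 1.
have M_gt0 : 0 < M by rewrite ltr_wpDl.
have fM u : `|f u| <= M.
  by rewrite (le_trans (fM0 u))// (le_trans (ler_norm _))// lerDl.
pose A n t := \int[P]_v f (U t n v, V t n v).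
(* Integrating out the exponentials first, by their independence of [Z], leaves a function of ln Z
   alone, within reach of the convergence of N(t) / t. *)
have -> : \int[Q]_w f (limit_component k1 p (E1 w) (Z w), limit_component k2 q (E2 w) (Z w)) =
    \int[Q]_w limit_functional xi1 xi2 k1 k2 p q f (ln (Z w)).
  under eq_Rintegral do rewrite !lcE.
  apply: (@ex_indep_sigma _ _ _ Q GZ GE _ _ (independent_systemsC E_Z_indep)
    (fun w v => f (renyi_component k1 p (xi1 ^~ v) (ln (Z w)),
                   renyi_component k2 q (xi2 ^~ v) (ln (Z w))))).
  - exact: generators_measurable.
  - exact: generators_measurable.
  apply: (@bm_limit_functional _ k1 k2 p q f M cf fM _
    (g_sigma_algebraType GZ * g_sigma_algebraType GE)%type
    (fun j z => xi1 j z.2) (fun j z => xi2 j z.2) (fun z => ln (Z z.1))).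
  - by move=> j j0; exact: (measurableT_comp (EG j ord0 j0) measurable_snd).
  - by move=> j j0; exact: (measurableT_comp (EG j ord_max j0) measurable_snd).
  - apply: measurableT_comp; first exact: measurable_ln.
    exact: (measurableT_comp ZG measurable_fst).
(* Only for t >= 0, the range of times whose sigma-algebra is assumed independent of the sample. *)
have AN : {near +oo, (fun t => \int[P]_w A (N t w) t) =1
    fun t => \int[P]_w f (U t (N t w) w, V t (N t w) w)}.
  near=> t; have t0 : 0 <= t by near: t; apply: nbhs_pinfty_ge; rewrite num_real.
  apply/esym; apply: (@ex_random_index _ _ _ P GN GXY _ _ N_indep (N t)
    (fun n w => f (U t n w, V t n w)) M).
  - exact: generators_measurable.
  - exact: generators_measurable.
  - exact: NG.
  - move=> n; have [] // := @bm_continuous_pair _ _ (g_sigma_algebraType GXY) f (U t n) (V t n) cf.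
    + by exists M.
    + by apply: mU => //; exact: measurable_fst.
    + by apply: mU => //; exact: measurable_snd.
  - by [].
apply: cvg_trans (near_eq_cvg AN) _.
apply: (random_index_cvg Z_gt0 N_cvg (M := M)).
- exact: continuous_limit_functional.
- exact: limit_functional_le.
- move=> n t; apply: ex_norm_le => //; apply: bm_continuous_pair; first by [].
  + by exists M.
  + by apply: mU => //; exact: measurable_fst.
  + by apply: mU => //; exact: measurable_snd.
move=> a b e a0 ab e0; have e2 : 0 < e / 2 by rewrite divr_gt0.
have H1 := sample_comparison XY_indep XY_ident a1_gt0 a2_gt0 V_cvg
  (@generators_measurable _ _ _ Q _ _ _ EE D1) (@generators_measurable _ _ _ Q _ _ _ EE D2)
  G12 xi1G xi2G xi1_indep xi2_indep xi1_exp xi2_exp k1 k2 p_gt0 q_gt0 cf fM M_gt0 uf a0 ab e2.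
have H2 := near_sample_size a0 (renyi_functional_cvg xi1_indep xi2_indep xi1_exp xi2_exp
  k1 k2 p q cf fM uf e2).
have H3 : \forall n \near \oo, (p <= n)%N /\ (q <= n)%N.
  by near=> n; split; near: n; exact: nbhs_infty_ge.
have {}H3 := near_sample_size a0 H3.
near=> t => n an nb.
have t0 : 0 < t by near: t; apply: nbhs_pinfty_gt; rewrite num_real.
have [pn qn] : (p <= n)%N /\ (q <= n)%N by move: n an {nb}; near: t.
have -> : A n t = \int[P]_w top_functional k1 k2 p q f n
    (normX XY a1 b1 t w) (normY XY a2 b2 t w).
  apply: eq_Rintegral => w _; rewrite /top_functional /U /V.
  by rewrite -!upper_order_sum_affine ?a1_gt0 ?a2_gt0.
(* The Renyi model with the same n lies between the sample and the limit; each side costs e/2,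
   uniformly for a t <= n <= b t. *)
pose B := \int[Q]_w top_functional k1 k2 p q f n (renyi1 xi1 t n w) (renyi2 xi2 t n w).
rewrite [leRHS]splitr; apply: le_trans (ler_distD B _ _) (lerD _ _).
  by rewrite /B; move: n an nb {pn qn B}; near: t.
by rewrite /B; move: {t0} n an {nb pn qn B}; near: t; apply: filterS H2 => t H2 n /H2.
Unshelve. all: by end_near. Qed.
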